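(* Fix $\tau\in i\mathbb{R}_{>0}$ and $p\in E_\tau\setminus\{\omega_k/2:k=0,1,2,3\}$ with $\wp(p)\in\mathbb{R}$. Then $\sigma_1,\sigma_2\subset\mathbb{R}\cup i\mathbb{R}$ and $$\sigma_1\cup\sigma_2=\mathbb{R}\cup i\mathbb{R},\qquad \sigma_1\cap\sigma_2=\{T\in\mathbb{C}:Q(T)=0\}.$$ Moreover, writing $a_k=\sqrt{2\wp(p)+e_k}$ when $2\wp(p)+e_k\ge0$ and $b_k=\sqrt{-(2\wp(p)+e_k)}$ when $2\wp(p)+e_k\le0$: (1) If $\wp(p)\in(-\infty,-\frac{e_1}{2})$, then $\sigma_1=(-i\infty,-ib_2]\cup[-ib_3,-ib_1]\cup[ib_1,ib_3]\cup[ib_2,i\infty)$. (2) If $\wp(p)=-\frac{e_1}{2}$, then $\sigma_1=(-i\infty,-ib_2]\cup[-ib_3,ib_3]\cup[ib_2,i\infty)$. (3) If $\wp(p)\in(-\frac{e_1}{2},-\frac{e_3}{2})$, then $\sigma_1=(-i\infty,-ib_2]\cup[-ib_3,ib_3]\cup[ib_2,i\infty)\cup[-a_1,a_1]$. (4) If $\wp(p)=-\frac{e_3}{2}$, then $\sigma_1=(-i\infty,-ib_2]\cup[ib_2,i\infty)\cup[-a_1,a_1]$. (5) If $\wp(p)\in(-\frac{e_3}{2},-\frac{e_2}{2})$, then $\sigma_1=(-i\infty,-ib_2]\cup[ib_2,i\infty)\cup[-a_1,-a_3]\cup[a_3,a_1]$. (6) If $\wp(p)=-\frac{e_2}{2}$,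 then $\sigma_1=i\mathbb{R}\cup[-a_1,-a_3]\cup[a_3,a_1]$. (7) If $\wp(p)\in(-\frac{e_2}{2},+\infty)$, then $\sigma_1=i\mathbb{R}\cup[-a_1,-a_3]\cup[-a_2,a_2]\cup[a_3,a_1]$.
   Context: $\omega_0=0,\omega_1=1,\omega_2=\tau,\omega_3=1+\tau$, $\Lambda_\tau=\mathbb{Z}\oplus\mathbb{Z}\tau$, $E_\tau=\mathbb{C}/\Lambda_\tau$; $\wp,\zeta$ are the Weierstrass functions of $\Lambda_\tau$, $e_k=e_k(\tau)=\wp(\omega_k/2)$; for $\tau\in i\mathbb{R}_{>0}$ one has $e_1>e_3>e_2$. Intervals such as $[ia,ib]$ and $(-i\infty,-ib]$ denote segments and rays of the imaginary axis. $$q(z;T)=2\wp(z)+\tfrac34(\wp(z+p)+\wp(z-p))+T(\zeta(z+p)+\zeta(z-p)-2\zeta(z))-\frac{\wp''(p)}{4\wp'(p)}(\zeta(z+p)-\zeta(z-p))+B,$$ $B=T^2+\frac{\wp''(p)}{2\wp'(p)}\zeta(p)-\frac12\wp(p)$, $T\in\mathbb{C}$. The spectral polynomial is $Q(T)=-4\prod_{k=1}^3(T^2-2\wp(p)-e_k)$. Fix $z_0\in\mathbb{C}$ such that $x\mapsto q(x+z_0;T)$ is smooth on $\mathbb{R}$ and on $\tau\mathbb{R}$. The spectral set $\sigma_1$ (resp. $\sigma_2$) is the set of $T\in\mathbb{C}$ for which $y''(x)=q(x+z_0;T)y(x)$ has a nontrivial bounded solution on $\mathbb{R}$ (resp. on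 $\tau\mathbb{R}$). *)

(* Defs.v *)
From Stdlib Require Import Reals ZArith.
From Coquelicot Require Import Coquelicot.

Local Open Scope C_scope.

(** * The lattice [Z + Z tau] and its Weierstrass functions *)

Definition lattice_point (tau : C) (m n : Z) : C := IZR m + IZR n * tau.

Definition in_lattice (tau z : C) : Prop :=
  exists m n : Z, z = lattice_point tau m n.

(** [omega tau k] is meant for [k <= 3] only. *)
Definition omega (tau : C) (k : nat) : C :=
  match k with
  | 0%nat => 0
  | 1%nat => 1
  | 2%nat => tau
  | _ => 1 + tau
  end.

(** Sum of [a m n] over [-N <= m, n <= N]. *)
Definition square_sum (a : Z -> Z -> C) (N : nat) : C :=
  sum_n (fun i => sum_n (fun j =>
    a (Z.of_nat i - Z.of_nat N)%Z (Z.of_nat j - Z.of_nat N)%Z)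
    (2 * N)) (2 * N).

(** Sum of [f] over the nonzero lattice points.  The two series below converge
    absolutely, so that summing along growing squares is not a restriction. *)
Definition lattice_sum (tau : C) (f : C -> C) : C :=
  let a (m n : Z) : C :=
    if (Z.eqb m 0 && Z.eqb n 0)%bool then 0 else f (lattice_point tau m n) in
  (real (Lim_seq (fun N => Re (square_sum a N))),
   real (Lim_seq (fun N => Im (square_sum a N)))).

(** Both functions take an irrelevant value at the lattice points, as [/ 0] is
    a total expression. *)
Definition wp (tau z : C) : C :=
  1 / z ^ 2 + lattice_sum tau (fun w => 1 / (z - w) ^ 2 - 1 / w ^ 2).

Definition wzeta (tau z : C) : C :=
  1 / z + lattice_sum tau (fun w => 1 / (z - w) + 1 / w + z / w ^ 2).

Definition wp' (tau : C) : C -> C := C_derive (wp tau).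

Definition wp'' (tau : C) : C -> C := C_derive (wp' tau).

Definition e (tau : C) (k : nat) : C := wp tau (omega tau k / 2).

(** * The potential and the spectral polynomial

    A point of the torus [C / (Z + Z tau)] is given by a representative [p];
    [q] does not depend on its choice. *)

Definition Bconst (tau p T : C) : C :=
  T ^ 2 + wp'' tau p / (2 * wp' tau p) * wzeta tau p - 1 / 2 * wp tau p.

Definition q (tau p T z : C) : C :=
  2 * wp tau z + 3 / 4 * (wp tau (z + p) + wp tau (z - p))
  + T * (wzeta tau (z + p) + wzeta tau (z - p) - 2 * wzeta tau z)
  - wp'' tau p / (4 * wp' tau p) * (wzeta tau (z + p) - wzeta tau (z - p))
  + Bconst tau p T.

Definition Qpoly (tau p T : C) : C :=
  - 4 * ((T ^ 2 - 2 * wp tau p - e tau 1)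
         * (T ^ 2 - 2 * wp tau p - e tau 2)
         * (T ^ 2 - 2 * wp tau p - e tau 3)).

(** * Functions on the line [w R] *)

Definition on_line (w x : C) : Prop := exists t : R, x = w * t.

(** [f] has derivative [l] at [x] with respect to the complex variable, for
    increments in [w R]: [(f (x + w t) - f x) / (w t)] tends to [l] as the real
    number [t] tends to 0.  Only meant for [w <> 0]. *)
Definition is_line_derive (w : C) (f : C -> C) (x l : C) : Prop :=
  @is_derive R_AbsRing C_R_NormedModule
    (fun t : R => f (x + w * t)) 0%R (w * l).

Definition smooth_on_line (w : C) (f : C -> C) : Prop :=
  exists D : nat -> C -> C,
    (forall x, on_line w x -> D 0%nat x = f x) /\
    (forall n x, on_line w x -> is_line_derive w (D n) x (D (S n) x)).

Definition solves_on_line (w : C) (V y : C -> C) : Prop :=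
  exists dy : C -> C,
    forall x, on_line w x ->
      is_line_derive w y x (dy x) /\ is_line_derive w dy x (V x * y x).

Definition bounded_on_line (w : C) (y : C -> C) : Prop :=
  exists M : R, forall x, on_line w x -> (Cmod (y x) <= M)%R.

Definition nontrivial_on_line (w : C) (y : C -> C) : Prop :=
  exists x, on_line w x /\ y x <> 0.

(** * The spectral sets *)

Definition spectral_set (w tau p z0 T : C) : Prop :=
  exists y : C -> C,
    solves_on_line w (fun x => q tau p T (x + z0)) y /\
    nontrivial_on_line w y /\ bounded_on_line w y.

Definition sigma1 (tau p z0 : C) : C -> Prop := spectral_set 1 tau p z0.

Definition sigma2 (tau p z0 : C) : C -> Prop := spectral_set tau tau p z0.

(** For purely imaginary [tau] the [e tau k] are real; [Re] is only there to
    view them, and [wp tau p], in [R].  [sqrt] is 0 on negative numbers, so that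
    [a] and [b] are meaningful only where the argument is nonnegative. *)
Definition a (tau p : C) (k : nat) : R :=
  sqrt (2 * Re (wp tau p) + Re (e tau k)).

Definition b (tau p : C) (k : nat) : R :=
  sqrt (- (2 * Re (wp tau p) + Re (e tau k))).

(** * Subsets of the two axes *)

Definition real_axis (T : C) : Prop := Im T = 0%R.

Definition imag_axis (T : C) : Prop := Re T = 0%R.

(** [[x, y]] *)
Definition real_seg (x y : R) (T : C) : Prop :=
  Im T = 0%R /\ (x <= Re T <= y)%R.

(** [[i x, i y]] *)
Definition imag_seg (x y : R) (T : C) : Prop :=
  Re T = 0%R /\ (x <= Im T <= y)%R.

(** [(- i oo, i y]] *)
Definition imag_ray_below (y : R) (T : C) : Prop :=
  Re T = 0%R /\ (Im T <= y)%R.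

(** [[i x, i oo)] *)
Definition imag_ray_above (x : R) (T : C) : Prop :=
  Re T = 0%R /\ (x <= Im T)%R.

(* Main.v *)
Require Import Defs.
From Stdlib Require Import Reals Ranalysis5 ZArith Lra Lia Psatz ClassicalEpsilon.
From Coquelicot Require Import Coquelicot.

(** Put [lam = T ^ 2 - 2 wp p] and [D = wp - wp p].  The potential [q] is built so
    that [y = (w' - T w) / sqrt D] turns the solutions [w] of the Lame equation
    [w'' = (2 wp + lam) w] into solutions of [y'' = q y]; the inverse is
    [w = (u' + T u) / (2 D)] with [u = y sqrt D].  On a line on which [q] is smooth,
    [D] has neither zeros nor poles, and both maps preserve boundedness
    ([spectral_iff_lame]).  Each spectral set is thus the preimage under
    [T -> T ^ 2 - 2 wp p] of the spectral set of the Lame equation.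

    For the latter, write [lam = wp a].  The function
    [sigma (z - a) / sigma z * exp (zeta a z)] solves the Lame equation, and over
    the period [om] it is multiplied by [exp (om zeta a - eta om a)].  If the modulus of
    this multiplier is 1 there is a bounded solution; otherwise a Wronskian
    argument shows that there is none ([lame_bdd_iff]).  This
    needs a line on which the function has no zeros; a Darboux transformation,
    which translates the line without changing [lam], provides one.

    The real part of [om zeta a - eta om a] is harmonic and doubly periodic; it
    vanishes on the axis orthogonal to [om] and on its translate by [om / 2],
    and it is positive in between by the minimum principle, since its only
    singularity, at 0, is positive there ([exponent_zero_iff]).  So the
    multiplier has modulus 1 exactly when [a] lies on one of these lines, and
    [wp] maps them onto the bands with end points [e_k] ([band1_iff],
    [band2_iff]).

    The facts about [wp] and [zeta] come from Liouville's theorem, which rests on the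
    mean value property over circles.  It yields the identity
    [(zeta x + zeta y + zeta z) ^ 2 = wp x + wp y + wp z] for [x + y + z = 0]
    ([squared_addition]).  Differentiating gives the addition theorem and
    [wp'' = 6 wp ^ 2 + b]; uniqueness for this differential equation makes [wp]
    injective up to sign and periods, and Liouville's theorem once more makes it
    surjective. *)

Local Open Scope C_scope.

Implicit Types z w l c : C.

(** * Complex numbers *)

Lemma C_ext (z w : C) : Re z = Re w -> Im z = Im w -> z = w.
Proof. destruct z, w; simpl; intros; subst; reflexivity. Qed.

Lemma Re_plus z w : Re (z + w) = (Re z + Re w)%R. Proof. reflexivity. Qed.
Lemma Im_plus z w : Im (z + w) = (Im z + Im w)%R. Proof. reflexivity. Qed.
Lemma Re_opp z : Re (- z) = (- Re z)%R. Proof. reflexivity. Qed.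
Lemma Im_opp z : Im (- z) = (- Im z)%R. Proof. reflexivity. Qed.
Lemma Re_minus z w : Re (z - w) = (Re z - Re w)%R. Proof. reflexivity. Qed.
Lemma Im_minus z w : Im (z - w) = (Im z - Im w)%R. Proof. reflexivity. Qed.
Lemma Re_mult z w : Re (z * w) = (Re z * Re w - Im z * Im w)%R. Proof. reflexivity. Qed.
Lemma Im_mult z w : Im (z * w) = (Re z * Im w + Im z * Re w)%R. Proof. reflexivity. Qed.
Lemma Re_RtoC r : Re (RtoC r) = r. Proof. reflexivity. Qed.
Lemma Im_RtoC r : Im (RtoC r) = 0%R. Proof. reflexivity. Qed.

#[export] Hint Rewrite Re_plus Im_plus Re_opp Im_opp Re_minus Im_minus Re_mult Im_mult Re_RtoC Im_RtoC : cre.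

Lemma im_le_Cmod (z : C) : (Rabs (Im z) <= Cmod z)%R.
Proof.
  eapply Rle_trans; [|apply (Rmax_Cmod z)]. apply Rmax_r.
Qed.

Lemma Cmod_le_Re_Im (z : C) : (Cmod z <= Rabs (Re z) + Rabs (Im z))%R.
Proof.
  replace z with (RtoC (Re z) + Ci * RtoC (Im z)).
  - eapply Rle_trans; [apply Cmod_triangle|].
    rewrite Cmod_mult, Cmod_Ci, !Cmod_R, Rmult_1_l. autorewrite with cre. simpl.
    apply Req_le. f_equal; f_equal; ring.
  - apply C_ext; simpl; ring.
Qed.

Lemma Cmod_sub_sym (z w : C) : Cmod (z - w) = Cmod (w - z).
Proof. rewrite <- Cmod_opp. f_equal. ring. Qed.

Lemma Cmod_triangle_sub (z w : C) : (Cmod z - Cmod w <= Cmod (z - w))%R.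
Proof.
  assert (H := Cmod_triangle (z - w) w). replace (z - w + w) with z in H by ring. lra.
Qed.

Lemma Csub_neq (z w : C) : z <> w -> z - w <> 0.
Proof. intros H E. apply H. replace z with ((z - w) + w) by ring. rewrite E. ring. Qed.

(** * Continuity and differentiability of complex-valued functions *)

Section Calculus.
Context {X : Type}.
Implicit Types f g : X -> C.

(** The distance is a parameter, so that the same rules serve functions on R, on
    C and on R * R. *)
Definition cont (d : X -> X -> R) (f : X -> C) (x : X) : Prop :=
  forall eps, (0 < eps)%R -> exists del, (0 < del)%R /\
    forall y, (d x y < del)%R -> (Cmod (f y - f x) < eps)%R.

Variable d : X -> X -> R.

Lemma cont_const c x : cont d (fun _ => c) x.
Proof.
  intros eps He. exists 1%R. split; [lra|]. intros.
  replace (c - c) with (RtoC 0) by ring. now rewrite Cmod_0.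
Qed.

Lemma cont_plus f g x : cont d f x -> cont d g x -> cont d (fun y => f y + g y) x.
Proof.
  intros Hf Hg eps He.
  destruct (Hf (eps/2)%R) as [d1 [H1 F1]]; [lra|].
  destruct (Hg (eps/2)%R) as [d2 [H2 F2]]; [lra|].
  exists (Rmin d1 d2). split; [now apply Rmin_pos|]. intros y Hy.
  replace (f y + g y - (f x + g x)) with ((f y - f x) + (g y - g x)) by ring.
  assert (A := F1 y (Rlt_le_trans _ _ _ Hy (Rmin_l _ _))).
  assert (B := F2 y (Rlt_le_trans _ _ _ Hy (Rmin_r _ _))).
  assert (T := Cmod_triangle (f y - f x) (g y - g x)). lra.
Qed.

Lemma cont_opp f x : cont d f x -> cont d (fun y => - f y) x.
Proof.
  intros Hf eps He. destruct (Hf eps He) as [d1 [H1 F1]].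
  exists d1; split; [easy|]. intros y Hy.
  replace (- f y - - f x) with (- (f y - f x)) by ring. rewrite Cmod_opp. auto.
Qed.

Lemma cont_minus f g x : cont d f x -> cont d g x -> cont d (fun y => f y - g y) x.
Proof. intros. apply cont_plus; [easy|]. now apply cont_opp. Qed.

Lemma cont_mult f g x : cont d f x -> cont d g x -> cont d (fun y => f y * g y) x.
Proof.
  intros Hf Hg eps He.
  set (A := Cmod (f x)). set (B := Cmod (g x)).
  assert (HA : (0 <= A)%R) by apply Cmod_ge_0. assert (HB : (0 <= B)%R) by apply Cmod_ge_0.
  set (e := Rmin 1 (eps / (A + B + 2))).
  assert (He' : (0 < eps / (A + B + 2))%R) by (apply Rdiv_lt_0_compat; lra).
  assert (Hep : (0 < e)%R) by (apply Rmin_pos; lra).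
  destruct (Hf e Hep) as [d1 [H1 F1]]. destruct (Hg e Hep) as [d2 [H2 F2]].
  exists (Rmin d1 d2). split; [now apply Rmin_pos|]. intros y Hy.
  assert (P := F1 y (Rlt_le_trans _ _ _ Hy (Rmin_l _ _))).
  assert (Q := F2 y (Rlt_le_trans _ _ _ Hy (Rmin_r _ _))).
  replace (f y * g y - f x * g x) with
    ((f y - f x) * (g y - g x) + ((f y - f x) * g x + f x * (g y - g x))) by ring.
  eapply Rle_lt_trans; [apply Cmod_triangle|].
  eapply Rle_lt_trans; [apply Rplus_le_compat_l, Cmod_triangle|].
  rewrite !Cmod_mult. fold A B.
  set (p := Cmod (f y - f x)) in *. set (q := Cmod (g y - g x)) in *.
  assert (Hp : (0 <= p)%R) by apply Cmod_ge_0. assert (Hq : (0 <= q)%R) by apply Cmod_ge_0.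
  assert (E1 : (e <= 1)%R) by apply Rmin_l.
  assert (E2 : (e * (A + B + 2) <= eps)%R).
  { apply Rle_trans with (eps / (A + B + 2) * (A + B + 2))%R.
    - apply Rmult_le_compat_r; [lra|apply Rmin_r].
    - apply Req_le. field. lra. }
  assert (p * q <= e * 1)%R by (apply Rmult_le_compat; lra).
  assert (p * B <= e * B)%R by (apply Rmult_le_compat_r; lra).
  assert (A * q <= A * e)%R by (apply Rmult_le_compat_l; lra). nra.
Qed.

Lemma cont_inv f x : f x <> 0 -> cont d f x -> cont d (fun y => / f y) x.
Proof.
  intros Hn Hf eps He.
  set (A := Cmod (f x)). assert (HA : (0 < A)%R) by now apply Cmod_gt_0.
  assert (He2 : (0 < Rmin (A / 2) (eps * (A * A / 2)))%R).
  { apply Rmin_pos; [lra|]. apply Rmult_lt_0_compat; nra. }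
  destruct (Hf _ He2) as [d1 [H1 F1]]. exists d1; split; [easy|]. intros y Hy.
  assert (P := F1 y Hy).
  assert (P1 := Rlt_le_trans _ _ _ P (Rmin_l _ _)).
  assert (P2 := Rlt_le_trans _ _ _ P (Rmin_r _ _)).
  assert (B : (A / 2 < Cmod (f y))%R).
  { assert (T := Cmod_triangle_sub (f x) (f y)).
    rewrite Cmod_sub_sym in T. fold A in T. lra. }
  assert (Hy0 : f y <> 0) by (apply Cmod_gt_0; lra).
  replace (/ f y - / f x) with (- (f y - f x) * / (f y * f x)) by (field; auto).
  rewrite Cmod_mult, Cmod_opp, Cmod_inv by (now apply Cmult_neq_0).
  rewrite Cmod_mult. fold A.
  assert (Q : (A * A / 2 < Cmod (f y) * A)%R) by nra.
  apply Rmult_lt_reg_r with (Cmod (f y) * A)%R; [nra|].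
  rewrite Rmult_assoc, Rinv_l by nra. rewrite Rmult_1_r.
  eapply Rlt_trans; [apply P2|]. apply Rmult_lt_compat_l; auto.
Qed.

Lemma cont_div f g x : g x <> 0 -> cont d f x -> cont d g x -> cont d (fun y => f y / g y) x.
Proof. intros. apply cont_mult; [easy|]. now apply cont_inv. Qed.

Lemma cont_pow f n x : cont d f x -> cont d (fun y => f y ^ n) x.
Proof.
  intros H. induction n as [|n IH]; [exact (cont_const 1 x)|].
  apply (cont_mult f (fun y => f y ^ n)); auto.
Qed.

Lemma cont_ext_loc f g x : (exists r, (0 < r)%R /\ forall y, (d x y < r)%R -> f y = g y) ->
  f x = g x -> cont d f x -> cont d g x.
Proof.
  intros [r [Hr E]] Ex Hf eps He. destruct (Hf eps He) as [d1 [H1 F1]].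
  exists (Rmin d1 r). split; [now apply Rmin_pos|]. intros y Hy.
  rewrite <- E, <- Ex by (eapply Rlt_le_trans; [exact Hy|apply Rmin_r]).
  apply F1. eapply Rlt_le_trans; [exact Hy|apply Rmin_l].
Qed.

Lemma cont_ext f g x : (forall y, f y = g y) -> cont d f x -> cont d g x.
Proof.
  intros E. apply cont_ext_loc; auto. exists 1%R; split; [lra|auto].
Qed.
End Calculus.

Definition dC (x y : C) : R := Cmod (y - x).

Lemma cont_comp {X} (d : X -> X -> R) (F : C -> C) (g : X -> C) x :
  cont dC F (g x) -> cont d g x -> cont d (fun y => F (g y)) x.
Proof.
  intros HF Hg eps He. destruct (HF eps He) as [d1 [H1 F1]].
  destruct (Hg d1 H1) as [d2 [H2 F2]]. exists d2; split; [easy|]. intros y Hy. apply F1. exact (F2 y Hy).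
Qed.

Lemma cont_id z : cont dC (fun u => u) z.
Proof. intros eps He. exists eps. split; auto. Qed.

Section Diff.
Context {X : Type}.
Implicit Types f g : X -> C.
Variable i : X -> C.
Definition dI (x y : X) : R := Cmod (i y - i x).

(** Caratheodory's form of the derivative: with increments [phi y * (i y - i x)]
    and [phi] continuous at [x], the rules of calculus reduce to rules for
    continuity.  The embedding [i] of the domain in C is the identity for complex
    derivatives and [RtoC] for derivatives of curves. *)
Definition diff (f : X -> C) (x : X) (l : C) : Prop :=
  exists phi, cont dI phi x /\ phi x = l /\
    forall y, f y = f x + phi y * (i y - i x).

Lemma cont_i x : cont dI i x.
Proof. intros eps He. exists eps. split; auto. Qed.

Lemma diff_cont f x l : diff f x l -> cont dI f x.
Proof.
  intros [phi [H1 [H2 H3]]].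
  apply cont_ext with (fun y => f x + phi y * (i y - i x)); [intros; now rewrite <- H3|].
  apply cont_plus; [apply cont_const|]. apply cont_mult; [easy|].
  apply cont_minus; [apply cont_i|apply cont_const].
Qed.

Lemma diff_const c x : diff (fun _ => c) x 0.
Proof.
  exists (fun _ => 0). split; [apply cont_const|split; [easy|]]. intros; ring.
Qed.

Lemma diff_i x : diff i x 1.
Proof. exists (fun _ => 1). split; [apply cont_const|split; [easy|]]. intros; ring. Qed.

Lemma diff_eq f x l l' : diff f x l -> l = l' -> diff f x l'.
Proof. intros H <-; exact H. Qed.

Lemma diff_plus f g x l m : diff f x l -> diff g x m -> diff (fun y => f y + g y) x (l + m).
Proof.
  intros [p [H1 [H2 H3]]] [q [G1 [G2 G3]]]. exists (fun y => p y + q y).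
  split; [now apply cont_plus|split; [now rewrite H2, G2|]].
  intros y. rewrite (H3 y), (G3 y). ring.
Qed.

Lemma diff_opp f x l : diff f x l -> diff (fun y => - f y) x (- l).
Proof.
  intros [p [H1 [H2 H3]]]. exists (fun y => - p y).
  split; [now apply cont_opp|split; [now rewrite H2|]]. intros y. rewrite (H3 y). ring.
Qed.

Lemma diff_minus f g x l m : diff f x l -> diff g x m -> diff (fun y => f y - g y) x (l - m).
Proof. intros. apply diff_plus; [easy|]. now apply diff_opp. Qed.

Lemma diff_mult f g x l m : diff f x l -> diff g x m ->
  diff (fun y => f y * g y) x (l * g x + f x * m).
Proof.
  intros Hf Hg. assert (Cg := diff_cont _ _ _ Hg).
  destruct Hf as [p [H1 [H2 H3]]], Hg as [q [G1 [G2 G3]]].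
  exists (fun y => p y * g y + f x * q y).
  split; [apply cont_plus; apply cont_mult; auto using cont_const|].
  split; [now rewrite H2, G2|]. intros y. rewrite (H3 y). rewrite (G3 y). ring.
Qed.

Lemma diff_eps f x l : (forall x y, i x = i y -> x = y) ->
  (forall eps, (0 < eps)%R -> exists del, (0 < del)%R /\ forall y, (dI x y < del)%R ->
     (Cmod (f y - f x - l * (i y - i x)) <= eps * Cmod (i y - i x))%R) -> diff f x l.
Proof.
  intros Hi H.
  exists (fun y => if excluded_middle_informative (i y = i x) then l else (f y - f x) / (i y - i x)).
  split; [|split].
  - intros eps He. destruct (H (eps/2)%R) as [del [Hd F]]; [lra|].
    exists del; split; [easy|]. intros y Hy. specialize (F y Hy).
    destruct (excluded_middle_informative (i x = i x)) as [_|n]; [|congruence].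
    destruct (excluded_middle_informative (i y = i x)) as [e|n].
    + replace (l - l) with (RtoC 0) by ring. rewrite Cmod_0; lra.
    + apply Csub_neq in n.
      replace ((f y - f x) / (i y - i x) - l) with
        ((f y - f x - l * (i y - i x)) / (i y - i x)) by (field; auto).
      rewrite Cmod_div by auto. assert (0 < Cmod (i y - i x))%R by now apply Cmod_gt_0.
      apply Rmult_lt_reg_r with (Cmod (i y - i x)); [easy|].
      unfold Rdiv. rewrite Rmult_assoc, Rinv_l by lra. rewrite Rmult_1_r. nra.
  - destruct (excluded_middle_informative (i x = i x)); congruence.
  - intros y. destruct (excluded_middle_informative (i y = i x)) as [e|n].
    + rewrite e. apply Hi in e. subst. ring.
    + apply Csub_neq in n. field. auto.
Qed.

Lemma diff_eps_inv f x l : diff f x l ->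
  forall eps, (0 < eps)%R -> exists del, (0 < del)%R /\ forall y, (dI x y < del)%R ->
     (Cmod (f y - f x - l * (i y - i x)) <= eps * Cmod (i y - i x))%R.
Proof.
  intros [p [H1 [H2 H3]]] eps He. destruct (H1 eps He) as [del [Hd F]].
  exists del; split; [easy|]. intros y Hy. rewrite (H3 y).
  replace (f x + p y * (i y - i x) - f x - l * (i y - i x)) with ((p y - p x) * (i y - i x)) by (rewrite H2; ring).
  rewrite Cmod_mult. apply Rmult_le_compat_r; [apply Cmod_ge_0|]. apply Rlt_le; auto.
Qed.

Lemma diff_ext_loc f g x l : (forall x y, i x = i y -> x = y) ->
  (exists r, (0 < r)%R /\ forall y, (dI x y < r)%R -> f y = g y) -> diff f x l -> diff g x l.
Proof.
  intros Hi [r [Hr E]] Hf. apply diff_eps; [easy|]. intros eps He.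
  destruct (diff_eps_inv _ _ _ Hf eps He) as [del [Hd F]].
  exists (Rmin del r). split; [now apply Rmin_pos|]. intros y Hy.
  rewrite <- !E; [apply F; eapply Rlt_le_trans; [exact Hy|apply Rmin_l] | |
    eapply Rlt_le_trans; [exact Hy|apply Rmin_r]].
  unfold dI. replace (i x - i x) with (RtoC 0) by ring. now rewrite Cmod_0.
Qed.

Lemma diff_ext f g x l : (forall y, f y = g y) -> diff f x l -> diff g x l.
Proof.
  intros E [p [H1 [H2 H3]]]. exists p. split; [easy|split; [easy|]].
  intros y. rewrite <- !E. auto.
Qed.

Lemma diff_unique f x l m : (forall r, (0 < r)%R -> exists y, (0 < dI x y < r)%R) ->
  diff f x l -> diff f x m -> l = m.
Proof.
  intros Hacc Hf Hg.
  destruct (excluded_middle_informative (l = m)) as [e|n]; [easy|exfalso].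
  apply Csub_neq in n. assert (P : (0 < Cmod (l - m))%R) by now apply Cmod_gt_0.
  destruct (diff_eps_inv _ _ _ Hf (Cmod (l - m) / 3)%R) as [d1 [D1 F1]]; [lra|].
  destruct (diff_eps_inv _ _ _ Hg (Cmod (l - m) / 3)%R) as [d2 [D2 F2]]; [lra|].
  destruct (Hacc (Rmin d1 d2)) as [y Hy]; [now apply Rmin_pos|].
  specialize (F1 y (Rlt_le_trans _ _ _ (proj2 Hy) (Rmin_l _ _))).
  specialize (F2 y (Rlt_le_trans _ _ _ (proj2 Hy) (Rmin_r _ _))).
  assert (T := Cmod_triangle_sub (f y - f x - m * (i y - i x)) (f y - f x - l * (i y - i x))).
  assert (T2 := Cmod_triangle (f y - f x - m * (i y - i x)) (- (f y - f x - l * (i y - i x)))).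
  rewrite Cmod_opp in T2.
  replace (f y - f x - m * (i y - i x) + - (f y - f x - l * (i y - i x))) with ((l - m) * (i y - i x)) in T2 by ring.
  rewrite Cmod_mult in T2. unfold dI in Hy. nra.
Qed.

End Diff.

Local Notation cdiff := (diff (fun z : C => z)).
Local Notation rdiff := (diff RtoC).

Definition dR (s t : R) : R := Rabs (t - s).

Lemma dI_dR s t : dI RtoC s t = dR s t.
Proof. unfold dI, dR. now rewrite <- RtoC_minus, Cmod_R. Qed.

Lemma RtoC_injective (x y : R) : RtoC x = RtoC y -> x = y. Proof. apply RtoC_inj. Qed.

Lemma cdiff_inv z : z <> 0 -> cdiff (fun u => / u) z (- / (z * z)).
Proof.
  intros Hz. apply diff_ext_loc with (fun u : C => if excluded_middle_informative (u = RtoC 0) then / z - / (z*z) * (u - z) else / u); [auto| |].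
  - exists (Cmod z). split; [now apply Cmod_gt_0|]. intros y Hy.
    destruct (excluded_middle_informative (y = 0)) as [e|n]; [|easy].
    subst. unfold dI in Hy. replace (0 - z) with (- z) in Hy by ring. rewrite Cmod_opp in Hy. lra.
  - exists (fun u : C => if excluded_middle_informative (u = RtoC 0) then - / (z*z) else - / (z * u)). split; [|split].
    + apply cont_ext_loc with (fun u : C => - / (z * u)).
      * exists (Cmod z). split; [now apply Cmod_gt_0|]. intros y Hy.
        destruct (excluded_middle_informative (y = 0)) as [e|n]; [|easy].
        subst. unfold dI in Hy. replace (0 - z) with (- z) in Hy by ring. rewrite Cmod_opp in Hy. lra.
      * destruct (excluded_middle_informative (z = RtoC 0)); [easy|reflexivity].
      * apply cont_opp, cont_inv; [now apply Cmult_neq_0|].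
        apply cont_mult; [apply cont_const|apply cont_i].
    + destruct (excluded_middle_informative (z = RtoC 0)); easy.
    + intros y. destruct (excluded_middle_informative (z = RtoC 0)); [easy|].
      destruct (excluded_middle_informative (y = 0)) as [e|m]; [ring|]. field. auto.
Qed.

Lemma diff_comp {X} (i : X -> C) (F : C -> C) (g : X -> C) x l m :
  cdiff F (g x) m -> diff i g x l -> diff i (fun y => F (g y)) x (m * l).
Proof.
  intros [P [H1 [H2 H3]]] Hg. assert (Cg := diff_cont _ _ _ _ Hg).
  destruct Hg as [q [G1 [G2 G3]]].
  exists (fun y => P (g y) * q y). split; [|split].
  - apply cont_mult; [|easy]. apply (cont_comp (dI i) P g); easy.
  - now rewrite H2, G2.
  - intros y. rewrite (H3 (g y)). rewrite (G3 y) at 2. ring.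
Qed.

Lemma diff_inv {X} (i : X -> C) (g : X -> C) x l : g x <> 0 ->
  diff i g x l -> diff i (fun y => / g y) x (- l / (g x * g x)).
Proof.
  intros Hn Hg. eapply diff_eq; [apply (diff_comp i (fun u => / u) g); [apply cdiff_inv; easy|exact Hg]|].
  field. easy.
Qed.

Lemma diff_div {X} (i : X -> C) (f g : X -> C) x l m : g x <> 0 ->
  diff i f x l -> diff i g x m -> diff i (fun y => f y / g y) x ((l * g x - f x * m) / (g x * g x)).
Proof.
  intros Hn Hf Hg. eapply diff_eq.
  - apply (diff_mult i f (fun y => / g y)); [exact Hf|apply diff_inv; [easy|exact Hg]].
  - simpl. field. easy.
Qed.

Lemma diff_scal {X} (i : X -> C) c (f : X -> C) x l : diff i f x l -> diff i (fun y => c * f y) x (c * l).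
Proof.
  intros H. eapply diff_eq; [apply diff_mult; [apply diff_const|exact H]|]. simpl. ring.
Qed.

Lemma rdiff_Re (f : R -> C) t l : rdiff f t l -> is_derive (fun s => Re (f s)) t (Re l).
Proof.
  intros H. apply is_derive_Reals. intros eps He.
  destruct (diff_eps_inv _ _ _ _ H (eps/2)%R) as [del [Hd F]]; [lra|].
  exists (mkposreal del Hd). intros h Hh Hlt. simpl in Hlt.
  specialize (F (t + h)%R). rewrite dI_dR in F. unfold dR in F.
  replace (t + h - t)%R with h in F by ring. specialize (F Hlt).
  rewrite <- RtoC_minus in F. replace (t + h - t)%R with h in F by ring.
  rewrite Cmod_R in F.
  assert (G := re_le_Cmod (f (t + h)%R - f t - l * h)). autorewrite with cre in G.
  replace ((Re (f (t + h)%R) - Re (f t)) / h - Re l)%R with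
    ((Re (f (t + h)%R) - Re (f t) - (Re l * h - Im l * 0)) / h)%R by (field; auto).
  unfold Rdiv. rewrite Rabs_mult, Rabs_inv.
  assert (0 < Rabs h)%R by now apply Rabs_pos_lt.
  apply Rmult_lt_reg_r with (Rabs h); [easy|]. rewrite Rmult_assoc, Rinv_l by lra. nra.
Qed.

Lemma rdiff_Im (f : R -> C) t l : rdiff f t l -> is_derive (fun s => Im (f s)) t (Im l).
Proof.
  intros H. assert (H' := rdiff_Re _ _ _ (diff_scal RtoC (- Ci) f t l H)).
  replace (Im l) with (Re (- Ci * l)) by (unfold Re, Im; simpl; ring).
  eapply is_derive_ext; [|exact H']. intros s. unfold Re, Im. simpl. ring.
Qed.

Lemma is_derive_rdiff (f : R -> C) t l : is_derive (fun s => Re (f s)) t (Re l) ->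
  is_derive (fun s => Im (f s)) t (Im l) -> rdiff f t l.
Proof.
  intros HR HI. apply is_derive_Reals in HR. apply is_derive_Reals in HI.
  apply diff_eps; [apply RtoC_injective|]. intros eps He.
  destruct (HR (eps/2)%R) as [d1 F1]; [lra|]. destruct (HI (eps/2)%R) as [d2 F2]; [lra|].
  exists (Rmin d1 d2). split; [apply Rmin_pos; apply cond_pos|].
  intros s Hs. rewrite dI_dR in Hs. unfold dR in Hs. rewrite <- RtoC_minus, Cmod_R.
  destruct (Req_dec s t) as [->|n].
  { replace (t - t)%R with 0%R by ring. rewrite Rabs_R0.
    replace (f t - f t - l * 0) with (RtoC 0) by ring. rewrite Cmod_0; lra. }
  assert (Hn : (s - t <> 0)%R) by lra.
  specialize (F1 (s - t)%R Hn (Rlt_le_trans _ _ _ Hs (Rmin_l _ _))).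
  specialize (F2 (s - t)%R Hn (Rlt_le_trans _ _ _ Hs (Rmin_r _ _))).
  replace (t + (s - t))%R with s in * by ring.
  eapply Rle_trans; [apply Cmod_le_Re_Im|]. autorewrite with cre.
  assert (P : (0 < Rabs (s - t))%R) by now apply Rabs_pos_lt.
  replace (Re (f s) - Re (f t) - (Re l * (s - t) - Im l * 0))%R with
    (((Re (f s) - Re (f t)) / (s - t) - Re l) * (s - t))%R by (field; auto).
  replace (Im (f s) - Im (f t) - (Re l * 0 + Im l * (s - t)))%R with
    (((Im (f s) - Im (f t)) / (s - t) - Im l) * (s - t))%R by (field; auto).
  rewrite !Rabs_mult. nra.
Qed.

Lemma rdiff_line (z0 w : C) t : rdiff (fun s => z0 + w * s) t w.
Proof.
  eapply diff_eq; [apply diff_plus; [apply diff_const|apply diff_scal, diff_i]|]. ring.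
Qed.

Lemma rdiff_unique (f : R -> C) x l m : rdiff f x l -> rdiff f x m -> l = m.
Proof.
  apply diff_unique. intros r Hr. exists (x + r / 2)%R. rewrite dI_dR. unfold dR.
  replace (x + r / 2 - x)%R with (r/2)%R by ring. rewrite Rabs_pos_eq; lra.
Qed.

Lemma cdiff_unique (f : C -> C) x l m : cdiff f x l -> cdiff f x m -> l = m.
Proof.
  apply diff_unique. intros r Hr. exists (x + RtoC (r / 2)). unfold dI.
  replace (x + RtoC (r / 2) - x) with (RtoC (r/2)) by ring. rewrite Cmod_R, Rabs_pos_eq; lra.
Qed.

(** [phi] is the difference quotient away from [z], and it is continuous at
    [z]. *)
Lemma cdiff_C_derive (f : C -> C) z l : cdiff f z l -> C_derive f z = l.
Proof.
  intros [p [H1 [H2 H3]]]. apply is_C_lim_unique. subst l.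
  apply filterlim_ext_loc with p.
  - exists (mkposreal 1 Rlt_0_1). intros y _ Hy. rewrite (H3 y). field. now apply Csub_neq.
  - intros P [eps HP]. destruct (H1 (eps / 1)%R) as [del [Hd F]].
    { generalize (cond_pos eps). lra. }
    assert (Hd2 : (0 < del / 2)%R) by lra.
    exists (mkposreal _ Hd2). intros y [Hy1 Hy2] _. apply HP.
    assert (L : (Cmod (p y - p z) < eps)%R).
    { replace (pos eps) with (eps / 1)%R by field. apply F.
      unfold dI. eapply Rle_lt_trans; [apply Cmod_le_Re_Im|].
      change (Rabs (fst y - fst z) + Rabs (snd y - snd z) < del)%R.
      change (Rabs (fst y - fst z) < del / 2)%R in Hy1. change (Rabs (snd y - snd z) < del / 2)%R in Hy2. lra. }
    split.
    + change (Rabs (Re (p y - p z)) < eps)%R. eapply Rle_lt_trans; [apply re_le_Cmod|easy].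
    + change (Rabs (Im (p y - p z)) < eps)%R. eapply Rle_lt_trans; [apply im_le_Cmod|easy].
Qed.

Lemma is_derive_C_components (f : R -> C) t (l : C) :
  @is_derive R_AbsRing C_R_NormedModule f t l <->
  is_derive (fun s => Re (f s)) t (Re l) /\ is_derive (fun s => Im (f s)) t (Im l).
Proof.
  split.
  - intros H. split.
    + apply (filterdiff_comp' f (fun z : prod_NormedModule R_AbsRing R_NormedModule R_NormedModule => fst z) t
        (fun y : R => scal y l : C_R_NormedModule) (fun z : C_R_NormedModule => fst z) H).
      apply filterdiff_linear, is_linear_fst.
    + apply (filterdiff_comp' f (fun z : prod_NormedModule R_AbsRing R_NormedModule R_NormedModule => snd z) t
        (fun y : R => scal y l : C_R_NormedModule) (fun z : C_R_NormedModule => snd z) H).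
      apply filterdiff_linear, is_linear_snd.
  - intros [HR HI].
    assert (A := @is_derive_scal_l R_AbsRing C_R_NormedModule _ t _ (RtoC 1) HR).
    assert (B := @is_derive_scal_l R_AbsRing C_R_NormedModule _ t _ Ci HI).
    assert (S := is_derive_plus _ _ _ _ _ A B).
    replace l with (plus (scal (Re l) (RtoC 1) : C_R_NormedModule) (scal (Im l) Ci)).
    + eapply is_derive_ext; [|exact S]. intros s. simpl.
      apply C_ext; simpl; unfold plus, scal, mult; simpl; unfold mult; simpl; ring.
    + apply C_ext; simpl; unfold plus, scal, mult; simpl; unfold mult; simpl; ring.
Qed.

Lemma is_derive_C_rdiff (f : R -> C) t (l : C) :
  @is_derive R_AbsRing C_R_NormedModule f t l <-> rdiff f t l.
Proof.
  rewrite is_derive_C_components. split.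
  - intros [H1 H2]. now apply is_derive_rdiff.
  - intros H. split; [now apply rdiff_Re|now apply rdiff_Im].
Qed.

(** * Sums over growing squares *)

Definition Cseq (u : nat -> C) (l : C) : Prop := is_lim_seq (fun n => Cmod (u n - l)) 0%R.

Lemma is_lim_seq_0_le (u v : nat -> R) : (forall n, (0 <= u n <= v n)%R) ->
  is_lim_seq v 0%R -> is_lim_seq u 0%R.
Proof. intros H Hv. apply (is_lim_seq_le_le (fun _ => 0%R) u v); auto using is_lim_seq_const. Qed.

Lemma Cseq_const c : Cseq (fun _ => c) c.
Proof.
  unfold Cseq. replace (c - c) with (RtoC 0) by ring. rewrite Cmod_0. apply is_lim_seq_const.
Qed.

Lemma Cseq_plus u v l l' : Cseq u l -> Cseq v l' -> Cseq (fun n => u n + v n) (l + l').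
Proof.
  intros Hu Hv. apply is_lim_seq_0_le with (fun n => Cmod (u n - l) + Cmod (v n - l'))%R.
  - intros n. split; [apply Cmod_ge_0|].
    replace (u n + v n - (l + l')) with ((u n - l) + (v n - l')) by ring. apply Cmod_triangle.
  - replace (Finite 0) with (Rbar_plus 0 0) by (simpl; f_equal; ring).
    apply is_lim_seq_plus'; auto.
Qed.

Lemma Cseq_scal c u l : Cseq u l -> Cseq (fun n => c * u n) (c * l).
Proof.
  intros Hu. unfold Cseq. apply is_lim_seq_ext with (fun n => Cmod c * Cmod (u n - l))%R.
  - intros n. rewrite <- Cmod_mult. f_equal. ring.
  - replace (Finite 0) with (Rbar_mult (Cmod c) 0) by (simpl; f_equal; ring).
    now apply is_lim_seq_scal_l.
Qed.

Lemma Cseq_ext u v l : (forall n, u n = v n) -> Cseq u l -> Cseq v l.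
Proof. intros E. apply is_lim_seq_ext. intros n. now rewrite E. Qed.

Lemma Cseq_opp u l : Cseq u l -> Cseq (fun n => - u n) (- l).
Proof.
  intros H. replace (- l) with (RtoC (-1) * l) by ring.
  eapply Cseq_ext; [|apply Cseq_scal, H]. intros n. simpl. ring.
Qed.

Lemma Cseq_minus u v l l' : Cseq u l -> Cseq v l' -> Cseq (fun n => u n - v n) (l - l').
Proof. intros. apply Cseq_plus; [easy|]. now apply Cseq_opp. Qed.

Lemma Cseq_bound u l M : (forall n, (Cmod (u n) <= M)%R) -> Cseq u l -> (Cmod l <= M)%R.
Proof.
  intros H Hu.
  assert (A : is_lim_seq (fun n => M + Cmod (u n - l))%R (M + 0)%R).
  { apply is_lim_seq_plus'; [apply is_lim_seq_const|exact Hu]. }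
  rewrite Rplus_0_r in A.
  apply (is_lim_seq_le (fun _ => Cmod l) (fun n => M + Cmod (u n - l))%R (Cmod l) M); [|apply is_lim_seq_const|exact A].
  intros n. assert (T := Cmod_triangle (u n) (- (u n - l))). rewrite Cmod_opp in T.
  replace (u n + - (u n - l)) with l in T by ring. specialize (H n). lra.
Qed.

Lemma Cseq_unique u l l' : Cseq u l -> Cseq u l' -> l = l'.
Proof.
  intros H H'. assert (A := Cseq_minus _ _ _ _ H H').
  assert (B : (Cmod (l - l') <= 0)%R).
  { apply (Cseq_bound (fun n => u n - u n)); [|exact A]. intros n.
    replace (u n - u n) with (RtoC 0) by ring. rewrite Cmod_0; lra. }
  assert (D : l - l' = 0) by (apply Cmod_eq_0; generalize (Cmod_ge_0 (l - l')); lra).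
  replace l with (l - l' + l') by ring. rewrite D. ring.
Qed.

Lemma Cseq_Re_Im u l : Cseq u l <-> is_lim_seq (fun n => Re (u n)) (Re l) /\ is_lim_seq (fun n => Im (u n)) (Im l).
Proof.
  assert (D : forall (v : nat -> R) (a : R), is_lim_seq v a <-> is_lim_seq (fun n => Rabs (v n - a)) 0%R).
  { intros v a. split; intros H.
    - apply (is_lim_seq_abs_0 (fun n => v n - a)%R).
      replace (Finite 0) with (Rbar_minus a a) by (simpl; f_equal; ring).
      apply is_lim_seq_minus'; [easy|apply is_lim_seq_const].
    - apply (is_lim_seq_abs_0 (fun n => v n - a)%R) in H.
      apply is_lim_seq_ext with (fun n => (v n - a) + a)%R; [intros; ring|].
      replace (Finite a) with (Rbar_plus 0 a) by (simpl; f_equal; ring).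
      apply is_lim_seq_plus'; [easy|apply is_lim_seq_const]. }
  rewrite (D (fun n => Re (u n))), (D (fun n => Im (u n))). split.
  - intros H. split; (eapply is_lim_seq_0_le; [|exact H]); intros n; split; try apply Rabs_pos.
    + rewrite <- Re_minus. apply re_le_Cmod.
    + rewrite <- Im_minus. apply im_le_Cmod.
  - intros [H1 H2]. eapply is_lim_seq_0_le; [intros n; split; [apply Cmod_ge_0|apply Cmod_le_Re_Im]|].
    replace (Finite 0) with (Rbar_plus 0 0) by (simpl; f_equal; ring).
    apply is_lim_seq_plus'; [exact H1|exact H2].
Qed.

Lemma Cseq_bounded u l : Cseq u l -> exists M, forall n, (Cmod (u n) <= M)%R.
Proof.
  intros H. apply is_lim_seq_spec in H. destruct (H (mkposreal 1 Rlt_0_1)) as [N HN]. simpl in HN.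
  assert (P : forall N, exists M, forall n, (n < N)%nat -> (Cmod (u n) <= M)%R).
  { clear. induction N as [|N [M IH]]; [exists 0%R; intros; lia|].
    exists (Rmax M (Cmod (u N))). intros n Hn. destruct (Nat.eq_dec n N) as [->|].
    - apply Rmax_r.
    - eapply Rle_trans; [apply IH; lia|apply Rmax_l]. }
  destruct (P N) as [M HM]. exists (Rmax M (Cmod l + 1)). intros n.
  destruct (lt_dec n N) as [h|h]; [eapply Rle_trans; [apply HM, h|apply Rmax_l]|].
  eapply Rle_trans; [|apply Rmax_r]. specialize (HN n). rewrite Rminus_0_r in HN.
  rewrite Rabs_pos_eq in HN by apply Cmod_ge_0.
  assert (T := Cmod_triangle_sub (u n) l). specialize (HN ltac:(lia)). lra.
Qed.

Section Sym.
Context {G : AbelianMonoid}.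

Definition symsum (f : Z -> G) (N : nat) : G :=
  sum_n (fun i => f (Z.of_nat i - Z.of_nat N)%Z) (2 * N).

Lemma sum_n_first (g : nat -> G) n : sum_n g (S n) = plus (g O) (sum_n (fun i => g (S i)) n).
Proof.
  induction n as [|n IH].
  - rewrite sum_Sn, !sum_O. reflexivity.
  - rewrite sum_Sn, IH, sum_Sn. now rewrite plus_assoc.
Qed.

Lemma symsum_0 (f : Z -> G) : symsum f 0 = f 0%Z.
Proof. unfold symsum. simpl. now rewrite sum_O. Qed.

Lemma symsum_S (f : Z -> G) N :
  symsum f (S N) = plus (f (- Z.of_nat (S N))%Z) (plus (symsum f N) (f (Z.of_nat (S N)))).
Proof.
  unfold symsum. replace (2 * S N)%nat with (S (S (2 * N))) by lia.
  rewrite sum_n_first, sum_Sn. apply f_equal2; [|apply f_equal2].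
  - apply f_equal. lia.
  - apply sum_n_ext. intros n. apply f_equal. lia.
  - apply f_equal. lia.
Qed.

Lemma symsum_ext_loc (f g : Z -> G) N :
  (forall k, (Z.abs k <= Z.of_nat N)%Z -> f k = g k) -> symsum f N = symsum g N.
Proof.
  intros H. unfold symsum. apply sum_n_ext_loc. intros n Hn. apply H. lia.
Qed.

Lemma symsum_opp (f : Z -> G) N : symsum (fun k => f (- k)%Z) N = symsum f N.
Proof.
  induction N as [|N IH]; [now rewrite !symsum_0|].
  rewrite !symsum_S, IH, Z.opp_involutive.
  rewrite (plus_comm (f (Z.of_nat (S N)))), (plus_comm (symsum f N) (f (- _)%Z)).
  symmetry. apply plus_assoc.
Qed.

Lemma symsum_plus (f g : Z -> G) N : symsum (fun k => plus (f k) (g k)) N = plus (symsum f N) (symsum g N).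
Proof. apply sum_n_plus. Qed.

Lemma symsum_switch (a : Z -> Z -> G) M N :
  symsum (fun m => symsum (a m) N) M = symsum (fun n => symsum (fun m => a m n) M) N.
Proof. unfold symsum. apply (sum_n_switch (fun i j => a (Z.of_nat i - Z.of_nat M)%Z (Z.of_nat j - Z.of_nat N)%Z)). Qed.

Lemma symsum_shift (f : Z -> G) N :
  plus (symsum (fun k => f (k - 1)%Z) N) (f (Z.of_nat N)) = plus (f (- Z.of_nat N - 1)%Z) (symsum f N).
Proof.
  induction N as [|N IH].
  - rewrite !symsum_0. reflexivity.
  - rewrite !symsum_S.
    replace (Z.of_nat (S N) - 1)%Z with (Z.of_nat N) by lia.
    replace (- Z.of_nat N - 1)%Z with (- Z.of_nat (S N))%Z in IH by lia.
    rewrite <- !plus_assoc. f_equal. rewrite !plus_assoc. f_equal. exact IH.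
Qed.

Definition box (a : Z -> Z -> G) (N : nat) : G := symsum (fun m => symsum (a m) N) N.

(** The new points form two full rows, and two columns without their end
    points. *)
Lemma box_S (a : Z -> Z -> G) N :
  box a (S N) = plus (box a N)
    (plus (plus (symsum (a (- Z.of_nat (S N))%Z) (S N)) (symsum (a (Z.of_nat (S N))) (S N)))
          (symsum (fun m => plus (a m (- Z.of_nat (S N))%Z) (a m (Z.of_nat (S N)))) N)).
Proof.
  unfold box at 1. rewrite symsum_S.
  replace (symsum (fun m => symsum (a m) (S N)) N) with
    (plus (box a N) (symsum (fun m => plus (a m (- Z.of_nat (S N))%Z) (a m (Z.of_nat (S N)))) N)).
  - set (A := symsum (a (- _)%Z) (S N)). set (B := symsum (a _) (S N)).
    set (D := symsum _ N).
    rewrite (plus_comm _ B), (plus_assoc A B), (plus_comm (plus A B)), <- plus_assoc.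
    f_equal. apply plus_comm.
  - unfold box. rewrite <- symsum_plus. apply symsum_ext_loc. intros k _.
    rewrite symsum_S. rewrite (plus_comm (a k (- _)%Z) (a k _)), !plus_assoc.
    rewrite plus_comm. now rewrite plus_assoc.
Qed.
End Sym.

Lemma square_sum_box a N : square_sum a N = box (G := C_AbelianMonoid) a N.
Proof. reflexivity. Qed.

Lemma Cmod_symsum (f : Z -> C) N : (Cmod (symsum (G := C_AbelianMonoid) f N) <= symsum (G := R_AbelianMonoid) (fun k => Cmod (f k)) N)%R.
Proof.
  induction N as [|N IH]; [rewrite !symsum_0; apply Rle_refl|].
  rewrite !symsum_S. simpl. unfold plus; simpl.
  eapply Rle_trans; [apply Cmod_triangle|]. apply Rplus_le_compat_l.
  eapply Rle_trans; [apply Cmod_triangle|]. apply Rplus_le_compat_r, IH.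
Qed.

Lemma symsum_le (f g : Z -> R) N : (forall k, (Z.abs k <= Z.of_nat N)%Z -> (f k <= g k)%R) ->
  (symsum (G := R_AbelianMonoid) f N <= symsum (G := R_AbelianMonoid) g N)%R.
Proof.
  induction N as [|N IH]; intros H; [rewrite !symsum_0; apply H; simpl; lia|].
  rewrite !symsum_S. unfold plus; simpl.
  apply Rplus_le_compat; [apply H; lia|]. apply Rplus_le_compat; [apply IH|apply H; lia].
  intros k Hk. apply H. lia.
Qed.

Lemma symsum_cst (r : R) N : symsum (G := R_AbelianMonoid) (fun _ => r) N = ((2 * INR N + 1) * r)%R.
Proof.
  induction N as [|N IH]; [rewrite symsum_0; simpl; ring|].
  rewrite symsum_S, IH, S_INR. unfold plus; simpl. ring.
Qed.

Lemma Cmod_symsum_bound (f : Z -> C) N r : (forall k, (Z.abs k <= Z.of_nat N)%Z -> (Cmod (f k) <= r)%R) ->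
  (Cmod (symsum (G := C_AbelianMonoid) f N) <= (2 * INR N + 1) * r)%R.
Proof.
  intros H. eapply Rle_trans; [apply Cmod_symsum|]. rewrite <- symsum_cst. now apply symsum_le.
Qed.

Lemma Cmod_box (a : Z -> Z -> C) N :
  (Cmod (square_sum a N) <= box (G := R_AbelianMonoid) (fun m n => Cmod (a m n)) N)%R.
Proof.
  unfold box. rewrite square_sum_box. unfold box.
  eapply Rle_trans; [apply Cmod_symsum|]. apply symsum_le. intros. apply Cmod_symsum.
Qed.

Lemma box_le (f g : Z -> Z -> R) N : (forall m n, (f m n <= g m n)%R) ->
  (box (G := R_AbelianMonoid) f N <= box (G := R_AbelianMonoid) g N)%R.
Proof. intros H. apply symsum_le. intros. apply symsum_le. intros; auto. Qed.

Lemma symsum_RtoC (f : Z -> R) N :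
  RtoC (symsum (G := R_AbelianMonoid) f N) = symsum (G := C_AbelianMonoid) (fun k => RtoC (f k)) N.
Proof.
  induction N as [|N IH]; [now rewrite !symsum_0|].
  rewrite !symsum_S, <- IH. unfold plus; simpl. now rewrite !RtoC_plus.
Qed.

Lemma symsum_scal_r (f : Z -> R) r N :
  symsum (G := R_AbelianMonoid) (fun k => f k * r)%R N = (symsum (G := R_AbelianMonoid) f N * r)%R.
Proof.
  induction N as [|N IH]; [now rewrite !symsum_0|].
  rewrite !symsum_S, IH. unfold plus; simpl. ring.
Qed.

Lemma box_RtoC (a : Z -> Z -> R) N :
  RtoC (box (G := R_AbelianMonoid) a N) = square_sum (fun m n => RtoC (a m n)) N.
Proof.
  rewrite square_sum_box. unfold box. rewrite symsum_RtoC. apply symsum_ext_loc. intros.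
  apply symsum_RtoC.
Qed.

Lemma symsum_C_scal c (f : Z -> C) N :
  symsum (G := C_AbelianMonoid) (fun k => c * f k) N = c * symsum (G := C_AbelianMonoid) f N.
Proof.
  induction N as [|N IH]; [now rewrite !symsum_0|].
  rewrite !symsum_S, IH. unfold plus; simpl. ring.
Qed.

Lemma square_sum_ext (a b : Z -> Z -> C) N : (forall m n, a m n = b m n) -> square_sum a N = square_sum b N.
Proof.
  intros H. rewrite (square_sum_box a), (square_sum_box b). unfold box. apply symsum_ext_loc. intros. apply symsum_ext_loc. auto.
Qed.

Lemma square_sum_plus (a b : Z -> Z -> C) N :
  square_sum (fun m n => a m n + b m n) N = square_sum a N + square_sum b N.
Proof.
  rewrite (square_sum_box a), (square_sum_box b), square_sum_box. unfold box.
  rewrite <- (symsum_plus (G := C_AbelianMonoid)). apply symsum_ext_loc. intros.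
  apply (symsum_plus (G := C_AbelianMonoid)).
Qed.

Lemma square_sum_scal c (a : Z -> Z -> C) N :
  square_sum (fun m n => c * a m n) N = c * square_sum a N.
Proof.
  rewrite (square_sum_box a), square_sum_box. unfold box. rewrite <- symsum_C_scal. apply symsum_ext_loc. intros.
  apply symsum_C_scal.
Qed.

Lemma square_sum_minus (a b : Z -> Z -> C) N :
  square_sum (fun m n => a m n - b m n) N = square_sum a N - square_sum b N.
Proof.
  rewrite (square_sum_ext _ (fun m n => a m n + RtoC (-1) * b m n)) by (intros; ring).
  rewrite square_sum_plus, square_sum_scal. ring.
Qed.

Lemma square_sum_conj (a : Z -> Z -> C) N :
  square_sum (fun m n => Cconj (a m n)) N = Cconj (square_sum a N).
Proof.
  assert (H : forall f N, symsum (G := C_AbelianMonoid) (fun k => Cconj (f k)) N = Cconj (symsum (G := C_AbelianMonoid) f N)).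
  { clear. intros f N. induction N as [|N IH]; [now rewrite !symsum_0|].
    rewrite !symsum_S, IH. unfold plus; simpl. now rewrite !Cplus_conj. }
  rewrite (square_sum_box a), square_sum_box. unfold box. rewrite <- H. apply symsum_ext_loc. intros. apply H.
Qed.

(** A shell of the square contains [8 N] points, so that cubic decay makes the
    contributions of the shells summable. *)
Definition dominated (a : Z -> Z -> C) : Prop :=
  exists (K : R) (N0 : nat), (0 <= K)%R /\ forall N m n, (N0 <= N)%nat ->
    Z.max (Z.abs m) (Z.abs n) = Z.of_nat (S N) -> (Cmod (a m n) <= K / INR (S N) ^ 3)%R.

Lemma shell_bound (a : Z -> Z -> C) N B :
  (forall m n, Z.max (Z.abs m) (Z.abs n) = Z.of_nat (S N) -> (Cmod (a m n) <= B)%R) ->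
  (Cmod (square_sum a (S N) - square_sum a N) <= 8 * INR (S N) * B)%R.
Proof.
  intros H. rewrite (square_sum_box a (S N)), (square_sum_box a N), box_S.
  set (P := symsum (a (- _)%Z) (S N)). set (Q := symsum (a _) (S N)). set (D := symsum _ N).
  replace (plus (box a N) (plus (plus P Q) D) - box a N) with (P + Q + D)
    by (unfold plus; simpl; ring).
  assert (HP : (Cmod P <= (2 * INR (S N) + 1) * B)%R) by (apply Cmod_symsum_bound; intros; apply H; lia).
  assert (HQ : (Cmod Q <= (2 * INR (S N) + 1) * B)%R) by (apply Cmod_symsum_bound; intros; apply H; lia).
  assert (HD : (Cmod D <= (2 * INR N + 1) * (2 * B))%R).
  { apply Cmod_symsum_bound. intros k Hk. unfold plus; simpl.
    eapply Rle_trans; [apply Cmod_triangle|].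
    assert (A1 := H k (- Z.of_nat (S N))%Z ltac:(lia)). assert (A2 := H k (Z.of_nat (S N))%Z ltac:(lia)).
    simpl in *. lra. }
  eapply Rle_trans; [apply Cmod_triangle|].
  eapply Rle_trans; [apply Rplus_le_compat_r, Cmod_triangle|].
  rewrite S_INR in *. lra.
Qed.

(** Comparison with [2 * (1 / (n + 1) - 1 / (n + 2))], which telescopes. *)
Lemma telescopic_cv (u : nat -> C) (K : R) (N0 : nat) : (0 <= K)%R ->
  (forall n, (N0 <= n)%nat -> (Cmod (u (S n) - u n) <= K / INR (S n) ^ 2)%R) ->
  exists l, Cseq u l.
Proof.
  intros HK H.
  assert (A : forall n k, (N0 <= n)%nat -> (Cmod (u (n + k)%nat - u n) <= 2 * K * (/ INR (S n) - / INR (S (n + k))))%R).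
  { intros n k Hn. induction k as [|k IH].
    - rewrite Nat.add_0_r. replace (u n - u n) with (RtoC 0) by ring. rewrite Cmod_0. lra.
    - replace (u (n + S k)%nat - u n) with ((u (S (n + k)) - u (n + k)%nat) + (u (n + k)%nat - u n))
        by (rewrite <- plus_n_Sm; ring).
      eapply Rle_trans; [apply Cmod_triangle|].
      specialize (H (n + k)%nat ltac:(lia)). rewrite <- plus_n_Sm.
      assert (Hp : (0 < INR (S (n + k)))%R) by (apply lt_0_INR; lia).
      assert (E : (K / INR (S (n + k)) ^ 2 <= 2 * K * (/ INR (S (n + k)) - / INR (S (S (n + k)))))%R).
      { rewrite (S_INR (S (n + k))). set (x := INR (S (n + k))) in *.
        assert (x >= 1)%R. { unfold x. rewrite S_INR. assert (0 <= INR (n + k))%R by apply pos_INR. lra. }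
        replace (2 * K * (/ x - / (x + 1)))%R with (K * (2 / (x * (x + 1))))%R by (field; lra).
        unfold Rdiv. apply Rmult_le_compat_l; [easy|].
        apply Rmult_le_reg_r with (x ^ 2 * (x + 1))%R; [apply Rmult_lt_0_compat; [apply pow_lt|]; lra|].
        replace (/ x ^ 2 * (x ^ 2 * (x + 1)))%R with (x + 1)%R by (field; lra).
        replace (2 * / (x * (x + 1)) * (x ^ 2 * (x + 1)))%R with (2 * x)%R by (field; lra). lra. }
      lra. }
  assert (B : forall eps : posreal, exists N : nat, forall n p, (N <= n)%nat -> (N <= p)%nat -> (Cmod (u p - u n) < eps)%R).
  { intros eps.
    destruct (nfloor_ex (4 * K / eps)) as [N1 [_ HN1]].
    { apply Rmult_le_pos; [lra|]. apply Rlt_le, Rinv_0_lt_compat, cond_pos. }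
    exists (max N0 N1).
    assert (Q : forall n k, (max N0 N1 <= n)%nat -> (Cmod (u (n + k)%nat - u n) < eps)%R).
    { intros n k Hn. eapply Rle_lt_trans; [apply A; lia|].
      assert (P1 : (0 < / INR (S (n + k)))%R) by (apply Rinv_0_lt_compat, lt_0_INR; lia).
      apply Rle_lt_trans with (2 * K * / INR (S n))%R; [nra|].
      assert (P2 : (0 < INR (S n))%R) by (apply lt_0_INR; lia).
      apply Rmult_lt_reg_r with (INR (S n)); [easy|]. rewrite Rmult_assoc, Rinv_l by lra.
      assert (INR N1 <= INR n)%R by (apply le_INR; lia). rewrite S_INR.
      assert (He := cond_pos eps).
      assert (4 * K < (INR N1 + 1) * eps)%R.
      { apply Rmult_lt_reg_r with (/ eps)%R; [now apply Rinv_0_lt_compat|].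
        replace ((INR N1 + 1) * eps * / eps)%R with (INR N1 + 1)%R by (field; lra). unfold Rdiv in HN1. lra. }
      nra. }
    intros n p Hn Hp. destruct (le_lt_dec n p) as [h|h].
    - replace p with (n + (p - n))%nat by lia. now apply Q.
    - rewrite Cmod_sub_sym. replace n with (p + (n - p))%nat by lia. now apply Q. }
  assert (HR : ex_finite_lim_seq (fun n => Re (u n))).
  { apply ex_lim_seq_cauchy_corr. intros eps. destruct (B eps) as [N HN]. exists N. intros n p Hn Hp.
    rewrite <- Re_minus. eapply Rle_lt_trans; [apply re_le_Cmod|auto]. }
  assert (HI : ex_finite_lim_seq (fun n => Im (u n))).
  { apply ex_lim_seq_cauchy_corr. intros eps. destruct (B eps) as [N HN]. exists N. intros n p Hn Hp.
    rewrite <- Im_minus. eapply Rle_lt_trans; [apply im_le_Cmod|auto]. }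
  destruct HR as [a Ha], HI as [b Hb]. exists (a, b). apply Cseq_Re_Im. now split.
Qed.

Lemma dominated_cv a : dominated a -> exists l, Cseq (square_sum a) l.
Proof.
  intros [K [N0 [HK H]]]. apply telescopic_cv with (8 * K)%R N0; [lra|].
  intros n Hn. eapply Rle_trans; [apply (shell_bound a n (K / INR (S n) ^ 3)); auto|].
  apply Req_le. field. apply not_0_INR. lia.
Qed.

Lemma dominated_abs_bounded a : dominated a ->
  exists M, forall N, (box (G := R_AbelianMonoid) (fun m n => Cmod (a m n)) N <= M)%R.
Proof.
  intros [K [N0 [HK H]]].
  assert (D : dominated (fun m n => RtoC (Cmod (a m n)))).
  { exists K, N0. split; [easy|]. intros. rewrite Cmod_R, Rabs_pos_eq by apply Cmod_ge_0. now apply H. }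
  destruct (dominated_cv _ D) as [l Hl]. destruct (Cseq_bounded _ _ Hl) as [M HM].
  exists M. intros N. specialize (HM N). rewrite <- box_RtoC, Cmod_R in HM.
  eapply Rle_trans; [apply Rle_abs|exact HM].
Qed.

Lemma dominated_le a b : (forall m n, (Cmod (b m n) <= Cmod (a m n))%R) -> dominated a -> dominated b.
Proof.
  intros E [K [N0 [HK H]]]. exists K, N0. split; [easy|]. intros.
  eapply Rle_trans; [apply E|now apply H].
Qed.

(** * The lattice *)

Section Lattice.
Variable tau : C.
Hypothesis Htau : Re tau = 0%R /\ (0 < Im tau)%R.

(** A lower bound for the modulus of [m + n tau] divided by
    [max (|m|, |n|)]. *)
Definition lattice_gap : R := Rmin 1 (Im tau).

Lemma ltau_pos : (0 < lattice_gap)%R.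
Proof. apply Rmin_pos; [lra|apply Htau]. Qed.

Lemma lp_Re m n : Re (lattice_point tau m n) = IZR m.
Proof. unfold lattice_point. autorewrite with cre. destruct Htau as [-> _]. simpl. ring. Qed.
Lemma lp_Im m n : Im (lattice_point tau m n) = (IZR n * Im tau)%R.
Proof. unfold lattice_point. autorewrite with cre. simpl. ring. Qed.

Lemma lp_large m n N : Z.max (Z.abs m) (Z.abs n) = Z.of_nat N ->
  (lattice_gap * INR N <= Cmod (lattice_point tau m n))%R.
Proof.
  intros H. assert (P := ltau_pos). rewrite INR_IZR_INZ, <- H.
  assert (E : (lattice_gap <= 1 /\ lattice_gap <= Im tau)%R) by (split; [apply Rmin_l|apply Rmin_r]).
  destruct (Z.max_spec (Z.abs m) (Z.abs n)) as [[_ Em]|[_ Em]]; rewrite Em, abs_IZR.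
  - eapply Rle_trans; [|apply im_le_Cmod]. rewrite lp_Im, Rabs_mult, (Rabs_pos_eq (Im tau)) by lra.
    assert (0 <= Rabs (IZR n))%R by apply Rabs_pos. nra.
  - eapply Rle_trans; [|apply re_le_Cmod]. rewrite lp_Re.
    assert (0 <= Rabs (IZR m))%R by apply Rabs_pos. nra.
Qed.

Definition lattice_array (f : C -> C) (m n : Z) : C :=
  if (Z.eqb m 0 && Z.eqb n 0)%bool then 0 else f (lattice_point tau m n).

Lemma arr_dominated (f : C -> C) (K R0 : R) : (0 <= K)%R ->
  (forall w, (R0 <= Cmod w)%R -> (Cmod (f w) <= K / Cmod w ^ 3)%R) -> dominated (lattice_array f).
Proof.
  intros HK H. assert (P := ltau_pos).
  destruct (nfloor_ex (Rmax 0 R0 / lattice_gap)) as [N0 [_ HN0]].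
  { apply Rmult_le_pos; [apply Rmax_l|]. now apply Rlt_le, Rinv_0_lt_compat. }
  exists (K / lattice_gap ^ 3)%R, N0. assert (P3 : (0 < lattice_gap ^ 3)%R) by now apply pow_lt.
  split. { apply Rmult_le_pos; [easy|]. now apply Rlt_le, Rinv_0_lt_compat. }
  intros N m n HN Hmn. assert (L := lp_large _ _ _ Hmn). unfold lattice_array.
  assert (S0 : (0 < INR (S N))%R) by (apply lt_0_INR; lia).
  destruct (Z.eqb m 0 && Z.eqb n 0)%bool eqn:E.
  { apply andb_prop in E. rewrite !Z.eqb_eq in E. lia. }
  assert (Q : (0 < lattice_gap * INR (S N))%R) by now apply Rmult_lt_0_compat.
  eapply Rle_trans; [apply H|].
  - eapply Rle_trans; [|exact L]. eapply Rle_trans; [apply (Rmax_r 0)|].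
    assert (INR N0 + 1 <= INR (S N))%R by (rewrite S_INR; apply Rplus_le_compat_r, le_INR; lia).
    apply Rmult_le_reg_r with (/ lattice_gap)%R; [now apply Rinv_0_lt_compat|].
    replace (lattice_gap * INR (S N) * / lattice_gap)%R with (INR (S N)) by (field; lra).
    unfold Rdiv in HN0. lra.
  - unfold Rdiv. rewrite Rmult_assoc, <- Rinv_mult, <- Rpow_mult_distr.
    apply Rmult_le_compat_l; [easy|]. apply Rinv_le_contravar; [now apply pow_lt|].
    apply pow_incr. lra.
Qed.

Lemma lattice_sum_cv f l : Cseq (square_sum (lattice_array f)) l -> lattice_sum tau f = l.
Proof.
  intros H. apply Cseq_Re_Im in H. destruct H as [HR HI].
  change (lattice_sum tau f) with (real (Lim_seq (fun N => Re (square_sum (lattice_array f) N))),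
    real (Lim_seq (fun N => Im (square_sum (lattice_array f) N)))).
  apply is_lim_seq_unique in HR, HI. rewrite HR, HI. destruct l; reflexivity.
Qed.

Lemma lattice_sum_lim f : dominated (lattice_array f) -> Cseq (square_sum (lattice_array f)) (lattice_sum tau f).
Proof. intros H. destruct (dominated_cv _ H) as [l Hl]. now rewrite (lattice_sum_cv _ _ Hl). Qed.

Lemma Z_isolated (x : R) : exists d, (0 < d)%R /\ forall m : Z, IZR m <> x -> (d <= Rabs (x - IZR m))%R.
Proof.
  destruct (archimed x) as [A B]. generalize dependent (up x). intros k A B.
  destruct (Req_dec x (IZR (k - 1))) as [e|n].
  - exists 1%R. split; [lra|]. intros m Hm. subst x.
    rewrite <- minus_IZR, <- abs_IZR. apply IZR_le.
    assert (k - 1 <> m)%Z by (intros <-; now apply Hm). lia.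
  - rewrite minus_IZR in n. exists (Rmin (IZR k - x) (x - (IZR k - 1))).
    split; [apply Rmin_pos; lra|]. intros m Hm.
    destruct (Z_lt_le_dec m k) as [h|h].
    + assert (IZR m <= IZR k - 1)%R by (rewrite <- minus_IZR; apply IZR_le; lia).
      eapply Rle_trans; [apply Rmin_r|]. rewrite Rabs_pos_eq; lra.
    + apply IZR_le in h. eapply Rle_trans; [apply Rmin_l|]. rewrite Rabs_minus_sym, Rabs_pos_eq; lra.
Qed.

(** The real parts of lattice points are integers and the imaginary parts are
    multiples of [Im tau]; each coordinate keeps its distance from [z]. *)
Lemma lattice_isolated z : exists d, (0 < d)%R /\ forall m n, lattice_point tau m n <> z -> (d <= Cmod (z - lattice_point tau m n))%R.
Proof.
  destruct Htau as [HR HI].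
  destruct (Z_isolated (Re z)) as [d1 [P1 H1]]. destruct (Z_isolated (Im z / Im tau)) as [d2 [P2 H2]].
  exists (Rmin d1 (d2 * Im tau)). split; [apply Rmin_pos; nra|]. intros m n Hne.
  destruct (Req_dec (IZR m) (Re z)) as [e|ne].
  - assert (ne : IZR n <> (Im z / Im tau)%R).
    { intros e2. apply Hne. apply C_ext; rewrite ?lp_Re, ?lp_Im; [easy|]. rewrite e2. field. lra. }
    eapply Rle_trans; [apply Rmin_r|]. eapply Rle_trans; [|apply im_le_Cmod].
    rewrite Im_minus, lp_Im. specialize (H2 n ne).
    replace (Im z - IZR n * Im tau)%R with ((Im z / Im tau - IZR n) * Im tau)%R by (field; lra).
    rewrite Rabs_mult, (Rabs_pos_eq (Im tau)) by lra. nra.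
  - eapply Rle_trans; [apply Rmin_l|]. eapply Rle_trans; [|apply re_le_Cmod].
    rewrite Re_minus, lp_Re. auto.
Qed.

End Lattice.

(** * Termwise differentiation of lattice sums *)

Lemma Cpow_neq_0 z n : z <> 0 -> z ^ n <> 0.
Proof. apply Cpow_nz. Qed.

Lemma dominated_scal c a : dominated a -> dominated (fun m n => c * a m n).
Proof.
  intros [K [N0 [HK H]]]. exists (Cmod c * K)%R, N0.
  assert (P := Cmod_ge_0 c). split; [nra|]. intros.
  rewrite Cmod_mult. unfold Rdiv. rewrite Rmult_assoc. apply Rmult_le_compat_l; [easy|]. now apply H.
Qed.

(** By induction on [k]: with [a = 1 / x] and [b = 1 / (x + h)] one has
    [b - a = - h a b], hence a recursion for the remainder of [b ^ k]. *)
Lemma inv_pow_remainder (k : nat) : exists K : R, (0 <= K)%R /\ forall x h : C, x <> 0 -> (Cmod h <= Cmod x / 2)%R ->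
  (Cmod (1 / (x + h) ^ k - 1 / x ^ k + INR k * h / x ^ (S k)) <= K * Cmod h ^ 2 / Cmod x ^ (k + 2))%R.
Proof.
  induction k as [|k [K [HK IH]]].
  - exists 0%R. split; [lra|]. intros x h Hx _. simpl.
    replace (1 / 1 - 1 / 1 + 0 * h / (x * 1)) with (RtoC 0) by (field; auto). rewrite Cmod_0.
    unfold Rdiv. rewrite Rmult_0_l, Rmult_0_l. lra.
  - exists (2 * K + 2 * INR (S k))%R. assert (P0 := pos_INR (S k)). split; [lra|].
    intros x h Hx Hh. specialize (IH x h Hx Hh).
    assert (Px : (0 < Cmod x)%R) by now apply Cmod_gt_0.
    assert (Hxh : (Cmod x / 2 <= Cmod (x + h))%R).
    { assert (T := Cmod_triangle (x + h) (- h)). rewrite Cmod_opp in T.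
      replace (x + h + - h) with x in T by ring. lra. }
    assert (Nxh : x + h <> 0) by (apply Cmod_gt_0; lra).
    set (r := 1 / (x + h) ^ k - 1 / x ^ k + INR k * h / x ^ S k) in *.
    replace (1 / (x + h) ^ S k - 1 / x ^ S k + INR (S k) * h / x ^ S (S k)) with
      (/ (x + h) * r + INR (S k) * h ^ 2 / (x ^ (S (S k)) * (x + h))).
    2:{ unfold r. rewrite !S_INR, RtoC_plus. rewrite !Cpow_S.
        field. repeat split; auto; apply Cpow_neq_0; auto. }
    eapply Rle_trans; [apply Cmod_triangle|].
    rewrite Cmod_mult, Cmod_div, !Cmod_mult, Cmod_inv, !Cmod_pow, Cmod_R, (Rabs_pos_eq (INR _)) by
      (auto using Cmult_neq_0, Cpow_neq_0).
    set (X := Cmod x) in *. set (Y := Cmod (x + h)) in *. set (H2 := Cmod h) in *.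
    assert (IY : (/ Y <= 2 / X)%R).
    { replace (2 / X)%R with (/ (X / 2))%R by (field; lra). apply Rinv_le_contravar; lra. }
    assert (PY : (0 < / Y)%R) by (apply Rinv_0_lt_compat; lra).
    assert (PH : (0 <= H2 ^ 2)%R) by (apply pow2_ge_0).
    assert (PXk : (0 < X ^ (k + 2))%R) by now apply pow_lt.
    apply Rle_trans with (2 / X * (K * H2 ^ 2 / X ^ (k + 2)) + INR (S k) * H2 ^ 2 / X ^ (k + 2) * (2 / X))%R.
    + apply Rplus_le_compat.
      * apply Rmult_le_compat; try easy; try lra. apply Cmod_ge_0.
      * replace (INR (S k) * H2 ^ 2 / (X ^ S (S k) * Y))%R with (INR (S k) * H2 ^ 2 / X ^ (k + 2) * / Y)%R.
        { apply Rmult_le_compat_l; [|easy]. apply Rmult_le_pos; [nra|]. now apply Rlt_le, Rinv_0_lt_compat. }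
        replace (k + 2)%nat with (S (S k)) in * by lia. field. split; lra.
    + apply Req_le. replace (S k + 2)%nat with (S (k + 2)) by lia. simpl (X ^ S (k + 2))%R. field. split; lra.
Qed.

Definition zeta_term z w := 1 / (z - w) + 1 / w + z / w ^ 2.
Definition wp_term z w := 1 / (z - w) ^ 2 - 1 / w ^ 2.
Definition pow_term (k : nat) z w := 1 / (z - w) ^ k.

Lemma large_facts z w : (2 * Cmod z + 1 <= Cmod w)%R ->
  w <> 0 /\ z - w <> 0 /\ (1 <= Cmod w)%R /\ (Cmod w / 2 <= Cmod (z - w))%R.
Proof.
  intros H. assert (P := Cmod_ge_0 z).
  assert (T := Cmod_triangle_sub w z). rewrite Cmod_sub_sym in T.
  repeat split; try (apply Cmod_gt_0); lra.
Qed.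

Lemma inv_pow_half (a b : R) k : (0 < a)%R -> (a / 2 <= b)%R -> (/ b ^ k <= 2 ^ k / a ^ k)%R.
Proof.
  intros Ha Hb. replace (2 ^ k / a ^ k)%R with (/ (a / 2) ^ k)%R.
  - apply Rinv_le_contravar; [apply pow_lt; lra|]. apply pow_incr. lra.
  - unfold Rdiv. rewrite Rpow_mult_distr, pow_inv, Rinv_mult, Rinv_inv. ring.
Qed.

Section W.
Variable tau : C.
Hypothesis Htau : Re tau = 0%R /\ (0 < Im tau)%R.
Notation lp := (lattice_point tau).

Lemma zeta_term_dom z : dominated (lattice_array tau (zeta_term z)).
Proof.
  apply arr_dominated with (2 * Cmod z ^ 2)%R (2 * Cmod z + 1)%R; [easy|nra|].
  intros w Hw. destruct (large_facts z w Hw) as [W0 [ZW [Wge B]]].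
  unfold zeta_term. replace (1 / (z - w) + 1 / w + z / w ^ 2) with (z ^ 2 / w ^ 2 * / (z - w)) by (field; auto).
  rewrite Cmod_mult, Cmod_inv, Cmod_div, !Cmod_pow by auto using Cpow_neq_0.
  assert (H := inv_pow_half (Cmod w) (Cmod (z - w)) 1 ltac:(lra) B). rewrite !pow_1 in H.
  apply Rle_trans with (Cmod z ^ 2 / Cmod w ^ 2 * (2 / Cmod w))%R.
  - apply Rmult_le_compat_l; [|easy]. apply Rmult_le_pos; [nra|]. apply Rlt_le, Rinv_0_lt_compat. nra.
  - apply Req_le. field. lra.
Qed.

Lemma wp_term_dom z : dominated (lattice_array tau (wp_term z)).
Proof.
  assert (P := Cmod_ge_0 z).
  apply arr_dominated with (12 * Cmod z)%R (2 * Cmod z + 1)%R; [easy|lra|].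
  intros w Hw. destruct (large_facts z w Hw) as [W0 [ZW [Wge B]]].
  unfold wp_term. replace (1 / (z - w) ^ 2 - 1 / w ^ 2) with (z * (2 * w - z) / w ^ 2 * / (z - w) ^ 2) by (field; auto).
  rewrite Cmod_mult, Cmod_inv, Cmod_div, !Cmod_pow, Cmod_mult by auto using Cpow_neq_0.
  assert (H := inv_pow_half (Cmod w) (Cmod (z - w)) 2 ltac:(lra) B).
  assert (N : (Cmod (2 * w - z) <= 3 * Cmod w)%R).
  { eapply Rle_trans; [apply Cmod_triangle|]. rewrite Cmod_opp, Cmod_mult, Cmod_R, Rabs_pos_eq by lra. lra. }
  apply Rle_trans with (Cmod z * (3 * Cmod w) / Cmod w ^ 2 * (2 ^ 2 / Cmod w ^ 2))%R.
  - apply Rmult_le_compat; try easy.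
    + apply Rmult_le_pos; [|apply Rlt_le, Rinv_0_lt_compat; nra]. apply Rmult_le_pos; [lra|apply Cmod_ge_0].
    + apply Rlt_le, Rinv_0_lt_compat, pow_lt. lra.
    + apply Rmult_le_compat_r; [apply Rlt_le, Rinv_0_lt_compat; nra|]. now apply Rmult_le_compat_l.
  - apply Req_le. field. lra.
Qed.

Lemma pow_term_dom k z : (3 <= k)%nat -> dominated (lattice_array tau (pow_term k z)).
Proof.
  intros Hk. assert (P := Cmod_ge_0 z).
  apply arr_dominated with (2 ^ k)%R (2 * Cmod z + 1)%R; [easy|apply pow_le; lra|].
  intros w Hw. destruct (large_facts z w Hw) as [W0 [ZW [Wge B]]].
  unfold pow_term. rewrite Cmod_div, Cmod_1, Cmod_pow by auto using Cpow_neq_0.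
  unfold Rdiv at 1. rewrite Rmult_1_l.
  eapply Rle_trans; [apply (inv_pow_half (Cmod w)); [lra|easy]|].
  apply Rmult_le_compat_l; [apply pow_le; lra|].
  apply Rinv_le_contravar; [apply pow_lt; lra|]. now apply Rle_pow.
Qed.

Lemma lp_0 m n : lp m n = 0 -> m = 0%Z /\ n = 0%Z.
Proof.
  intros H. assert (A := lp_Re tau Htau m n). assert (B := lp_Im tau m n). rewrite H in A, B. simpl in A, B.
  split; apply eq_IZR; [lra|]. destruct Htau. nra.
Qed.

Lemma arr_cases f m n : (lattice_array tau f m n = 0 /\ m = 0%Z /\ n = 0%Z) \/ (lattice_array tau f m n = f (lp m n) /\ lp m n <> 0 /\ (m,n) <> (0,0)%Z).
Proof.
  unfold lattice_array. destruct (Z.eqb m 0 && Z.eqb n 0)%bool eqn:E.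
  - left. apply andb_prop in E. rewrite !Z.eqb_eq in E. easy.
  - right. split; [easy|]. assert (Q : (m, n) <> (0,0)%Z).
    { intros Q. injection Q as -> ->. discriminate. }
    split; [|easy]. intros H. apply lp_0 in H. destruct H; subst. easy.
Qed.

Lemma lattice_sum_scal c f : dominated (lattice_array tau f) -> lattice_sum tau (fun w => c * f w) = c * lattice_sum tau f.
Proof.
  intros H. apply lattice_sum_cv. eapply Cseq_ext; [|apply Cseq_scal, lattice_sum_lim, H].
  intros N. cbv beta. rewrite <- square_sum_scal. apply square_sum_ext. intros. unfold lattice_array.
  destruct (Z.eqb m 0 && Z.eqb n 0)%bool; [ring|easy].
Qed.

Lemma lattice_sum_ext_loc f g : (forall m n, lp m n <> 0 -> f (lp m n) = g (lp m n)) ->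
  lattice_sum tau f = lattice_sum tau g.
Proof.
  intros H. assert (E : forall N, square_sum (lattice_array tau f) N = square_sum (lattice_array tau g) N).
  { intros N. apply square_sum_ext. intros m n. unfold lattice_array.
    destruct (arr_cases f m n) as [[_ [-> ->]]|[_ [E _]]]; [easy|]. rewrite H; easy. }
  change (lattice_sum tau f) with (real (Lim_seq (fun N => Re (square_sum (lattice_array tau f) N))),
    real (Lim_seq (fun N => Im (square_sum (lattice_array tau f) N)))).
  change (lattice_sum tau g) with (real (Lim_seq (fun N => Re (square_sum (lattice_array tau g) N))),
    real (Lim_seq (fun N => Im (square_sum (lattice_array tau g) N)))).
  f_equal; f_equal; apply Lim_seq_ext; intros N; now rewrite E.
Qed.

Lemma lattice_sum_opp f : lattice_sum tau (fun w => f (- w)) = lattice_sum tau f.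
Proof.
  assert (E : forall N, square_sum (lattice_array tau (fun w => f (- w))) N = square_sum (lattice_array tau f) N).
  { intros N. rewrite (square_sum_box (lattice_array tau f)), square_sum_box. unfold box.
    rewrite <- (symsum_opp (G := C_AbelianMonoid) (fun m => symsum (lattice_array tau f m) N)).
    apply symsum_ext_loc. intros m _. rewrite <- (symsum_opp (G := C_AbelianMonoid)).
    apply symsum_ext_loc. intros n _. unfold lattice_array.
    rewrite !(Z.eqb_sym (- _)).
    replace (0 =? - m)%Z with (m =? 0)%Z by (apply Bool.eq_true_iff_eq; rewrite !Z.eqb_eq; lia).
    replace (0 =? - n)%Z with (n =? 0)%Z by (apply Bool.eq_true_iff_eq; rewrite !Z.eqb_eq; lia).
    destruct (m =? 0)%Z, (n =? 0)%Z; simpl; try easy;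
    f_equal; unfold lattice_point; rewrite !opp_IZR, !RtoC_opp; ring. }
  change (lattice_sum tau f) with (real (Lim_seq (fun N => Re (square_sum (lattice_array tau f) N))),
    real (Lim_seq (fun N => Im (square_sum (lattice_array tau f) N)))).
  unfold lattice_sum. f_equal; f_equal; apply Lim_seq_ext; intros N; now rewrite <- E.
Qed.

Lemma conj_lp m n : Cconj (lp m n) = lp m (- n).
Proof.
  apply C_ext; rewrite ?re_conj, ?im_conj, ?lp_Re, ?lp_Im by easy; [easy|].
  rewrite opp_IZR. ring.
Qed.

Lemma lattice_sum_conj f : dominated (lattice_array tau f) ->
  lattice_sum tau (fun w => Cconj (f (Cconj w))) = Cconj (lattice_sum tau f).
Proof.
  intros H. apply lattice_sum_cv.
  assert (A := lattice_sum_lim _ _ H).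
  apply is_lim_seq_ext with (fun N => Cmod (square_sum (lattice_array tau f) N - lattice_sum tau f)); [|exact A].
  intros N. rewrite <- Cmod_conj, Cminus_conj. f_equal. f_equal. rewrite <- square_sum_conj.
  rewrite (square_sum_box (lattice_array tau _)), square_sum_box. unfold box.
  apply symsum_ext_loc. intros m _. rewrite <- (symsum_opp (G := C_AbelianMonoid)).
  apply symsum_ext_loc. intros n _. unfold lattice_array.
  replace (- n =? 0)%Z with (n =? 0)%Z by (apply Bool.eq_true_iff_eq; rewrite !Z.eqb_eq; lia).
  rewrite conj_lp. destruct (m =? 0)%Z, (n =? 0)%Z; simpl; try easy; apply C_ext; simpl; ring.
Qed.

(** The remainders of second order of the terms have a sum that is bounded by
    [M * Cmod (u - z) ^ 2] with [M] independent of the size of the square, and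
    this bound passes to the limit. *)
Lemma lattice_sum_diff (F : C -> C -> C) (g B : C -> C) z del : (0 < del)%R ->
  (forall u, dominated (lattice_array tau (F u))) -> dominated (lattice_array tau g) -> dominated (lattice_array tau B) ->
  (forall u m n, (Cmod (u - z) <= del)%R -> lp m n <> 0 ->
     (Cmod (F u (lp m n) - F z (lp m n) - g (lp m n) * (u - z)) <= Cmod (B (lp m n)) * Cmod (u - z) ^ 2)%R) ->
  cdiff (fun u => lattice_sum tau (F u)) z (lattice_sum tau g).
Proof.
  intros Hd HF Hg HB HR.
  destruct (dominated_abs_bounded _ HB) as [M HM].
  assert (M0 : (0 <= M)%R).
  { eapply Rle_trans; [|apply (HM 0%nat)]. unfold box. rewrite !symsum_0. apply Cmod_ge_0. }
  assert (Q : forall u, (Cmod (u - z) <= del)%R ->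
    (Cmod (lattice_sum tau (F u) - lattice_sum tau (F z) - lattice_sum tau g * (u - z)) <= M * Cmod (u - z) ^ 2)%R).
  { intros u Hu.
    replace (lattice_sum tau g * (u - z)) with ((u - z) * lattice_sum tau g) by ring.
    apply (Cseq_bound (fun N => square_sum (lattice_array tau (F u)) N - square_sum (lattice_array tau (F z)) N - (u - z) * square_sum (lattice_array tau g) N)).
    2:{ apply Cseq_minus; [apply Cseq_minus|apply Cseq_scal]; now apply lattice_sum_lim. }
    intros N. rewrite <- square_sum_scal, <- !square_sum_minus.
    eapply Rle_trans; [apply Cmod_box|].
    apply Rle_trans with (box (G := R_AbelianMonoid) (fun m n => Cmod (lattice_array tau B m n) * Cmod (u - z) ^ 2)%R N).
    - apply box_le. intros m n. unfold lattice_array.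
      destruct (arr_cases g m n) as [[_ [-> ->]]|[_ [E Q]]].
      + simpl. replace (0 - 0 - (u - z) * 0) with (RtoC 0) by ring. rewrite Cmod_0. lra.
      + destruct (Z.eqb m 0 && Z.eqb n 0)%bool eqn:EE.
        { apply andb_prop in EE. rewrite !Z.eqb_eq in EE. destruct EE; subst. easy. }
        rewrite (Cmult_comm (u - z)). now apply HR.
    - unfold box. rewrite (symsum_ext_loc _ (fun m => symsum (G := R_AbelianMonoid) (fun n => Cmod (lattice_array tau B m n)) N * Cmod (u - z) ^ 2)%R)
        by (intros; apply symsum_scal_r).
      rewrite symsum_scal_r. apply Rmult_le_compat_r; [apply pow2_ge_0|]. apply HM. }
  apply diff_eps; [auto|]. intros eps He.
  exists (Rmin del (eps / (M + 1)))%R. assert (He' : (0 < eps / (M + 1))%R) by (apply Rdiv_lt_0_compat; lra).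
  split; [now apply Rmin_pos|]. intros u Hu. unfold dI in Hu.
  assert (P := Cmod_ge_0 (u - z)).
  eapply Rle_trans; [apply Q; apply Rlt_le; eapply Rlt_le_trans; [exact Hu|apply Rmin_l]|].
  assert (E : (Cmod (u - z) * (M + 1) <= eps)%R).
  { apply Rle_trans with (eps / (M + 1) * (M + 1))%R.
    - apply Rmult_le_compat_r; [lra|]. apply Rlt_le. eapply Rlt_le_trans; [exact Hu|apply Rmin_r].
    - apply Req_le. field. lra. }
  nra.
Qed.

Definition off_lattice z : Prop := forall m n, lp m n <> z.
(** The domain of holomorphy of the three sums below; it contains 0. *)
Definition off_nonzero_lattice z : Prop := forall m n, lp m n <> 0 -> lp m n <> z.

Lemma nl_nl0 z : off_lattice z -> off_nonzero_lattice z. Proof. intros H m n _. apply H. Qed.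
Lemma nl_neq0 z : off_lattice z -> z <> 0.
Proof.
  intros H ->. apply (H 0%Z 0%Z). apply C_ext; rewrite ?lp_Re, ?lp_Im by easy; simpl; ring.
Qed.
Lemma nl0_0 : off_nonzero_lattice 0. Proof. intros m n H. exact H. Qed.

(** The parts of [zeta], of [wp] and of the sums of higher powers that are
    regular at 0. *)
Definition zeta_reg z := lattice_sum tau (zeta_term z).
Definition wp_reg z := lattice_sum tau (wp_term z).
Definition pow_reg k z := lattice_sum tau (pow_term k z).

Lemma remainder_setup z k : off_nonzero_lattice z -> exists del K, (0 < del)%R /\ forall u m n, (Cmod (u - z) <= del)%R -> lp m n <> 0 ->
  z - lp m n <> 0 /\ u - lp m n <> 0 /\
  (Cmod (1 / (u - lp m n) ^ k - 1 / (z - lp m n) ^ k + INR k * (u - z) / (z - lp m n) ^ (S k))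
    <= Cmod (RtoC K * pow_term (k + 2) z (lp m n)) * Cmod (u - z) ^ 2)%R.
Proof.
  intros Hz. destruct (lattice_isolated tau Htau z) as [d [Hd HI]].
  destruct (inv_pow_remainder k) as [K [HK HR]].
  exists (d / 2)%R, K. split; [lra|]. intros u m n Hu H0.
  assert (B := HI m n (Hz m n H0)).
  assert (Z0 : z - lp m n <> 0) by (apply Cmod_gt_0; lra).
  assert (U0 : u - lp m n <> 0).
  { apply Cmod_gt_0. assert (T := Cmod_triangle (u - lp m n) (- (u - z))). rewrite Cmod_opp in T.
    replace (u - lp m n + - (u - z)) with (z - lp m n) in T by ring. lra. }
  split; [easy|split; [easy|]].
  specialize (HR (z - lp m n) (u - z) Z0 ltac:(lra)).
  replace (z - lp m n + (u - z)) with (u - lp m n) in HR by ring.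
  eapply Rle_trans; [apply HR|]. apply Req_le. unfold pow_term.
  rewrite Cmod_mult, Cmod_div, Cmod_1, Cmod_pow, Cmod_R, Rabs_pos_eq by auto using Cpow_neq_0.
  field. apply Rgt_not_eq, pow_lt. now apply Cmod_gt_0.
Qed.

Lemma arr_scal_dom c f : dominated (lattice_array tau f) -> dominated (lattice_array tau (fun w => c * f w)).
Proof.
  intros H. apply dominated_le with (fun m n => c * lattice_array tau f m n); [|now apply dominated_scal].
  intros m n. unfold lattice_array. destruct (Z.eqb m 0 && Z.eqb n 0)%bool; [|lra].
  replace (c * 0) with (RtoC 0) by ring. lra.
Qed.

Lemma zeta_reg_diff z : off_nonzero_lattice z -> cdiff zeta_reg z (- wp_reg z).
Proof.
  intros Hz. destruct (remainder_setup z 1 Hz) as [del [K [Hd H]]].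
  replace (- wp_reg z) with (RtoC (-1) * wp_reg z) by ring. unfold wp_reg. rewrite <- lattice_sum_scal by apply wp_term_dom.
  apply lattice_sum_diff with (B := fun w => RtoC K * pow_term (1 + 2) z w) (del := del); auto using zeta_term_dom, wp_term_dom, arr_scal_dom.
  - apply arr_scal_dom, pow_term_dom. lia.
  - intros u m n Hu H0. destruct (H u m n Hu H0) as [Z0 [U0 HH]].
    eapply Rle_trans; [|exact HH]. apply Req_le. f_equal. unfold zeta_term, wp_term. simpl (INR 1). field. auto.
Qed.

Lemma wp_reg_diff z : off_nonzero_lattice z -> cdiff wp_reg z (RtoC (-2) * pow_reg 3 z).
Proof.
  intros Hz. destruct (remainder_setup z 2 Hz) as [del [K [Hd H]]].
  unfold pow_reg. rewrite <- lattice_sum_scal by (apply pow_term_dom; lia).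
  apply lattice_sum_diff with (B := fun w => RtoC K * pow_term (2 + 2) z w) (del := del); auto using wp_term_dom.
  - apply arr_scal_dom, pow_term_dom. lia.
  - apply arr_scal_dom, pow_term_dom. lia.
  - intros u m n Hu H0. destruct (H u m n Hu H0) as [Z0 [U0 HH]].
    eapply Rle_trans; [|exact HH]. apply Req_le. f_equal. unfold wp_term, pow_term. simpl (INR 2).
    replace (1 + 1)%R with 2%R by ring. field. auto.
Qed.

Lemma pow_reg_diff k z : (3 <= k)%nat -> off_nonzero_lattice z -> cdiff (pow_reg k) z (RtoC (- INR k) * pow_reg (S k) z).
Proof.
  intros Hk Hz. destruct (remainder_setup z k Hz) as [del [K [Hd H]]].
  unfold pow_reg. rewrite <- lattice_sum_scal by (apply pow_term_dom; lia).
  apply lattice_sum_diff with (B := fun w => RtoC K * pow_term (k + 2) z w) (del := del); auto using pow_term_dom.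
  - apply arr_scal_dom, pow_term_dom. lia.
  - apply arr_scal_dom, pow_term_dom. lia.
  - intros u m n Hu H0. destruct (H u m n Hu H0) as [Z0 [U0 HH]].
    eapply Rle_trans; [|exact HH]. apply Req_le. f_equal. unfold pow_term. rewrite RtoC_opp.
    rewrite Cpow_S. field. split; [|split]; auto using Cpow_neq_0.
Qed.

(** * The Weierstrass functions and their derivatives *)

(** The first three derivatives of [wp], outside the lattice. *)
Definition wp_d1 z := RtoC (-2) * (/ z ^ 3 + pow_reg 3 z).
Definition wp_d2 z := 6 * (/ z ^ 4 + pow_reg 4 z).
Definition wp_d3 z := RtoC (-24) * (/ z ^ 5 + pow_reg 5 z).

Lemma cdiff_inv_pow k z : z <> 0 -> cdiff (fun u => / u ^ S k) z (RtoC (- INR (S k)) / z ^ S (S k)).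
Proof.
  intros Hz. induction k as [|k IH].
  - apply diff_ext with (fun u : C => / u); [intros; f_equal; simpl; ring|].
    eapply diff_eq; [apply cdiff_inv; easy|]. simpl (INR 1). rewrite RtoC_opp. simpl. field. auto.
  - apply diff_ext with (fun u : C => / u * / u ^ S k).
    + intros u. rewrite (Cpow_S u (S k)).
      destruct (excluded_middle_informative (u = 0)) as [->|n].
      * simpl. apply C_ext; simpl; unfold Rdiv; rewrite ?Rmult_0_l, ?Rmult_0_r, ?Rplus_0_l, ?Rinv_0; ring.
      * field. split; auto using Cpow_neq_0.
    + eapply diff_eq; [apply diff_mult; [apply cdiff_inv; easy|exact IH]|].
      rewrite (S_INR (S k)), !RtoC_opp, RtoC_plus. rewrite !Cpow_S. field. split; auto using Cpow_neq_0.
Qed.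

Lemma wzeta_split z : wzeta tau z = / z + zeta_reg z.
Proof. unfold wzeta, zeta_reg. f_equal. unfold Cdiv. ring. Qed.
Lemma wp_split z : wp tau z = / z ^ 2 + wp_reg z.
Proof. unfold wp, wp_reg. f_equal. unfold Cdiv. ring. Qed.

Lemma wzeta_diff z : off_lattice z -> cdiff (wzeta tau) z (- wp tau z).
Proof.
  intros H. assert (Z0 := nl_neq0 z H).
  apply diff_ext with (fun u => / u ^ 1 + zeta_reg u); [intros; rewrite wzeta_split; f_equal; f_equal; simpl; ring|].
  eapply diff_eq; [apply diff_plus; [apply cdiff_inv_pow, Z0|apply zeta_reg_diff, nl_nl0, H]|].
  rewrite wp_split. simpl (INR 1). rewrite RtoC_opp. simpl. field. auto.
Qed.

Lemma wp_diff z : off_lattice z -> cdiff (wp tau) z (wp_d1 z).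
Proof.
  intros H. assert (Z0 := nl_neq0 z H).
  apply diff_ext with (fun u => / u ^ 2 + wp_reg u); [intros; now rewrite wp_split|].
  eapply diff_eq; [apply diff_plus; [apply cdiff_inv_pow, Z0|apply wp_reg_diff, nl_nl0, H]|].
  unfold wp_d1. simpl (INR 2). replace (1 + 1)%R with 2%R by ring. replace (- (2))%R with (-2)%R by ring. field. auto.
Qed.

Lemma wp_d1_diff z : off_lattice z -> cdiff wp_d1 z (wp_d2 z).
Proof.
  intros H. assert (Z0 := nl_neq0 z H). unfold wp_d1 at 1.
  eapply diff_eq; [apply diff_scal, diff_plus; [apply cdiff_inv_pow, Z0|apply pow_reg_diff, nl_nl0, H; lia]|].
  unfold wp_d2. simpl (INR 3). replace (- (1 + 1 + 1))%R with (-3)%R by ring. field. auto.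
Qed.

Lemma wp_d2_diff z : off_lattice z -> cdiff wp_d2 z (wp_d3 z).
Proof.
  intros H. assert (Z0 := nl_neq0 z H). unfold wp_d2 at 1.
  eapply diff_eq; [apply diff_scal, diff_plus; [apply cdiff_inv_pow, Z0|apply pow_reg_diff, nl_nl0, H; lia]|].
  unfold wp_d3. simpl (INR 4). replace (- (1 + 1 + 1 + 1))%R with (-4)%R by ring. field. auto.
Qed.

Lemma nl_open z : off_lattice z -> exists r, (0 < r)%R /\ forall u, (Cmod (u - z) < r)%R -> off_lattice u.
Proof.
  intros H. destruct (lattice_isolated tau Htau z) as [d [Hd HI]]. exists d. split; [easy|].
  intros u Hu m n E. specialize (HI m n (H m n)). rewrite E in HI. rewrite Cmod_sub_sym in HI. lra.
Qed.

Lemma wp'_closed z : off_lattice z -> wp' tau z = wp_d1 z.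
Proof. intros H. apply cdiff_C_derive, wp_diff, H. Qed.

Lemma wp''_closed z : off_lattice z -> wp'' tau z = wp_d2 z.
Proof.
  intros H. apply cdiff_C_derive. destruct (nl_open z H) as [r [Hr HN]].
  apply diff_ext_loc with wp_d1; [auto| |now apply wp_d1_diff]. exists r. split; [easy|].
  intros u Hu. symmetry. apply wp'_closed, HN, Hu.
Qed.

Lemma Cinv_opp z : / (- z) = - / z.
Proof.
  destruct (excluded_middle_informative (z = 0)) as [->|n]; [|field; auto].
  apply C_ext; simpl; unfold Rdiv; rewrite ?Ropp_0, ?Rmult_0_l, ?Rmult_0_r, ?Rplus_0_l, ?Rinv_0; ring.
Qed.

Lemma zeta_reg_opp z : zeta_reg (- z) = - zeta_reg z.
Proof.
  unfold zeta_reg. rewrite <- (lattice_sum_opp (zeta_term (- z))).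
  replace (- lattice_sum tau (zeta_term z)) with (RtoC (-1) * lattice_sum tau (zeta_term z)) by ring.
  rewrite <- lattice_sum_scal by apply zeta_term_dom. apply lattice_sum_ext_loc. intros m n H. unfold zeta_term.
  replace (- z - - lp m n) with (- (z - lp m n)) by ring. unfold Cdiv. rewrite !Cinv_opp.
  replace ((- lp m n) ^ 2) with (lp m n ^ 2) by ring. ring.
Qed.

Lemma wp_reg_opp z : wp_reg (- z) = wp_reg z.
Proof.
  unfold wp_reg. rewrite <- (lattice_sum_opp (wp_term (- z))).
  apply lattice_sum_ext_loc. intros m n H. unfold wp_term.
  replace ((- z - - lp m n) ^ 2) with ((z - lp m n) ^ 2) by ring.
  replace ((- lp m n) ^ 2) with (lp m n ^ 2) by ring. ring.
Qed.

Lemma wzeta_opp z : wzeta tau (- z) = - wzeta tau z.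
Proof. rewrite !wzeta_split, zeta_reg_opp, Cinv_opp. ring. Qed.

Lemma wp_opp z : wp tau (- z) = wp tau z.
Proof. rewrite !wp_split, wp_reg_opp. f_equal. f_equal. ring. Qed.

Lemma wp_d1_opp z : wp_d1 (- z) = - wp_d1 z.
Proof.
  unfold wp_d1, pow_reg. rewrite <- (lattice_sum_opp (pow_term 3 (- z))).
  replace (lattice_sum tau (fun w => pow_term 3 (- z) (- w))) with (RtoC (-1) * lattice_sum tau (pow_term 3 z)).
  - replace ((- z) ^ 3) with (- z ^ 3) by (simpl; ring). rewrite Cinv_opp. ring.
  - rewrite <- lattice_sum_scal by (apply pow_term_dom; lia). apply lattice_sum_ext_loc. intros m n H. unfold pow_term, Cdiv.
    replace ((- z - - lp m n) ^ 3) with (- (z - lp m n) ^ 3) by (simpl; ring). rewrite Cinv_opp. ring.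
Qed.

Lemma zeta_reg_0 : zeta_reg 0 = 0.
Proof.
  assert (H := zeta_reg_opp 0). replace (- 0) with (RtoC 0) in H by ring.
  assert (E : 2 * zeta_reg 0 = 0) by (replace (2 * zeta_reg 0) with (zeta_reg 0 + zeta_reg 0) by ring; rewrite H at 1; ring).
  replace (zeta_reg 0) with (/ 2 * (2 * zeta_reg 0)) by (field; auto). rewrite E. ring.
Qed.

Lemma wp_reg_0 : wp_reg 0 = 0.
Proof.
  apply (lattice_sum_cv tau (wp_term 0)). eapply Cseq_ext; [|apply Cseq_const].
  intros N. symmetry. rewrite (square_sum_ext _ (fun _ _ => 0 * 0)).
  - rewrite (square_sum_scal 0). ring.
  - intros m n. unfold lattice_array, wp_term. destruct (_ && _)%bool; [ring|].
    replace ((0 - lp m n) ^ 2) with (lp m n ^ 2) by ring. ring.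
Qed.

Lemma Cinv_conj' z : Cconj (/ z) = / Cconj z.
Proof.
  destruct (excluded_middle_informative (z = 0)) as [->|n]; [|now apply Cinv_conj].
  apply C_ext; simpl; unfold Rdiv; rewrite ?Ropp_0, ?Rmult_0_l, ?Rmult_0_r, ?Rplus_0_l, ?Rinv_0; ring.
Qed.

Lemma wzeta_conj z : wzeta tau (Cconj z) = Cconj (wzeta tau z).
Proof.
  rewrite !wzeta_split, Cplus_conj, Cinv_conj'. f_equal. unfold zeta_reg.
  rewrite <- lattice_sum_conj by apply zeta_term_dom. apply lattice_sum_ext_loc. intros m n _. unfold zeta_term, Cdiv.
  rewrite !Cplus_conj, !Cmult_conj, !Cinv_conj', Cpow_conj, Cminus_conj, !Cconj_conj.
  f_equal. f_equal; f_equal; apply C_ext; simpl; ring.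
Qed.

Lemma wp_conj z : wp tau (Cconj z) = Cconj (wp tau z).
Proof.
  rewrite !wp_split, Cplus_conj, Cinv_conj', Cpow_conj. f_equal. unfold wp_reg.
  rewrite <- lattice_sum_conj by apply wp_term_dom. apply lattice_sum_ext_loc. intros m n _. unfold wp_term, Cdiv.
  rewrite !Cminus_conj, !Cmult_conj, !Cinv_conj', !Cpow_conj, Cminus_conj, !Cconj_conj.
  f_equal; f_equal; apply C_ext; simpl; ring.
Qed.
End W.

(** * Quasi-periodicity *)

Lemma inv_diff_bound z u w (r : R) : (0 < r)%R -> (r <= Cmod w)%R -> (2 * Cmod z <= r)%R -> (2 * Cmod u <= r)%R ->
  (Cmod (/ (z - w) - / (u - w)) <= 4 * Cmod (u - z) / r ^ 2)%R.
Proof.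
  intros Hr Hw Hz Hu.
  assert (Tz := Cmod_triangle_sub w z). assert (Tu := Cmod_triangle_sub w u).
  rewrite (Cmod_sub_sym w z) in Tz. rewrite (Cmod_sub_sym w u) in Tu.
  assert (A : (r / 2 <= Cmod (z - w))%R) by lra. assert (B : (r / 2 <= Cmod (u - w))%R) by lra.
  assert (NA : z - w <> 0) by (apply Cmod_gt_0; lra). assert (NB : u - w <> 0) by (apply Cmod_gt_0; lra).
  replace (/ (z - w) - / (u - w)) with ((u - z) * (/ (z - w) * / (u - w))) by (field; auto).
  rewrite !Cmod_mult, !Cmod_inv by auto.
  replace (4 * Cmod (u - z) / r ^ 2)%R with (Cmod (u - z) * (/ (r / 2) * / (r / 2)))%R by (field; lra).
  apply Rmult_le_compat_l; [apply Cmod_ge_0|].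
  apply Rmult_le_compat; try (apply Rlt_le, Rinv_0_lt_compat; lra); apply Rinv_le_contravar; lra.
Qed.

Section Shift.
Variable L : Z -> Z -> C.
Variable om : C.
Variable rho : R.
Hypothesis Hrho : (0 < rho)%R.
Hypothesis HL : forall m n N, Z.max (Z.abs m) (Z.abs n) = Z.of_nat N -> (rho * INR N <= Cmod (L m n))%R.
Hypothesis Hom : forall m n, L (m - 1) n = L m n - om.

Let S z N := square_sum (fun m n => / (z - L m n)) N.

(** A translation by the period of the first index telescopes; two boundary
    columns remain. *)
Lemma column_telescope z N : S (z + om) N - S z N =
  symsum (G := C_AbelianMonoid) (fun n => / (z - L (- Z.of_nat N - 1) n) - / (z - L (Z.of_nat N) n)) N.
Proof.
  unfold S. rewrite (square_sum_box (fun m n => / (z - L m n))), square_sum_box. unfold box.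
  rewrite (symsum_switch (G := C_AbelianMonoid) (fun m n => / (z + om - L m n))).
  rewrite (symsum_switch (G := C_AbelianMonoid) (fun m n => / (z - L m n))).
  set (A := symsum (fun n : Z => symsum (fun m : Z => / (z + om - L m n)) N) N).
  set (B := symsum (fun n : Z => symsum (fun m : Z => / (z - L m n)) N) N).
  set (D := symsum _ N).
  assert (E : A = plus D B).
  { unfold A, B, D. rewrite <- (symsum_plus (G := C_AbelianMonoid)). apply symsum_ext_loc. intros n _.
    assert (H := symsum_shift (G := C_AbelianMonoid) (fun m => / (z - L m n)) N).
    rewrite (symsum_ext_loc (fun k => / (z - L (k - 1) n)) (fun m => / (z + om - L m n))) in H.
    2:{ intros m _. rewrite Hom. f_equal. ring. }
    unfold plus in *; simpl in *.
    match goal with |- ?x = ?y - ?t + ?v => assert (HH : x + t = y + v) by exact H end.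
    match goal with |- ?x = ?y - ?t + ?v => replace x with (x + t - t) by ring end.
    rewrite HH. ring. }
  rewrite E. unfold plus; simpl. ring.
Qed.

(** A boundary column has [2 N + 1] terms, and between [z] and [u] each of them
    varies by [O (1 / N ^ 2)].  Hence the increment of [zeta] over a period does
    not depend on the point. *)
Lemma column_difference_vanishes z u : Cseq (fun N => (S (z + om) N - S z N) - (S (u + om) N - S u N)) 0.
Proof.
  set (K := (24 * Cmod (u - z) / rho ^ 2)%R).
  assert (HK : (0 <= K)%R).
  { apply Rmult_le_pos; [generalize (Cmod_ge_0 (u - z)); lra|]. apply Rlt_le, Rinv_0_lt_compat, pow_lt, Hrho. }
  destruct (nfloor_ex (2 * (Cmod z + Cmod u) / rho)) as [N0 [_ HN0]].
  { apply Rmult_le_pos; [generalize (Cmod_ge_0 z), (Cmod_ge_0 u); lra|]. now apply Rlt_le, Rinv_0_lt_compat. }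
  apply (is_lim_seq_le_le_loc (fun _ => 0%R) _ (fun n => K * / INR n)%R); [|apply is_lim_seq_const|].
  2:{ replace (Finite 0) with (Rbar_mult K (Rbar_inv p_infty)) by (simpl; f_equal; ring).
      apply is_lim_seq_scal_l. apply is_lim_seq_inv; [apply is_lim_seq_INR|easy]. }
  exists (N0 + 1)%nat. intros N HN. split; [apply Cmod_ge_0|].
  assert (HN1 : (1 <= INR N)%R) by (replace 1%R with (INR 1) by reflexivity; apply le_INR; lia).
  assert (HNr : (2 * (Cmod z + Cmod u) <= rho * INR N)%R).
  { assert (INR (N0 + 1) <= INR N)%R by (apply le_INR; lia). rewrite plus_INR in H. simpl in H.
    apply Rmult_le_reg_r with (/ rho)%R; [now apply Rinv_0_lt_compat|].
    replace (rho * INR N * / rho)%R with (INR N) by (field; lra). unfold Rdiv in HN0. lra. }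
  rewrite !column_telescope.
  replace (_ - 0) with (symsum (G := C_AbelianMonoid) (fun n => / (z - L (- Z.of_nat N - 1) n) - / (z - L (Z.of_nat N) n)
    - (/ (u - L (- Z.of_nat N - 1) n) - / (u - L (Z.of_nat N) n))) N).
  2:{ rewrite (symsum_ext_loc _ (fun n => plus (/ (z - L (- Z.of_nat N - 1) n) - / (z - L (Z.of_nat N) n) : C_AbelianMonoid)
        (RtoC (-1) * (/ (u - L (- Z.of_nat N - 1) n) - / (u - L (Z.of_nat N) n))))).
      2:{ intros k _. unfold plus; simpl. ring. }
      rewrite (symsum_plus (G := C_AbelianMonoid)), symsum_C_scal. unfold plus; simpl. ring. }
  apply Rle_trans with ((2 * INR N + 1) * (8 * Cmod (u - z) / (rho * INR N) ^ 2))%R.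
  - apply Cmod_symsum_bound. intros k Hk.
    match goal with |- (Cmod (?a - ?b - (?c - ?d)) <= _)%R => replace (a - b - (c - d)) with ((a - c) - (b - d)) by ring end.
    eapply Rle_trans; [apply Cmod_triangle|]. rewrite Cmod_opp.
    assert (A1 := HL (Z.of_nat N) k N ltac:(lia)).
    assert (A2 := HL (- Z.of_nat N - 1) k (Datatypes.S N) ltac:(lia)). rewrite S_INR in A2.
    assert (Pz := Cmod_ge_0 z). assert (Pu := Cmod_ge_0 u).
    assert (B1 := inv_diff_bound z u (L (Z.of_nat N) k) (rho * INR N) ltac:(nra) A1 ltac:(lra) ltac:(lra)).
    assert (B2 := inv_diff_bound z u (L (- Z.of_nat N - 1) k) (rho * INR N) ltac:(nra) ltac:(nra) ltac:(lra) ltac:(lra)).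
    lra.
  - unfold K. replace ((2 * INR N + 1) * (8 * Cmod (u - z) / (rho * INR N) ^ 2))%R with
      ((8 * Cmod (u - z) / rho ^ 2) * / INR N * ((2 * INR N + 1) / INR N))%R by (field; lra).
    replace (24 * Cmod (u - z) / rho ^ 2 * / INR N)%R with ((8 * Cmod (u - z) / rho ^ 2) * / INR N * 3)%R by (field; lra).
    apply Rmult_le_compat_l.
    + apply Rmult_le_pos; [|apply Rlt_le, Rinv_0_lt_compat; lra].
      apply Rmult_le_pos; [generalize (Cmod_ge_0 (u - z)); lra|]. apply Rlt_le, Rinv_0_lt_compat, pow_lt, Hrho.
    + apply Rmult_le_reg_r with (INR N); [lra|]. unfold Rdiv. rewrite Rmult_assoc, Rinv_l by lra. lra.
Qed.
End Shift.

Section Quasi.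
Variable tau : C.
Hypothesis Htau : Re tau = 0%R /\ (0 < Im tau)%R.
Notation lp := (lattice_point tau).
Notation zeta := (wzeta tau).

Lemma sum_delta x N : square_sum (fun m n : Z => if (Z.eqb m 0 && Z.eqb n 0)%bool then x else 0) N = x.
Proof.
  induction N as [|N IH].
  - rewrite square_sum_box. unfold box. rewrite !symsum_0. reflexivity.
  - assert (H := shell_bound (fun m n : Z => if (Z.eqb m 0 && Z.eqb n 0)%bool then x else 0) N 0).
    rewrite IH in H. rewrite Rmult_0_r in H.
    assert (E : (Cmod (square_sum (fun m n : Z => if (Z.eqb m 0 && Z.eqb n 0)%bool then x else 0) (S N) - x) <= 0)%R).
    { apply H. intros m n Hmn. destruct (Z.eqb m 0 && Z.eqb n 0)%bool eqn:E; [|rewrite Cmod_0; lra].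
      apply andb_prop in E. rewrite !Z.eqb_eq in E. lia. }
    apply Rle_antisym in E; [|apply Cmod_ge_0]. symmetry in E. apply Cmod_eq_0 in E.
    match goal with |- ?s = x => replace s with (s - x + x) by ring end. rewrite E. ring.
Qed.

Lemma zeta_partial z N : / z + square_sum (lattice_array tau (zeta_term z)) N =
  square_sum (fun m n => / (z - lp m n)) N + square_sum (lattice_array tau (fun w => / w)) N
   + z * square_sum (lattice_array tau (fun w => / w ^ 2)) N.
Proof.
  rewrite <- (sum_delta (/ z) N) at 1. rewrite <- square_sum_scal, <- !square_sum_plus.
  apply square_sum_ext. intros m n. unfold lattice_array.
  destruct (Z.eqb m 0 && Z.eqb n 0)%bool eqn:E.
  - apply andb_prop in E. rewrite !Z.eqb_eq in E. destruct E; subst.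
    replace (lp 0 0) with (RtoC 0) by (apply C_ext; rewrite ?lp_Re, ?lp_Im by easy; simpl; ring).
    replace (z - 0) with z by ring. ring.
  - unfold zeta_term, Cdiv. ring.
Qed.

Lemma zeta_lim z : Cseq (fun N => / z + square_sum (lattice_array tau (zeta_term z)) N) (zeta z).
Proof.
  rewrite wzeta_split. apply Cseq_plus; [apply Cseq_const|]. apply lattice_sum_lim; now apply zeta_term_dom.
Qed.

Lemma zeta_quasi (L : Z -> Z -> C) om rho z u : (0 < rho)%R ->
  (forall m n N, Z.max (Z.abs m) (Z.abs n) = Z.of_nat N -> (rho * INR N <= Cmod (L m n))%R) ->
  (forall m n, L (m - 1)%Z n = L m n - om) ->
  (forall z N, square_sum (fun m n => / (z - lp m n)) N = square_sum (fun m n => / (z - L m n)) N) ->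
  zeta (z + om) - zeta z = zeta (u + om) - zeta u.
Proof.
  intros Hr HL Hom E.
  assert (A := column_difference_vanishes L om rho Hr HL Hom z u).
  assert (B : Cseq (fun N => (/ (z + om) + square_sum (lattice_array tau (zeta_term (z + om))) N - (/ z + square_sum (lattice_array tau (zeta_term z)) N))
    - (/ (u + om) + square_sum (lattice_array tau (zeta_term (u + om))) N - (/ u + square_sum (lattice_array tau (zeta_term u)) N)))
    ((zeta (z + om) - zeta z) - (zeta (u + om) - zeta u))).
  { apply Cseq_minus; apply Cseq_minus; apply zeta_lim. }
  assert (D : (zeta (z + om) - zeta z) - (zeta (u + om) - zeta u) = 0).
  { eapply Cseq_unique; [exact B|]. eapply Cseq_ext; [|exact A]. intros N. cbv beta.
    rewrite !zeta_partial, !E. ring. }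
  replace (zeta (z + om) - zeta z) with ((zeta (z + om) - zeta z) - (zeta (u + om) - zeta u) + (zeta (u + om) - zeta u)) by ring.
  rewrite D. ring.
Qed.

Definition is_period (om : C) : Prop := om = 1 \/ om = tau.

Lemma zeta_quasi_period om z u : is_period om -> zeta (z + om) - zeta z = zeta (u + om) - zeta u.
Proof.
  assert (P := ltau_pos tau Htau).
  intros [->| ->].
  - apply zeta_quasi with lp (lattice_gap tau); auto.
    + intros. now apply lp_large.
    + intros. unfold lattice_point. rewrite minus_IZR, RtoC_minus. ring.
  - apply zeta_quasi with (fun m n => lp n m) (lattice_gap tau); auto.
    + intros m n N H. apply lp_large; [easy|]. now rewrite Z.max_comm.
    + intros. unfold lattice_point. rewrite minus_IZR, RtoC_minus. ring.
    + intros v N. exact (symsum_switch (G := C_AbelianMonoid) (fun m n => / (v - lp m n)) N N).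
Qed.

Definition eta (om : C) : C := zeta (0 + om) - zeta 0.

Lemma zeta_period om z : is_period om -> zeta (z + om) = zeta z + eta om.
Proof.
  intros H. unfold eta. rewrite <- (zeta_quasi_period om z 0 H). ring.
Qed.

Lemma nl_period om z : is_period om -> off_lattice tau (z + om) <-> off_lattice tau z.
Proof.
  intros [->| ->]; split; intros H m n E.
  - apply (H (m + 1)%Z n). rewrite <- E. unfold lattice_point. rewrite plus_IZR, RtoC_plus. ring.
  - apply (H (m - 1)%Z n). unfold lattice_point in *. rewrite minus_IZR, RtoC_minus.
    replace (IZR m - 1 + IZR n * tau) with (IZR m + IZR n * tau - 1) by ring. rewrite E. ring.
  - apply (H m (n + 1)%Z). rewrite <- E. unfold lattice_point. rewrite plus_IZR, RtoC_plus. ring.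
  - apply (H m (n - 1)%Z). unfold lattice_point in *. rewrite minus_IZR, RtoC_minus.
    replace (IZR m + (IZR n - 1) * tau) with (IZR m + IZR n * tau - tau) by ring. rewrite E. ring.
Qed.

Lemma cdiff_shift (f : C -> C) om z l : cdiff f (z + om) l -> cdiff (fun u => f (u + om)) z l.
Proof.
  intros H. eapply diff_eq.
  - apply (diff_comp (fun z => z) f (fun u => u + om)); [exact H|].
    apply diff_plus; [apply (diff_i (fun z => z))|apply diff_const].
  - ring.
Qed.

Lemma wp_period om z : is_period om -> off_lattice tau z -> wp tau (z + om) = wp tau z.
Proof.
  intros Hom H. assert (H' := proj2 (nl_period om z Hom) H).
  assert (A := wzeta_diff tau Htau _ H'). assert (B := wzeta_diff tau Htau _ H).
  apply cdiff_shift in A.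
  apply (diff_ext _ _ (fun u => zeta u + eta om)) in A; [|intros; now apply zeta_period].
  assert (D := diff_plus _ _ _ _ _ _ B (diff_const (fun z => z) (eta om) z)).
  assert (E := cdiff_unique _ _ _ _ A D).
  replace (wp tau (z + om)) with (- - wp tau (z + om)) by ring. rewrite E. ring.
Qed.

Lemma deriv_period (f g : C -> C) om : is_period om ->
  (forall z, off_lattice tau z -> cdiff f z (g z)) -> (forall z, off_lattice tau z -> f (z + om) = f z) ->
  forall z, off_lattice tau z -> g (z + om) = g z.
Proof.
  intros Hom Hf Hp z H. assert (H' := proj2 (nl_period om z Hom) H).
  assert (A := cdiff_shift _ _ _ _ (Hf _ H')). destruct (nl_open tau Htau z H) as [r [Hr HN]].
  apply (cdiff_unique f z); [|now apply Hf].
  apply (diff_ext_loc _ (fun u => f (u + om))); [auto| |exact A].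
  exists r. split; [easy|]. intros u Hu. apply Hp, HN, Hu.
Qed.

Lemma wp_d1_period om z : is_period om -> off_lattice tau z -> wp_d1 tau (z + om) = wp_d1 tau z.
Proof.
  intros Hom. apply (deriv_period (wp tau) (wp_d1 tau) om Hom); intros; [now apply wp_diff|now apply wp_period].
Qed.

Lemma nl_opp z : off_lattice tau z -> off_lattice tau (- z).
Proof.
  intros H m n E. apply (H (- m) (- n))%Z. replace z with (- - z) by ring. rewrite <- E.
  unfold lattice_point. rewrite !opp_IZR, !RtoC_opp. ring.
Qed.

Lemma lattice_invariant (P : C -> C -> Prop) :
  (forall z, P z z) -> (forall a b c, P a b -> P b c -> P a c) -> (forall a b, P a b -> P b a) ->
  (forall z om, is_period om -> P z (z + om)) -> forall z m n, P z (z + lp m n).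
Proof.
  intros R T S H z m n.
  assert (A : forall om, is_period om -> forall k z, P z (z + IZR (Z.of_nat k) * om)).
  { intros om Hom k. induction k as [|k IH]; intros v.
    - simpl. replace (v + 0 * om) with v by ring. apply R.
    - rewrite Nat2Z.inj_succ, succ_IZR, RtoC_plus. eapply T; [apply IH|].
      replace (v + (IZR (Z.of_nat k) + 1) * om) with (v + IZR (Z.of_nat k) * om + om) by ring. now apply H. }
  assert (B : forall om, is_period om -> forall k z, P z (z + IZR k * om)).
  { intros om Hom k v. destruct (Z.le_ge_cases 0 k) as [h|h].
    - replace k with (Z.of_nat (Z.to_nat k)) by lia. now apply A.
    - apply S. replace v with (v + IZR k * om + IZR (Z.of_nat (Z.to_nat (- k))) * om) at 2.
      + now apply A.
      + replace (Z.of_nat (Z.to_nat (- k))) with (- k)%Z by lia. rewrite opp_IZR, RtoC_opp. ring. }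
  unfold lattice_point. rewrite Cplus_assoc. eapply T; [|apply B; right; easy].
  replace (z + IZR m) with (z + IZR m * 1) by ring. apply B. now left.
Qed.

Lemma nl_lp z m n : off_lattice tau (z + lp m n) <-> off_lattice tau z.
Proof.
  symmetry. apply (lattice_invariant (fun a b => off_lattice tau a <-> off_lattice tau b)); try tauto.
  intros. symmetry. now apply nl_period.
Qed.

Lemma invariant_fun (f : C -> C) : (forall om z, is_period om -> off_lattice tau z -> f (z + om) = f z) ->
  forall z m n, off_lattice tau z -> f (z + lp m n) = f z.
Proof.
  intros H z m n Hz.
  apply (lattice_invariant (fun a b => (off_lattice tau a <-> off_lattice tau b) /\ (off_lattice tau a -> f b = f a))); [| | | |exact Hz].
  - intuition.
  - intros a b c [A1 A2] [B1 B2]. split; [tauto|]. intros Ha. rewrite B2 by tauto. auto.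
  - intros a b [A1 A2]. split; [tauto|]. intros Hb. symmetry. apply A2. tauto.
  - intros v om Hom. split; [symmetry; now apply nl_period|]. intros. now apply H.
Qed.

Lemma wp_lp z m n : off_lattice tau z -> wp tau (z + lp m n) = wp tau z.
Proof. apply (invariant_fun (wp tau)). intros; now apply wp_period. Qed.
Lemma wp_d1_lp z m n : off_lattice tau z -> wp_d1 tau (z + lp m n) = wp_d1 tau z.
Proof. apply (invariant_fun (wp_d1 tau)). intros; now apply wp_d1_period. Qed.

Lemma not_nl z : ~ off_lattice tau z -> exists m n, z = lp m n.
Proof.
  intros H. destruct (excluded_middle_informative (exists m n, z = lp m n)) as [e|ne]; [easy|].
  exfalso. apply H. intros m n E. apply ne. now exists m, n.
Qed.

(** [zeta] is odd and commutes with conjugation, so that it is real on the real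
    axis and imaginary on the imaginary axis. *)
Lemma eta_1_real : Im (eta 1) = 0%R.
Proof.
  assert (H := zeta_period 1 (RtoC (1/3)) (or_introl eq_refl)).
  assert (R : forall x : R, Im (zeta x) = 0%R).
  { intros x. assert (E := wzeta_conj tau Htau x). replace (Cconj x) with (RtoC x) in E by (apply C_ext; simpl; ring).
    apply (f_equal Im) in E. rewrite im_conj in E. lra. }
  replace (eta 1) with (zeta (RtoC (1/3) + 1) - zeta (RtoC (1/3))) by (rewrite H; ring).
  rewrite <- RtoC_plus, Im_minus, !R. ring.
Qed.

Lemma zeta_imag (y : R) : Re (zeta (0, y)) = 0%R.
Proof.
  assert (E := wzeta_conj tau Htau (0, y)%R).
  replace (Cconj (0, y)%R) with (- ((0, y)%R : C)) in E by (apply C_ext; simpl; ring).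
  rewrite wzeta_opp in E by easy. apply (f_equal Re) in E. rewrite re_conj, Re_opp in E. lra.
Qed.

Lemma eta_tau_imag : Re (eta tau) = 0%R.
Proof.
  assert (H := zeta_period tau (0,1)%R (or_intror eq_refl)).
  replace (eta tau) with (zeta ((0,1)%R + tau) - zeta (0,1)%R) by (rewrite H; ring).
  replace ((0,1)%R + tau) with ((0, 1 + Im tau)%R : C) by (apply C_ext; simpl; unfold Re, Im in *; destruct Htau; simpl in *; lra).
  rewrite Re_minus, !zeta_imag. ring.
Qed.
End Quasi.

(** * Mean values over circles *)

Definition CInt (f : R -> C) (a b : R) : C := (RInt (fun s => Re (f s)) a b, RInt (fun s => Im (f s)) a b).

Definition d2 (p q : R * R) : R := Rmax (Rabs (fst q - fst p)) (Rabs (snd q - snd p)).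

Lemma cont_Re_2d (A : R -> R -> C) u s : cont d2 (fun p => A (fst p) (snd p)) (u, s) ->
  continuity_2d_pt (fun u s => Re (A u s)) u s.
Proof.
  intros H eps. destruct (H eps (cond_pos eps)) as [del [Hd F]]. exists (mkposreal del Hd).
  intros u' s' Hu Hs. rewrite <- Re_minus. eapply Rle_lt_trans; [apply re_le_Cmod|].
  apply (F (u', s')). unfold d2; simpl. now apply Rmax_lub_lt.
Qed.

Lemma cont_Im_2d (A : R -> R -> C) u s : cont d2 (fun p => A (fst p) (snd p)) (u, s) ->
  continuity_2d_pt (fun u s => Im (A u s)) u s.
Proof.
  intros H eps. destruct (H eps (cond_pos eps)) as [del [Hd F]]. exists (mkposreal del Hd).
  intros u' s' Hu Hs. rewrite <- Im_minus. eapply Rle_lt_trans; [apply im_le_Cmod|].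
  apply (F (u', s')). unfold d2; simpl. now apply Rmax_lub_lt.
Qed.

Lemma cont_d2_snd (A : R -> R -> C) u s : cont d2 (fun p => A (fst p) (snd p)) (u, s) -> cont dR (A u) s.
Proof.
  intros H eps He. destruct (H eps He) as [del [Hd F]]. exists del; split; [easy|].
  intros t Ht. apply (F (u, t)). unfold d2; simpl. replace (u - u)%R with 0%R by ring. rewrite Rabs_R0.
  apply Rmax_lub_lt; [easy|exact Ht].
Qed.

Lemma cont_dR_continuous_Re (f : R -> C) s : cont dR f s -> continuous (fun t => Re (f t)) s.
Proof.
  intros H. apply continuity_pt_filterlim. intros eps He. destruct (H eps He) as [del [Hd F]].
  exists del. split; [easy|]. intros t [_ Ht]. simpl. unfold R_dist. rewrite <- Re_minus.
  eapply Rle_lt_trans; [apply re_le_Cmod|]. apply F. exact Ht.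
Qed.

Lemma cont_dR_continuous_Im (f : R -> C) s : cont dR f s -> continuous (fun t => Im (f t)) s.
Proof.
  intros H. apply continuity_pt_filterlim. intros eps He. destruct (H eps He) as [del [Hd F]].
  exists del. split; [easy|]. intros t [_ Ht]. simpl. unfold R_dist. rewrite <- Im_minus.
  eapply Rle_lt_trans; [apply im_le_Cmod|]. apply F. exact Ht.
Qed.

Lemma cont_dI_dR (f : R -> C) s : cont (dI RtoC) f s <-> cont dR f s.
Proof.
  split; intros H eps He; destruct (H eps He) as [del [Hd F]]; exists del; (split; [easy|]); intros t Ht; apply F.
  - now rewrite dI_dR.
  - now rewrite <- dI_dR.
Qed.

Lemma param_integral_real (G A : R -> R -> R) (a b u : R) (r : R) : (a < u < b)%R ->
  (forall v s, (a < v < b)%R -> is_derive (fun v => G v s) v (A v s)) ->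
  (forall v s, (a < v < b)%R -> continuous (G v) s) ->
  (forall v s, (a < v < b)%R -> continuity_2d_pt A v s) ->
  is_RInt (A u) 0 1 r -> is_derive (fun v => RInt (G v) 0 1) u r.
Proof.
  intros Hu HG Hc HA Hr.
  assert (L : locally u (fun v => (a < v < b)%R)).
  { assert (P : (0 < Rmin (u - a) (b - u))%R) by (apply Rmin_pos; lra).
    exists (mkposreal _ P). intros v Hv. change (Rabs (v - u) < Rmin (u - a) (b - u))%R in Hv.
    apply Rabs_def2 in Hv. assert (M1 := Rmin_l (u - a) (b - u)). assert (M2 := Rmin_r (u - a) (b - u)). lra. }
  replace r with (RInt (fun t => Derive (fun v => G v t) u) 0 1).
  - apply is_derive_RInt_param.
    + apply filter_imp with (2 := L). intros v Hv t _. eexists. now apply HG.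
    + intros t _. apply continuity_2d_pt_ext_loc with (f := A).
      * destruct L as [d L]. exists d. intros v s Hv _. symmetry. apply is_derive_unique, HG, L, Hv.
      * now apply HA.
    + apply filter_imp with (2 := L). intros v Hv. apply (@ex_RInt_continuous R_CompleteNormedModule).
      intros. now apply Hc.
  - apply is_RInt_unique. apply is_RInt_ext with (f := A u); [|exact Hr].
    intros t _. symmetry. apply is_derive_unique. now apply HG.
Qed.

Lemma CInt_FTC (f g : R -> C) a b : (forall s, rdiff f s (g s)) -> (forall s, cont dR g s) ->
  is_RInt (fun s => Re (g s)) a b (Re (f b - f a)) /\ is_RInt (fun s => Im (g s)) a b (Im (f b - f a)).
Proof.
  intros H Hc. split.
  - apply (is_RInt_derive (fun s => Re (f s)) (fun s => Re (g s))); intros.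
    + now apply rdiff_Re.
    + now apply cont_dR_continuous_Re.
  - apply (is_RInt_derive (fun s => Im (f s)) (fun s => Im (g s))); intros.
    + now apply rdiff_Im.
    + now apply cont_dR_continuous_Im.
Qed.

(** When the two partial derivatives of [G] are proportional, the derivative of
    the integral is the integral of a derivative.  For [G v s = F (gamma v s)]
    with [F] holomorphic this is Cauchy's theorem for the region swept by a
    family of curves. *)
Lemma param_integral (G B : R -> R -> C) (k : R -> C) (a b u : R) : (a < u < b)%R ->
  (forall v s, (a < v < b)%R -> rdiff (fun v => G v s) v (k v * B v s)) ->
  (forall v s, (a < v < b)%R -> rdiff (fun s => G v s) s (B v s)) ->
  (forall v s, (a < v < b)%R -> cont d2 (fun p => B (fst p) (snd p)) (v, s)) ->
  (forall v, (a < v < b)%R -> cont dR k v) ->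
  rdiff (fun v => CInt (G v) 0 1) u (k u * (G u 1%R - G u 0%R)).
Proof.
  intros Hu Hv Hs HB Hk.
  assert (HA : forall v s, (a < v < b)%R -> cont d2 (fun p => k (fst p) * B (fst p) (snd p)) (v, s)).
  { intros v s H. apply (cont_mult d2 (fun p => k (fst p))); [|now apply HB].
    intros eps He. destruct (Hk v H eps He) as [del [Hd F]]. exists del; split; [easy|].
    intros [v' s'] Hp. apply F. eapply Rle_lt_trans; [|exact Hp]. apply Rmax_l. }
  assert (Gc : forall v s, (a < v < b)%R -> cont dR (G v) s).
  { intros v s H. apply cont_dI_dR. eapply diff_cont. now apply Hs. }
  assert (D : forall s, rdiff (fun t => k u * G u t) s (k u * B u s)) by (intros; now apply diff_scal, Hs).
  destruct (CInt_FTC _ _ 0 1 D) as [IR II].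
  { intros s. apply (cont_d2_snd (fun v s => k v * B v s)). now apply HA. }
  apply is_derive_rdiff.
  - apply (param_integral_real (fun v s => Re (G v s)) (fun v s => Re (k v * B v s)) a b u); auto.
    + intros v s H. apply (rdiff_Re (fun v => G v s)). now apply Hv.
    + intros v s H. apply cont_dR_continuous_Re. now apply Gc.
    + intros v s H. apply (cont_Re_2d (fun v s => k v * B v s)). now apply HA.
    + replace (Re (k u * (G u 1%R - G u 0%R))) with (Re (k u * G u 1%R - k u * G u 0%R)); [exact IR|f_equal; ring].
  - apply (param_integral_real (fun v s => Im (G v s)) (fun v s => Im (k v * B v s)) a b u); auto.
    + intros v s H. apply (rdiff_Im (fun v => G v s)). now apply Hv.
    + intros v s H. apply cont_dR_continuous_Im. now apply Gc.
    + intros v s H. apply (cont_Im_2d (fun v s => k v * B v s)). now apply HA.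
    + replace (Im (k u * (G u 1%R - G u 0%R))) with (Im (k u * G u 1%R - k u * G u 0%R)); [exact II|f_equal; ring].
Qed.

Lemma rdiff_0_constant (f : R -> C) (a b u v : R) : (forall t, (a < t < b)%R -> rdiff f t 0) ->
  (a < u < b)%R -> (a < v < b)%R -> f u = f v.
Proof.
  intros H Hu Hv.
  assert (M : forall t, (Rmin u v <= t <= Rmax u v)%R -> (a < t < b)%R).
  { intros t [H1 H2]. split.
    - eapply Rlt_le_trans; [|exact H1]. apply Rmin_glb_lt; lra.
    - eapply Rle_lt_trans; [exact H2|]. apply Rmax_lub_lt; lra. }
  apply C_ext.
  - destruct (MVT_gen (fun t => Re (f t)) u v (fun _ => 0%R)) as [c [_ E]].
    + intros t Ht. apply (rdiff_Re f t 0), H, M; lra.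
    + intros t Ht. apply continuity_pt_filterlim, cont_dR_continuous_Re, cont_dI_dR. eapply diff_cont, H, M, Ht.
    + lra.
  - destruct (MVT_gen (fun t => Im (f t)) u v (fun _ => 0%R)) as [c [_ E]].
    + intros t Ht. apply (rdiff_Im f t 0), H, M; lra.
    + intros t Ht. apply continuity_pt_filterlim, cont_dR_continuous_Im, cont_dI_dR. eapply diff_cont, H, M, Ht.
    + lra.
Qed.

Definition cis (s : R) : C := (cos (2 * PI * s), sin (2 * PI * s)).
Lemma cis_mod s : Cmod (cis s) = 1%R.
Proof.
  unfold cis, Cmod. simpl. replace (_ + _)%R with ((Rsqr (sin (2 * PI * s)) + Rsqr (cos (2 * PI * s))))%R by (unfold Rsqr; ring).
  rewrite sin2_cos2. apply sqrt_1.
Qed.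
Lemma cis_0 : cis 0 = 1.
Proof. unfold cis. rewrite Rmult_0_r, cos_0, sin_0. reflexivity. Qed.
Lemma cis_1 : cis 1 = 1.
Proof. unfold cis. rewrite Rmult_1_r, cos_2PI, sin_2PI. reflexivity. Qed.
Lemma cis_half : cis (1/2) = -1.
Proof. unfold cis. replace (2 * PI * (1/2))%R with PI by field. rewrite cos_PI, sin_PI. reflexivity. Qed.
Lemma cis_diff s : rdiff cis s (2 * PI * Ci * cis s).
Proof.
  apply is_derive_rdiff; unfold cis, Re, Im; simpl; (auto_derive; [easy|ring]).
Qed.

(** Holomorphic in a punctured disc and continuous at its centre: the form in
    which an elliptic function presents itself at a point where its poles
    cancel. *)
Definition removable_at (f : C -> C) (z : C) : Prop :=
  cont dC f z /\ exists (r : R) (g : C -> C), (0 < r)%R /\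
    forall v, (0 < Cmod (v - z) < r)%R -> cdiff f v (g v) /\ cont dC g v.

(** The mean over the circle of radius [u] has derivative 0 in [u] and tends to
    [f z].  Only the punctured disc enters, so that [z] may be a removable
    singularity.  The factor [kap] rotates the circle, in order to place a given
    point of it at [s = 1 / 2]. *)
Lemma circle_mean (f : C -> C) z (kap : C) : Cmod kap = 1%R -> cont dC f z ->
  forall (r : R) (g : C -> C), (forall v, (0 < Cmod (v - z) < r)%R -> cdiff f v (g v) /\ cont dC g v) ->
  forall u, (0 < u < r)%R -> CInt (fun s => f (z + u * (kap * cis s))) 0 1 = f z.
Proof.
  intros Hk Hc r g Hg u Hu.
  assert (Hn : forall (v s : R), (0 < v < r)%R -> (0 < Cmod (z + v * (kap * cis s) - z) < r)%R).
  { intros v s Hv. replace (z + v * (kap * cis s) - z) with (v * (kap * cis s)) by ring.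
    rewrite !Cmod_mult, Hk, cis_mod, Cmod_R, Rabs_pos_eq; lra. }
  set (I := fun v : R => CInt (fun s => f (z + v * (kap * cis s))) 0 1).
  assert (DI : forall v, (0 < v < r)%R -> rdiff I v 0).
  { intros v Hv. eapply diff_eq.
    - apply (param_integral (fun v s => f (z + v * (kap * cis s)))
        (fun v s => g (z + v * (kap * cis s)) * (v * (kap * (2 * PI * Ci * cis s)))) (fun v => / (2 * PI * Ci * v)) 0 r v Hv).
      + intros w s Hw. eapply diff_eq.
        * apply (diff_comp RtoC f (fun w : R => z + w * (kap * cis s))); [apply (Hg _ (Hn w s Hw))|].
          apply diff_plus; [apply diff_const|]. apply diff_mult; [apply diff_i|apply diff_const].
        * assert (PIn := PI_neq0). assert (w <> 0)%R by lra.
          cbv beta. field. repeat split; try (intros E; apply RtoC_inj in E; lra).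
          intros E. apply (f_equal Im) in E. simpl in E. lra.
      + intros w s Hw. eapply diff_eq.
        * apply (diff_comp RtoC f (fun s : R => z + w * (kap * cis s))); [apply (Hg _ (Hn w s Hw))|].
          apply diff_plus; [apply diff_const|]. apply diff_scal, diff_scal, cis_diff.
        * ring.
      + intros w s Hw.
        assert (Cf : cont d2 (fun p : R * R => RtoC (fst p)) (w, s)).
        { intros eps He. exists eps. split; [easy|]. intros p Hp. simpl. rewrite <- RtoC_minus, Cmod_R.
          eapply Rle_lt_trans; [|exact Hp]. apply Rmax_l. }
        assert (Cs : cont d2 (fun p : R * R => cis (snd p)) (w, s)).
        { assert (Q := proj1 (cont_dI_dR _ _) (diff_cont _ _ _ _ (cis_diff s))).
          intros eps He. destruct (Q eps He) as [del [Hd F]]. exists del; split; [easy|].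
          intros p Hp. apply F. eapply Rle_lt_trans; [|exact Hp]. apply Rmax_r. }
        apply cont_mult.
        * apply (cont_comp d2 g (fun p => z + fst p * (kap * cis (snd p)))).
          -- apply (Hg _ (Hn w s Hw)).
          -- apply cont_plus; [apply cont_const|]. apply cont_mult; [easy|]. apply cont_mult; [apply cont_const|easy].
        * apply cont_mult; [easy|]. apply cont_mult; [apply cont_const|]. apply cont_mult; [apply cont_const|easy].
      + intros w Hw. apply cont_dI_dR. apply cont_inv.
        * repeat apply Cmult_neq_0; try (intros E; apply RtoC_inj in E; generalize PI_RGT_0; lra).
          intros E. apply (f_equal Im) in E. simpl in E. lra.
        * apply cont_mult; [apply cont_const|apply cont_i].
    - rewrite cis_0, cis_1. ring. }
  assert (KI : forall v, (0 < v < r)%R -> I v = I u) by (intros; now apply (rdiff_0_constant I 0 r)).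
  change (I u = f z).
  assert (E : forall eps, (0 < eps)%R -> (Cmod (I u - f z) <= eps)%R).
  { intros eps He. destruct (Hc (eps / 2)%R) as [del [Hd F]]; [lra|].
    set (v := Rmin (del / 2) u). assert (Hv : (0 < v)%R) by (apply Rmin_pos; lra).
    assert (Hv1 : (v <= del / 2)%R) by apply Rmin_l. assert (Hv2 : (v <= u)%R) by apply Rmin_r.
    rewrite <- (KI v) by lra. eapply Rle_trans; [apply Cmod_le_Re_Im|].
    assert (Fc : forall s, cont dR (fun s => f (z + v * (kap * cis s))) s).
    { intros s. apply cont_dI_dR. apply cont_comp.
      - eapply (diff_cont (fun z => z)). apply (Hg _ (Hn v s ltac:(lra))).
      - apply cont_plus; [apply cont_const|]. apply cont_mult; [apply cont_const|]. apply cont_mult; [apply cont_const|].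
        eapply diff_cont, cis_diff. }
    assert (B : forall s, (Cmod (f (z + v * (kap * cis s))%C - f z)%C <= eps / 2)%R).
    { intros s. apply Rlt_le, F. unfold dC. replace (z + v * (kap * cis s) - z) with (v * (kap * cis s)) by ring.
      rewrite !Cmod_mult, Hk, cis_mod, Cmod_R, Rabs_pos_eq; lra. }
    assert (R1 : forall (h : R -> R) (c e : R), (forall s, continuous h s) -> (forall s, (Rabs (h s - c) <= e)%R) -> (Rabs (RInt h 0 1 - c) <= e)%R).
    { intros h c e Hh He'. assert (Ex : ex_RInt h 0 1) by (apply (@ex_RInt_continuous R_CompleteNormedModule); auto).
      assert (L : (c - e <= RInt h 0 1)%R).
      { replace (c - e)%R with (RInt (fun _ => (c - e)%R) 0 1) by (rewrite RInt_const; unfold scal; simpl; unfold mult; simpl; ring).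
        apply RInt_le; [lra|apply ex_RInt_const|easy|]. intros s _. specialize (He' s). apply Rabs_le_between in He'. lra. }
      assert (U : (RInt h 0 1 <= c + e)%R).
      { replace (c + e)%R with (RInt (fun _ => (c + e)%R) 0 1) by (rewrite RInt_const; unfold scal; simpl; unfold mult; simpl; ring).
        apply RInt_le; [lra|easy|apply ex_RInt_const|]. intros s _. specialize (He' s). apply Rabs_le_between in He'. lra. }
      apply Rabs_le_between. lra. }
    unfold I, CInt. rewrite Re_minus, Im_minus. simpl Re at 1. simpl Im at 1.
    assert (X := R1 (fun s : R => Re (f (z + v * (kap * cis s))%C)) (Re (f z)) (eps/2)%R).
    assert (Y := R1 (fun s : R => Im (f (z + v * (kap * cis s))%C)) (Im (f z)) (eps/2)%R).
    apply Rle_trans with (eps / 2 + eps / 2)%R; [|lra]. apply Rplus_le_compat; [apply X|apply Y].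
    - intros s. now apply (cont_dR_continuous_Re (fun s => f (z + v * (kap * cis s)))).
    - intros s. rewrite <- Re_minus. eapply Rle_trans; [apply re_le_Cmod|apply B].
    - intros s. now apply (cont_dR_continuous_Im (fun s => f (z + v * (kap * cis s)))).
    - intros s. rewrite <- Im_minus. eapply Rle_trans; [apply im_le_Cmod|apply B]. }
  assert (Z : Cmod (I u - f z) = 0%R).
  { apply Rle_antisym; [|apply Cmod_ge_0]. apply le_epsilon. intros eps He. rewrite Rplus_0_l. auto. }
  apply Cmod_eq_0 in Z. replace (I u) with (I u - f z + f z) by ring. rewrite Z. ring.
Qed.

(** The primitive of [h] is monotone with equal values at 0 and 1, hence
    constant; its derivative is [h]. *)
Lemma RInt_0_nonneg (h : R -> R) : (forall s, continuous h s) -> (forall s, (0 <= h s)%R) -> RInt h 0 1 = 0%R ->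
  h (1/2)%R = 0%R.
Proof.
  intros Hc Hp H0.
  assert (Ex : forall a b, ex_RInt h a b) by (intros; apply (@ex_RInt_continuous R_CompleteNormedModule); auto).
  assert (Z : forall t, (0 <= t <= 1)%R -> RInt h 0 t = 0%R).
  { intros t Ht. assert (A : (0 <= RInt h 0 t)%R) by (apply RInt_ge_0; auto; lra).
    assert (B : (0 <= RInt h t 1)%R) by (apply RInt_ge_0; auto; lra).
    assert (E := RInt_Chasles h 0 t 1 (Ex _ _) (Ex _ _)). unfold plus in E; simpl in E. rewrite H0 in E. lra. }
  assert (D : is_derive (fun t => RInt h 0 t) (1/2)%R (h (1/2)%R)).
  { apply (is_derive_RInt h _ 0%R); [|apply Hc]. apply filter_forall. intros t. apply (RInt_correct h), Ex. }
  assert (D0 : is_derive (fun t => RInt h 0 t) (1/2)%R 0%R).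
  { apply is_derive_ext_loc with (fun _ => 0%R); [|apply @is_derive_const].
    assert (P : (0 < 1/2)%R) by lra. exists (mkposreal _ P). intros t Ht.
    change (Rabs (t - 1/2) < 1/2)%R in Ht. apply Rabs_def2 in Ht. symmetry. apply Z. lra. }
  apply is_derive_unique in D. apply is_derive_unique in D0. exact (eq_trans (eq_sym D) D0).
Qed.

(** The difference to the maximum is nonnegative and has mean 0 over every small
    circle. *)
Lemma local_max (f : C -> C) z : removable_at f z -> exists r, (0 < r)%R /\ forall r', (0 < r' <= r)%R ->
  (forall v, (Cmod (v - z) < r')%R -> (Re (f v) <= Re (f z))%R) ->
  forall v, (Cmod (v - z) < r')%R -> Re (f v) = Re (f z).
Proof.
  intros [Hc [r [g [Hr Hg]]]]. exists r. split; [easy|]. intros r' Hr' Hle v Hv.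
  destruct (excluded_middle_informative (v = z)) as [->|n]; [easy|].
  apply Csub_neq in n. assert (P : (0 < Cmod (v - z))%R) by now apply Cmod_gt_0.
  set (u := Cmod (v - z)) in *. set (kap := - (v - z) / u).
  assert (Nu : RtoC u <> 0) by (intros E; apply RtoC_inj in E; lra).
  assert (Hk : Cmod kap = 1%R).
  { unfold kap. rewrite Cmod_div, Cmod_opp, Cmod_R, Rabs_pos_eq by (auto; lra). fold u. field. lra. }
  assert (M := circle_mean f z kap Hk Hc r g Hg u ltac:(lra)).
  assert (Fc : forall s, cont dR (fun s => f (z + u * (kap * cis s))%C) s).
  { intros s. apply cont_dI_dR. apply cont_comp.
    - eapply (diff_cont (fun z => z)). apply Hg. replace (z + u * (kap * cis s) - z) with (u * (kap * cis s)) by ring.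
      rewrite !Cmod_mult, Hk, cis_mod, Cmod_R, Rabs_pos_eq; lra.
    - apply cont_plus; [apply cont_const|]. apply cont_mult; [apply cont_const|]. apply cont_mult; [apply cont_const|].
      eapply diff_cont, cis_diff. }
  apply (f_equal Re) in M. unfold CInt in M. simpl Re at 1 in M.
  assert (Ec : forall s, continuous (fun s => Re (f (z + u * (kap * cis s))%C)) s).
  { intros s. now apply (cont_dR_continuous_Re (fun s => f (z + u * (kap * cis s))%C)). }
  assert (Z := RInt_0_nonneg (fun s => Re (f z) - Re (f (z + u * (kap * cis s))%C))%R).
  cbv beta in Z. rewrite cis_half in Z.
  replace (z + u * (kap * -1)) with v in Z by (unfold kap; field; auto).
  assert (Q : (Re (f z) - Re (f v))%R = 0%R); [apply Z|lra].
  - intros s. apply (continuous_minus (fun _ => Re (f z))); [apply continuous_const|apply Ec].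
  - intros s. specialize (Hle (z + u * (kap * cis s))).
    replace (z + u * (kap * cis s) - z) with (u * (kap * cis s)) in Hle by ring.
    rewrite !Cmod_mult, Hk, cis_mod, Cmod_R, Rabs_pos_eq in Hle by lra. specialize (Hle ltac:(lra)). lra.
  - rewrite (RInt_minus (fun _ => Re (f z)) (fun s => Re (f (z + u * (kap * cis s))%C))).
    + rewrite M, RInt_const. unfold minus, plus, opp, scal; simpl; unfold mult; simpl. ring.
    + apply ex_RInt_const.
    + apply (@ex_RInt_continuous R_CompleteNormedModule). intros; apply Ec.
Qed.

(** * The strong maximum principle and Liouville's theorem *)

(** The parameters up to which the maximum [M] persists form a set that is closed
    by continuity and open by [local_max]. *)
Lemma segment_max (f : C -> C) z w M :
  (forall t, (0 <= t < 1)%R -> removable_at f (z + t * (w - z)) /\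
     exists r, (0 < r)%R /\ forall v, (Cmod (v - (z + t * (w - z))) < r)%R -> (Re (f v) <= M)%R) ->
  cont dC f w -> Re (f z) = M -> Re (f w) = M.
Proof.
  intros H Hw Hz. set (g := fun t : R => z + t * (w - z)).
  set (E := fun t => (0 <= t <= 1)%R /\ forall s, (0 <= s <= t)%R -> Re (f (g s)) = M).
  assert (E0 : E 0%R).
  { split; [lra|]. intros s Hs. replace s with 0%R by lra. unfold g. replace (z + 0 * (w - z)) with z by ring. easy. }
  destruct (completeness E) as [m [Hub Hlub]].
  { exists 1%R. intros t [Ht _]. lra. }
  { now exists 0%R. }
  assert (m0 : (0 <= m)%R) by (now apply Hub). assert (m1 : (m <= 1)%R) by (apply Hlub; intros t [Ht _]; lra).
  assert (Below : forall s, (0 <= s < m)%R -> Re (f (g s)) = M).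
  { intros s Hs. destruct (excluded_middle_informative (exists t, E t /\ (s < t)%R)) as [[t [[_ Et] Hst]]|n].
    - apply Et. lra.
    - exfalso. assert (m <= s)%R; [|lra]. apply Hlub. intros t Et.
      destruct (Rle_lt_dec t s); [easy|]. exfalso. apply n. now exists t. }
  assert (g1 : g 1%R = w) by (unfold g; ring).
  assert (gd : forall s t, Cmod (g t - g s) = (Rabs (t - s) * Cmod (w - z))%R).
  { intros s t. unfold g. replace (z + t * (w - z) - (z + s * (w - z))) with (RtoC (t - s) * (w - z)) by (rewrite RtoC_minus; ring).
    now rewrite Cmod_mult, Cmod_R. }
  assert (Cm : cont dC f (g m)).
  { destruct (Req_dec m 1) as [->|n]; [now rewrite g1|]. apply (H m). lra. }
  assert (L := Cmod_ge_0 (w - z)).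
  assert (Em : Re (f (g m)) = M).
  { destruct (Req_dec m 0) as [->|n]; [unfold g; replace (z + 0 * (w - z)) with z by ring; easy|].
    apply cond_eq. intros eps He. destruct (Cm eps He) as [del [Hd F]].
    set (s := Rmax 0 (m - del / (2 * (Cmod (w - z) + 1)))).
    assert (Q : (0 < del / (2 * (Cmod (w - z) + 1)))%R) by (apply Rdiv_lt_0_compat; lra).
    assert (Hs : (0 <= s < m)%R) by (split; [apply Rmax_l|apply Rmax_lub_lt; lra]).
    rewrite <- (Below s Hs), <- Re_minus. eapply Rle_lt_trans; [apply re_le_Cmod|].
    rewrite Cmod_sub_sym. apply F. unfold dC. rewrite gd. rewrite Rabs_left by lra.
    assert (S2 : (m - del / (2 * (Cmod (w - z) + 1)) <= s)%R) by apply Rmax_r.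
    assert (S3 : (del / (2 * (Cmod (w - z) + 1)) * (Cmod (w - z) + 1) = del / 2)%R) by (field; lra). nra. }
  destruct (Req_dec m 1) as [->|n]; [now rewrite <- g1|exfalso].
  destruct (H m ltac:(lra)) as [Hn [r [Hr Hle]]]. fold (g m) in *.
  destruct (local_max f (g m) Hn) as [r1 [Hr1 Hloc]].
  set (r' := Rmin r r1). assert (P' : (0 < r')%R) by now apply Rmin_pos.
  assert (Loc : forall v, (Cmod (v - g m) < r')%R -> Re (f v) = M).
  { intros v Hv. rewrite <- Em. apply (Hloc r'); [split; [easy|apply Rmin_r]| |easy].
    intros v' Hv'. rewrite Em. apply Hle. eapply Rlt_le_trans; [exact Hv'|apply Rmin_l]. }
  set (t := Rmin 1 (m + r' / (2 * (Cmod (w - z) + 1)))).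
  assert (Q : (0 < r' / (2 * (Cmod (w - z) + 1)))%R) by (apply Rdiv_lt_0_compat; lra).
  assert (Ht : (m < t <= 1)%R) by (split; [apply Rmin_glb_lt; lra|apply Rmin_l]).
  assert (t <= m)%R; [|lra]. apply Hub. split; [lra|]. intros s Hs.
  destruct (Rlt_le_dec s m) as [h|h]; [apply Below; lra|]. apply Loc. rewrite gd, Rabs_pos_eq by lra.
  assert (S2 : (t <= m + r' / (2 * (Cmod (w - z) + 1)))%R) by apply Rmin_r.
  assert (S3 : (r' / (2 * (Cmod (w - z) + 1)) * (Cmod (w - z) + 1) = r' / 2)%R) by (field; lra). nra.
Qed.

(** Compactness of the rectangle, in the form of a positive lower bound for a
    gauge.  The same number serves as radius and as bound in [Q]. *)
Lemma rect_uniform (a b c d : R) (Q : R -> R -> R -> Prop) :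
  (forall x y e e', Q x y e -> (0 < e' <= e)%R -> Q x y e') ->
  (forall x y, (a <= x <= b)%R -> (c <= y <= d)%R -> exists e, (0 < e)%R /\
     forall x' y', (a <= x' <= b)%R -> (c <= y' <= d)%R -> (Rabs (x' - x) < e)%R -> (Rabs (y' - y) < e)%R -> Q x' y' e) ->
  exists e, (0 < e)%R /\ forall x y, (a <= x <= b)%R -> (c <= y <= d)%R -> Q x y e.
Proof.
  intros Hm H.
  assert (S : forall x y, exists e : posreal, (a <= x <= b)%R -> (c <= y <= d)%R ->
     forall x' y', (a <= x' <= b)%R -> (c <= y' <= d)%R -> (Rabs (x' - x) < e)%R -> (Rabs (y' - y) < e)%R -> Q x' y' e).
  { intros x y. destruct (excluded_middle_informative ((a <= x <= b)%R /\ (c <= y <= d)%R)) as [[h1 h2]|n].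
    - destruct (H x y h1 h2) as [e [He F]]. exists (mkposreal e He). auto.
    - exists (mkposreal 1 Rlt_0_1). intros; exfalso; auto. }
  set (del := fun x y => proj1_sig (constructive_indefinite_description _ (S x y))).
  destruct (compactness_value_2d a b c d del) as [e He]. exists e. split; [apply cond_pos|].
  intros x y Hx Hy. specialize (He x y Hx Hy).
  destruct (excluded_middle_informative (Q x y e)) as [q|n]; [easy|exfalso].
  apply He. intros [u [v [Hu [Hv [X [Y L]]]]]]. apply n.
  unfold del in *. destruct (constructive_indefinite_description _ (S u v)) as [e' F]. simpl in *.
  apply Hm with e'; [apply F; auto|]. split; [apply cond_pos|easy].
Qed.

(** The first use of [rect_uniform] bounds [u]; the second shows that a supremum
    [M] which is not attained could be lowered. *)
Lemma rect_max (a b c d : R) (u : R -> R -> R) : (a <= b)%R -> (c <= d)%R ->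
  (forall x y, (a <= x <= b)%R -> (c <= y <= d)%R -> forall eps, (0 < eps)%R -> exists e, (0 < e)%R /\
     forall x' y', (a <= x' <= b)%R -> (c <= y' <= d)%R -> (Rabs (x' - x) < e)%R -> (Rabs (y' - y) < e)%R -> (Rabs (u x' y' - u x y) < eps)%R) ->
  exists x0 y0, (a <= x0 <= b)%R /\ (c <= y0 <= d)%R /\ forall x y, (a <= x <= b)%R -> (c <= y <= d)%R -> (u x y <= u x0 y0)%R.
Proof.
  intros Hab Hcd H.
  destruct (rect_uniform a b c d (fun x y e => (u x y <= / e)%R)) as [e [He B]].
  { intros x y e e' h [h1 h2]. eapply Rle_trans; [exact h|]. now apply Rinv_le_contravar. }
  { intros x y Hx Hy. destruct (H x y Hx Hy 1%R Rlt_0_1) as [e [He F]].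
    assert (P : (0 < / (Rabs (u x y) + 1))%R) by (apply Rinv_0_lt_compat; generalize (Rabs_pos (u x y)); lra).
    exists (Rmin e (/ (Rabs (u x y) + 1))). split; [now apply Rmin_pos|]. intros x' y' Hx' Hy' A1 A2.
    assert (F' := F x' y' Hx' Hy' (Rlt_le_trans _ _ _ A1 (Rmin_l _ _)) (Rlt_le_trans _ _ _ A2 (Rmin_l _ _))).
    apply Rabs_def2 in F'. apply Rle_trans with (Rabs (u x y) + 1)%R; [generalize (Rle_abs (u x y)); lra|].
    apply Rle_trans with (/ / (Rabs (u x y) + 1))%R; [rewrite Rinv_inv; lra|].
    apply Rinv_le_contravar; [now apply Rmin_pos|apply Rmin_r]. }
  set (E := fun r => exists x y, (a <= x <= b)%R /\ (c <= y <= d)%R /\ u x y = r).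
  destruct (completeness E) as [M [Hub Hlub]].
  { exists (/ e)%R. intros r [x [y [Hx [Hy <-]]]]. auto. }
  { exists (u a c), a, c. repeat split; lra. }
  destruct (excluded_middle_informative (exists x0 y0, (a <= x0 <= b)%R /\ (c <= y0 <= d)%R /\ u x0 y0 = M)) as [[x0 [y0 [Hx [Hy Q]]]]|n].
  { exists x0, y0. split; [easy|split; [easy|]]. intros x y Hx' Hy'. rewrite Q. apply Hub. now exists x, y. }
  exfalso.
  destruct (rect_uniform a b c d (fun x y e => (u x y <= M - e)%R)) as [e2 [He2 B2]].
  { intros; lra. }
  { intros x y Hx Hy.
    assert (L : (u x y < M)%R).
    { destruct (Rle_lt_or_eq_dec (u x y) M) as [h|h]; [apply Hub; now exists x, y|easy|].
      exfalso. apply n. now exists x, y. }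
    destruct (H x y Hx Hy ((M - u x y) / 2)%R) as [e2 [He2 F]]; [lra|].
    exists (Rmin e2 ((M - u x y) / 2)). split; [apply Rmin_pos; lra|]. intros x' y' Hx' Hy' A1 A2.
    assert (F' := F x' y' Hx' Hy' (Rlt_le_trans _ _ _ A1 (Rmin_l _ _)) (Rlt_le_trans _ _ _ A2 (Rmin_l _ _))).
    apply Rabs_def2 in F'. assert (R2 := Rmin_r e2 ((M - u x y) / 2)). lra. }
  assert (M <= M - e2)%R; [|lra]. apply Hlub. intros r [x [y [Hx [Hy <-]]]]. auto.
Qed.

Section Liouville.
Variable tau : C.
Hypothesis Htau : Re tau = 0%R /\ (0 < Im tau)%R.

Lemma Z_round (x : R) : exists m : Z, (-1/2 <= x - IZR m <= 1/2)%R.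
Proof.
  exists (up (x - 1/2)). destruct (archimed (x - 1/2)). lra.
Qed.

Lemma coords z : z = Re z + (Im z / Im tau)%R * tau.
Proof. apply C_ext; simpl; unfold Re, Im in *; destruct Htau as [H1 H2]; rewrite ?H1; field; lra. Qed.

Lemma reduce z : exists m n (x y : R), z = x + y * tau + lattice_point tau m n /\ (-1/2 <= x <= 1/2)%R /\ (-1/2 <= y <= 1/2)%R.
Proof.
  destruct (Z_round (Re z)) as [m Hm]. destruct (Z_round (Im z / Im tau)) as [n Hn].
  exists m, n, (Re z - IZR m)%R, (Im z / Im tau - IZR n)%R. split; [|easy].
  rewrite (coords z) at 1. unfold lattice_point. rewrite !RtoC_minus. ring.
Qed.

Lemma period_lp (f : C -> C) : (forall om z, is_period tau om -> f (z + om) = f z) -> forall z m n, f (z + lattice_point tau m n) = f z.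
Proof.
  intros H z m n. symmetry. apply (lattice_invariant tau (fun a b => f a = f b)); try congruence.
  intros. symmetry. auto.
Qed.

Lemma cont_plane (f : C -> C) (a b z : C) (x y : R) : z = x * a + y * b -> cont dC f z -> forall eps, (0 < eps)%R -> exists e, (0 < e)%R /\
  forall x' y', (Rabs (x' - x) < e)%R -> (Rabs (y' - y) < e)%R -> (Cmod (f (x' * a + y' * b)%C - f z) < eps)%R.
Proof.
  intros E H eps He. destruct (H eps He) as [del [Hd F]].
  assert (Pa := Cmod_ge_0 a). assert (Pb := Cmod_ge_0 b).
  exists (del / (Cmod a + Cmod b + 1))%R. assert (Q : (0 < del / (Cmod a + Cmod b + 1))%R) by (apply Rdiv_lt_0_compat; lra).
  split; [easy|]. intros x' y' Hx Hy. apply F. unfold dC.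
  replace (x' * a + y' * b - z) with (RtoC (x' - x) * a + RtoC (y' - y) * b) by (rewrite E, !RtoC_minus; ring).
  eapply Rle_lt_trans; [apply Cmod_triangle|]. rewrite !Cmod_mult, !Cmod_R.
  set (q := (del / (Cmod a + Cmod b + 1))%R) in *. assert (Eq : (q * (Cmod a + Cmod b + 1) = del)%R) by (unfold q; field; lra).
  assert (Rabs (x' - x) * Cmod a <= q * Cmod a)%R by (apply Rmult_le_compat_r; lra).
  assert (Rabs (y' - y) * Cmod b <= q * Cmod b)%R by (apply Rmult_le_compat_r; lra). nra.
Qed.

(** By periodicity the maximum over a period cell is a global one; it spreads
    along segments to all of C. *)
Lemma liouville_Re (f : C -> C) : (forall om z, is_period tau om -> f (z + om) = f z) -> (forall z, removable_at f z) ->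
  forall z w, Re (f z) = Re (f w).
Proof.
  intros Hp Hn.
  destruct (rect_max (-1/2) (1/2) (-1/2) (1/2) (fun x y : R => Re (f (x * 1 + y * tau)%C))) as [x0 [y0 [_ [_ HM]]]]; [lra|lra| |].
  { intros x y _ _ eps He.
    destruct (cont_plane f 1 tau (x * 1 + y * tau) x y eq_refl (proj1 (Hn _)) eps He) as [e [He' F]].
    exists e. split; [easy|]. intros x' y' _ _ A B. rewrite <- Re_minus. eapply Rle_lt_trans; [apply re_le_Cmod|]. now apply F. }
  set (z0 := x0 * 1 + y0 * tau) in *.
  assert (Max : forall z, (Re (f z) <= Re (f z0))%R).
  { intros z. destruct (reduce z) as [m [n [x [y [E [Hx Hy]]]]]]. rewrite E, (period_lp f Hp).
    replace (x + y * tau) with (x * 1 + y * tau) by ring. now apply HM. }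
  assert (K : forall w, Re (f w) = Re (f z0)).
  { intros w. apply (segment_max f z0 w); [|apply Hn|easy]. intros t _. split; [apply Hn|].
    exists 1%R. split; [lra|]. intros; apply Max. }
  intros z w. now rewrite !K.
Qed.

Lemma liouville (f : C -> C) : (forall om z, is_period tau om -> f (z + om) = f z) -> (forall z, removable_at f z) ->
  forall z w, f z = f w.
Proof.
  intros Hp Hn z w. apply C_ext; [now apply liouville_Re|].
  assert (E : Re (- Ci * f z) = Re (- Ci * f w)).
  { apply (liouville_Re (fun z => - Ci * f z)).
    - intros om v H. now rewrite Hp.
    - intros v. destruct (Hn v) as [Hc [r [g [Hr Hg]]]]. split; [apply cont_mult; [apply cont_const|easy]|].
      exists r, (fun v => - Ci * g v). split; [easy|]. intros v' Hv'. destruct (Hg v' Hv') as [A B].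
      split; [now apply diff_scal|]. apply cont_mult; [apply cont_const|easy]. }
  unfold Re, Im in *; simpl in E; lra.
Qed.
End Liouville.

(** * Addition theorems *)

Lemma removable_regular (f g : C -> C) z (r : R) : (0 < r)%R ->
  (forall v, (Cmod (v - z) < r)%R -> cdiff f v (g v) /\ cont dC g v) -> removable_at f z.
Proof.
  intros Hr H. split.
  - eapply (diff_cont (fun z => z)). apply (H z). replace (z - z) with (RtoC 0) by ring. now rewrite Cmod_0.
  - exists r, g. split; [easy|]. intros v Hv. apply H. lra.
Qed.

(** This extends identities to the points where their derivation breaks down, and
    compares leading terms at poles. *)
Lemma punctured_zero (f : C -> C) z (r : R) : (0 < r)%R -> cont dC f z ->
  (forall v, (0 < Cmod (v - z) < r)%R -> f v = 0) -> f z = 0.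
Proof.
  intros Hr Hc H. destruct (excluded_middle_informative (f z = 0)) as [e|n]; [easy|exfalso].
  assert (P : (0 < Cmod (f z))%R) by now apply Cmod_gt_0.
  destruct (Hc _ P) as [del [Hd F]]. set (e := (Rmin del r / 2)%R).
  assert (He : (0 < Rmin del r)%R) by now apply Rmin_pos.
  assert (E : Cmod (z + e - z) = e).
  { replace (z + e - z) with (RtoC e) by ring. rewrite Cmod_R, Rabs_pos_eq; unfold e; lra. }
  assert (F' : (Cmod (f (z + e)%C - f z) < Cmod (f z))%R).
  { apply F. unfold dC. rewrite E. apply Rlt_le_trans with (Rmin del r); [unfold e; lra|apply Rmin_l]. }
  rewrite H in F'.
  - replace (0 - f z) with (- f z) in F' by ring. rewrite Cmod_opp in F'. lra.
  - rewrite E. split; [unfold e; lra|]. apply Rlt_le_trans with (Rmin del r); [unfold e; lra|apply Rmin_r].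
Qed.

Lemma cont_shift (f : C -> C) a z : cont dC f (z + a) -> cont dC (fun v => f (v + a)) z.
Proof.
  intros H. apply (cont_comp dC f (fun v => v + a)); [easy|]. apply cont_plus; [apply cont_id|apply cont_const].
Qed.

Section Add.
Variable tau : C.
Hypothesis Htau : Re tau = 0%R /\ (0 < Im tau)%R.
Notation lp := (lattice_point tau).
Notation zeta := (wzeta tau).
Notation P := (wp tau).
Notation nl := (off_lattice tau).

Lemma nl_punctured z : exists r, (0 < r)%R /\ forall v, (0 < Cmod (v - z) < r)%R -> nl v.
Proof.
  destruct (lattice_isolated tau Htau z) as [d [Hd HI]].
  exists (d / 2)%R. split; [lra|]. intros v Hv m n E.
  destruct (excluded_middle_informative (lp m n = z)) as [e|ne].
  - rewrite <- E, e in Hv. replace (z - z) with (RtoC 0) in Hv by ring. rewrite Cmod_0 in Hv. lra.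
  - specialize (HI m n ne). rewrite E, Cmod_sub_sym in HI. lra.
Qed.

Lemma zeta_diff_minus z a : nl (z - a) -> cdiff (fun u => zeta (u - a)) z (- P (z - a)).
Proof. intros H. apply (cdiff_shift zeta (- a) z). now apply wzeta_diff. Qed.
Lemma wp_diff_minus z a : nl (z - a) -> cdiff (fun u => P (u - a)) z (wp_d1 tau (z - a)).
Proof. intros H. apply (cdiff_shift P (- a) z). now apply wp_diff. Qed.
Lemma wp_d1_diff_minus z a : nl (z - a) -> cdiff (fun u => wp_d1 tau (u - a)) z (wp_d2 tau (z - a)).
Proof. intros H. apply (cdiff_shift (wp_d1 tau) (- a) z). now apply wp_d1_diff. Qed.

Lemma zeta_cont z : nl z -> cont dC zeta z.
Proof. intros H. apply (diff_cont (fun z => z) _ _ _ (wzeta_diff tau Htau z H)). Qed.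
Lemma wp_cont z : nl z -> cont dC P z.
Proof. intros H. apply (diff_cont (fun z => z) _ _ _ (wp_diff tau Htau z H)). Qed.
Lemma wp_d1_cont z : nl z -> cont dC (wp_d1 tau) z.
Proof. intros H. apply (diff_cont (fun z => z) _ _ _ (wp_d1_diff tau Htau z H)). Qed.
Lemma wp_d2_cont z : nl z -> cont dC (wp_d2 tau) z.
Proof. intros H. apply (diff_cont (fun z => z) _ _ _ (wp_d2_diff tau Htau z H)). Qed.

Lemma zeta_reg_cont_0 : cont dC (zeta_reg tau) 0.
Proof. apply (diff_cont (fun z => z) _ _ _ (zeta_reg_diff tau Htau 0 (nl0_0 tau))). Qed.
Lemma wp_reg_cont_0 : cont dC (wp_reg tau) 0.
Proof. apply (diff_cont (fun z => z) _ _ _ (wp_reg_diff tau Htau 0 (nl0_0 tau))). Qed.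
Lemma pow_reg_cont_0 k : (3 <= k)%nat -> cont dC (pow_reg tau k) 0.
Proof. intros H. apply (diff_cont (fun z => z) _ _ _ (pow_reg_diff tau Htau k 0 H (nl0_0 tau))). Qed.

Lemma lp_00 : lp 0 0 = 0.
Proof. apply C_ext; rewrite ?lp_Re, ?lp_Im by easy; simpl; ring. Qed.
Lemma lp_opp m n : - lp m n = lp (- m) (- n).
Proof. unfold lattice_point. rewrite !opp_IZR, !RtoC_opp. ring. Qed.

Section Squared.
Variable a : C.
Hypothesis Ha : nl a.

Let v z := zeta (z - a) - zeta z + zeta a.
Let reg z := nl z /\ nl (z - a).
Let Rf z := v z * v z - P (z - a) - P z - P a.
Let f z := if excluded_middle_informative (reg z) then Rf z else 0.

Lemma v_diff z : reg z -> cdiff v z (P z - P (z - a)).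
Proof.
  intros [H1 H2]. eapply diff_eq.
  - apply diff_plus; [apply diff_minus|apply diff_const]; [now apply zeta_diff_minus|now apply wzeta_diff].
  - ring.
Qed.

Lemma raw_defect_diff z : reg z -> cdiff Rf z (2 * v z * (P z - P (z - a)) - wp_d1 tau (z - a) - wp_d1 tau z).
Proof.
  intros H. assert (H' := H). destruct H' as [H1 H2]. eapply diff_eq.
  - apply diff_minus; [|apply diff_const]. apply diff_minus; [|now apply wp_diff].
    apply diff_minus; [|now apply wp_diff_minus]. apply diff_mult; now apply v_diff.
  - ring.
Qed.

Lemma reg_punctured z : exists r, (0 < r)%R /\ forall u, (0 < Cmod (u - z) < r)%R -> reg u.
Proof.
  destruct (nl_punctured z) as [r1 [H1 F1]]. destruct (nl_punctured (z - a)) as [r2 [H2 F2]].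
  exists (Rmin r1 r2). split; [now apply Rmin_pos|]. intros u Hu. split.
  - apply F1. split; [easy|]. eapply Rlt_le_trans; [apply Hu|apply Rmin_l].
  - apply F2. replace (u - a - (z - a)) with (u - z) by ring. split; [easy|].
    eapply Rlt_le_trans; [apply Hu|apply Rmin_r].
Qed.

Lemma reg_open z : reg z -> exists r, (0 < r)%R /\ forall u, (Cmod (u - z) < r)%R -> reg u.
Proof.
  intros H. destruct (reg_punctured z) as [r [Hr F]]. exists r. split; [easy|]. intros u Hu.
  destruct (excluded_middle_informative (u = z)) as [->|n]; [easy|].
  apply F. split; [|easy]. apply Cmod_gt_0. now apply Csub_neq.
Qed.

Lemma defect_diff z : reg z -> cdiff f z (2 * v z * (P z - P (z - a)) - wp_d1 tau (z - a) - wp_d1 tau z).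
Proof.
  intros H. destruct (reg_open z H) as [r [Hr F]].
  apply diff_ext_loc with Rf; [auto| |now apply raw_defect_diff]. exists r. split; [easy|].
  intros u Hu. unfold f. destruct (excluded_middle_informative (reg u)) as [_|n]; [easy|].
  exfalso. apply n, F, Hu.
Qed.

Lemma reg_period om z : is_period tau om -> reg (z + om) <-> reg z.
Proof.
  intros H. unfold reg. rewrite (nl_period tau om z H).
  replace (z + om - a) with (z - a + om) by ring. now rewrite (nl_period tau om _ H).
Qed.

Lemma defect_period om z : is_period tau om -> f (z + om) = f z.
Proof.
  intros H. unfold f.
  destruct (excluded_middle_informative (reg (z + om))) as [r1|n1], (excluded_middle_informative (reg z)) as [r2|n2];
    try (exfalso; now apply (reg_period om z H) in r1 || (apply (reg_period om z H) in r2; easy)); [|easy].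
  unfold Rf, v. replace (z + om - a) with (z - a + om) by ring.
  rewrite !(zeta_period tau Htau om) by easy. rewrite !(wp_period tau Htau om) by (easy || apply r2). ring.
Qed.

(** The reflection exchanges the two poles 0 and [a], so that only 0 needs a local
    analysis. *)
Lemma defect_sym z : f (a - z) = f z.
Proof.
  assert (E : forall z, reg z -> reg (a - z)).
  { intros u [H1 H2]. split.
    - replace (a - u) with (- (u - a)) by ring. now apply nl_opp.
    - replace (a - u - a) with (- u) by ring. now apply nl_opp. }
  unfold f. destruct (excluded_middle_informative (reg (a - z))) as [r1|n1], (excluded_middle_informative (reg z)) as [r2|n2].
  - unfold Rf, v. replace (a - z - a) with (- z) by ring. replace (a - z) with (- (z - a)) by ring.
    rewrite !wzeta_opp, !wp_opp by easy. ring.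
  - exfalso. apply n2. replace z with (a - (a - z)) by ring. now apply E.
  - exfalso. apply n1. now apply E.
  - easy.
Qed.

(** Near 0 one has [zeta (u - a) + zeta a - zeta_reg u = phi u * u] with
    [phi 0 = - wp a].  Thus the terms [1 / u ^ 2] cancel, and the limit is
    [2 wp a - wp a - wp a = 0]. *)
Lemma defect_cont_0 : cont dC f 0.
Proof.
  assert (Ha' : nl (0 - a)). { replace (0 - a) with (- a) by ring. now apply nl_opp. }
  assert (D : cdiff (fun u => zeta (u - a) + zeta a - zeta_reg tau u) 0 (- P a)).
  { eapply diff_eq.
    - apply diff_minus; [|apply zeta_reg_diff; [easy|apply nl0_0]]. apply diff_plus; [now apply zeta_diff_minus|apply diff_const].
    - rewrite wp_reg_0 by easy. replace (0 - a) with (- a) by ring. rewrite wp_opp by easy. ring. }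
  destruct D as [phi [C1 [C2 C3]]].
  assert (E0 : zeta (0 - a) + zeta a - zeta_reg tau 0 = 0).
  { rewrite zeta_reg_0 by easy. replace (0 - a) with (- a) by ring. rewrite wzeta_opp by easy. ring. }
  rewrite E0 in C3.
  set (F := fun u => -2 * phi u + (u * phi u) * (u * phi u) - P (u - a) - wp_reg tau u - P a).
  destruct (reg_punctured 0) as [r [Hr HF]].
  apply cont_ext_loc with F.
  - exists r. split; [easy|]. intros u Hu. unfold dC in Hu. unfold f.
    destruct (excluded_middle_informative (u = 0)) as [->|n].
    + destruct (excluded_middle_informative (reg 0)) as [[q _]|q]; [exfalso; apply (q 0 0)%Z, lp_00|].
      unfold F. rewrite C2, wp_reg_0 by easy. replace (0 - a) with (- a) by ring. rewrite wp_opp by easy. ring.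
    + assert (Hu' : reg u). { apply HF. split; [|easy]. apply Cmod_gt_0. now apply Csub_neq. }
      destruct (excluded_middle_informative (reg u)) as [_|q]; [|easy].
      unfold F, Rf, v. specialize (C3 u). cbv beta in C3.
      assert (X : zeta (u - a) - zeta u + zeta a = phi u * u - / u).
      { rewrite (wzeta_split tau u). replace (phi u * u) with (zeta (u - a) + zeta a - zeta_reg tau u) by (rewrite C3; ring). ring. }
      rewrite X, (wp_split tau u). field. easy.
  - unfold f. destruct (excluded_middle_informative (reg 0)) as [[q _]|q]; [exfalso; apply (q 0 0)%Z, lp_00|].
    unfold F. rewrite C2, wp_reg_0 by easy. replace (0 - a) with (- a) by ring. rewrite wp_opp by easy. ring.
  - unfold F. apply cont_minus; [|apply cont_const]. apply cont_minus; [|apply wp_reg_cont_0].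
    apply cont_minus.
    + apply cont_plus; [apply cont_mult; [apply cont_const|easy]|].
      apply cont_mult; apply cont_mult; auto using cont_id.
    + apply (diff_cont (fun z => z) _ _ _ (wp_diff_minus 0 a Ha')).
Qed.

Lemma defect_removable z : removable_at f z.
Proof.
  split.
  - destruct (excluded_middle_informative (reg z)) as [H|H].
    { apply (diff_cont (fun z => z) _ _ _ (defect_diff z H)). }
    assert (L : forall m n, cont dC f (lp m n)).
    { intros m n. apply cont_ext with (fun u => f (u + lp (- m) (- n))).
      - intros u. apply (period_lp tau f); intros; now apply defect_period.
      - apply cont_shift. rewrite <- lp_opp. replace (lp m n + - lp m n) with (RtoC 0) by ring. apply defect_cont_0. }
    destruct (excluded_middle_informative (nl z)) as [N|N].
    + assert (N2 : ~ nl (z - a)) by (intros q; now apply H).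
      destruct (not_nl tau _ N2) as [m [n E]].
      apply cont_ext with (fun u => f (a - u)); [intros; apply defect_sym|].
      apply (cont_comp dC f (fun u => a - u)).
      * replace (a - z) with (- (z - a)) by ring. rewrite E, lp_opp. apply L.
      * apply cont_minus; [apply cont_const|apply cont_id].
    + destruct (not_nl tau _ N) as [m [n ->]]. apply L.
  - destruct (reg_punctured z) as [r [Hr HF]].
    exists r, (fun z => 2 * v z * (P z - P (z - a)) - wp_d1 tau (z - a) - wp_d1 tau z). split; [easy|].
    intros u Hu. assert (H := HF u Hu). split; [now apply defect_diff|]. destruct H as [H1 H2].
    assert (Pa := diff_cont (fun z => z) _ _ _ (wp_diff_minus u a H2)).
    assert (Wa := diff_cont (fun z => z) _ _ _ (wp_d1_diff_minus u a H2)).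
    assert (Va := diff_cont (fun z => z) _ _ _ (v_diff u (conj H1 H2))).
    apply cont_minus; [|now apply wp_d1_cont]. apply cont_minus; [|exact Wa].
    apply cont_mult; [apply cont_mult; [apply cont_const|exact Va]|]. apply cont_minus; [now apply wp_cont|exact Pa].
Qed.

Lemma squared_addition_aux z : reg z -> v z * v z = P (z - a) + P z + P a.
Proof.
  intros H. assert (E : f z = f 0) by (apply (liouville tau Htau f); [apply defect_period|apply defect_removable]).
  unfold f in E. destruct (excluded_middle_informative (reg 0)) as [[q _]|q]; [exfalso; apply (q 0 0)%Z, lp_00|].
  destruct (excluded_middle_informative (reg z)) as [_|n]; [|easy]. unfold Rf in E.
  replace (v z * v z) with (v z * v z - P (z - a) - P z - P a + (P (z - a) + P z + P a)) by ring. rewrite E. ring.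
Qed.

Lemma squared_addition_diff_aux z : reg z -> 2 * v z * (P z - P (z - a)) = wp_d1 tau (z - a) + wp_d1 tau z.
Proof.
  intros H. destruct (reg_open z H) as [r [Hr F]].
  assert (D : cdiff Rf z 0).
  { apply diff_ext_loc with (fun _ => RtoC 0); [auto| |apply diff_const]. exists r. split; [easy|].
    intros u Hu. unfold Rf. rewrite squared_addition_aux by (now apply F). ring. }
  assert (E := cdiff_unique _ _ _ _ (raw_defect_diff z H) D).
  replace (wp_d1 tau (z - a) + wp_d1 tau z) with (2 * v z * (P z - P (z - a)) - (2 * v z * (P z - P (z - a)) - wp_d1 tau (z - a) - wp_d1 tau z)) by ring.
  rewrite E. ring.
Qed.

Lemma relation_aux z : reg z ->
  2 * (P z - P (z - a)) ^ 3 + wp_d1 tau z ^ 2 - wp_d1 tau (z - a) ^ 2 = (wp_d2 tau z + wp_d2 tau (z - a)) * (P z - P (z - a)).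
Proof.
  intros H. destruct (reg_open z H) as [r [Hr F]]. assert (H' := H). destruct H' as [H1 H2].
  assert (A : cdiff (fun u => 2 * v u * (P u - P (u - a))) z
     (2 * (P z - P (z - a)) * (P z - P (z - a)) + 2 * v z * (wp_d1 tau z - wp_d1 tau (z - a)))).
  { eapply diff_eq.
    - apply diff_mult; [apply diff_scal; now apply v_diff|].
      apply diff_minus; [now apply wp_diff|now apply wp_diff_minus].
    - cbv beta. ring. }
  assert (B : cdiff (fun u => 2 * v u * (P u - P (u - a))) z (wp_d2 tau (z - a) + wp_d2 tau z)).
  { apply diff_ext_loc with (fun u => wp_d1 tau (u - a) + wp_d1 tau u); [auto| |].
    - exists r. split; [easy|]. intros u Hu. rewrite squared_addition_diff_aux by (now apply F). easy.
    - apply diff_plus; [now apply wp_d1_diff_minus|now apply wp_d1_diff]. }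
  assert (E := cdiff_unique _ _ _ _ A B). assert (G := squared_addition_diff_aux z H).
  replace (wp_d2 tau z + wp_d2 tau (z - a)) with (wp_d2 tau (z - a) + wp_d2 tau z) by ring. rewrite <- E.
  replace (wp_d1 tau z ^ 2 - wp_d1 tau (z - a) ^ 2) with ((wp_d1 tau (z - a) + wp_d1 tau z) * (wp_d1 tau z - wp_d1 tau (z - a))) by ring.
  replace (2 * (P z - P (z - a)) ^ 3 + wp_d1 tau z ^ 2 - wp_d1 tau (z - a) ^ 2) with
    (2 * (P z - P (z - a)) ^ 3 + (wp_d1 tau (z - a) + wp_d1 tau z) * (wp_d1 tau z - wp_d1 tau (z - a))) by ring.
  rewrite <- G. ring.
Qed.
End Squared.

(** The identity of Frobenius and Stickelberger.  The difference of the two sides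
    is an elliptic function of [z] whose poles cancel, and it vanishes at 0. *)
Lemma squared_addition z a : nl a -> nl z -> nl (z - a) ->
  (zeta (z - a) - zeta z + zeta a) * (zeta (z - a) - zeta z + zeta a) = P (z - a) + P z + P a.
Proof. intros. now apply squared_addition_aux. Qed.

Lemma addition z y : nl z -> nl y -> nl (z + y) ->
  2 * (zeta (z + y) - zeta z - zeta y) * (P z - P y) = wp_d1 tau z - wp_d1 tau y.
Proof.
  intros Hz Hy Hs. assert (H := squared_addition_diff_aux (z + y) Hs z). cbv zeta beta in H.
  replace (z - (z + y)) with (- y) in H by ring. rewrite wzeta_opp, wp_opp, wp_d1_opp in H by easy.
  assert (E := H (conj Hz (nl_opp tau _ Hy))).
  replace (wp_d1 tau z - wp_d1 tau y) with (- wp_d1 tau y + wp_d1 tau z) by ring. rewrite <- E. ring.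
Qed.

Lemma addition_sym z p : nl z -> nl p -> nl (z + p) -> nl (z - p) ->
  (zeta (z + p) + zeta (z - p) - 2 * zeta z) * (P z - P p) = wp_d1 tau z.
Proof.
  intros Hz Hp H1 H2.
  assert (A := addition z p Hz Hp H1). assert (B := addition z (- p) Hz (nl_opp tau _ Hp) H2).
  rewrite wzeta_opp, wp_opp, wp_d1_opp in B by easy. replace (z + - p) with (z - p) in B by ring.
  assert (E : 2 * ((zeta (z + p) + zeta (z - p) - 2 * zeta z) * (P z - P p)) = 2 * wp_d1 tau z).
  { replace (2 * wp_d1 tau z) with ((wp_d1 tau z - wp_d1 tau p) + (wp_d1 tau z - - wp_d1 tau p)) by ring.
    rewrite <- A, <- B. ring. }
  replace (wp_d1 tau z) with (/ 2 * (2 * wp_d1 tau z)) by (field; auto). rewrite <- E. field.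
Qed.

(** The second derivative of the squared addition theorem, with the remaining
    zeta values eliminated by means of the first.  The points [z] and [t] are
    independent of each other. *)
Lemma relation z t : nl z -> nl t -> nl (z - t) ->
  2 * (P z - P t) ^ 3 + wp_d1 tau z ^ 2 - wp_d1 tau t ^ 2 = (wp_d2 tau z + wp_d2 tau t) * (P z - P t).
Proof.
  intros Hz Ht H. assert (E := relation_aux (z - t) H z). cbv zeta beta in E. replace (z - (z - t)) with t in E by ring.
  apply E. unfold off_lattice in *. split; [easy|]. now replace (z - (z - t)) with t by ring.
Qed.

(** * The differential equation of the Weierstrass function *)

Lemma relation_diff z t : nl z -> nl t -> nl (z - t) ->
  wp_d2 tau t * wp_d1 tau z = 6 * (P z - P t) ^ 2 * wp_d1 tau z + wp_d1 tau z * wp_d2 tau z - wp_d3 tau z * (P z - P t).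
Proof.
  intros Hz Ht H.
  destruct (nl_open tau Htau z Hz) as [r1 [Hr1 F1]]. destruct (nl_open tau Htau _ H) as [r2 [Hr2 F2]].
  assert (A : cdiff (fun u => 2 * ((P u - P t) * ((P u - P t) * (P u - P t))) + wp_d1 tau u * wp_d1 tau u - wp_d1 tau t ^ 2) z
    (6 * (P z - P t) ^ 2 * wp_d1 tau z + 2 * wp_d1 tau z * wp_d2 tau z)).
  { assert (D : cdiff (fun u => P u - P t) z (wp_d1 tau z)).
    { eapply diff_eq; [apply diff_minus; [now apply wp_diff|apply diff_const]|ring]. }
    eapply diff_eq.
    - apply diff_minus; [|apply diff_const]. apply diff_plus; [|apply diff_mult; now apply wp_d1_diff].
      apply diff_scal. apply diff_mult; [exact D|]. apply diff_mult; exact D.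
    - cbv beta. ring. }
  assert (B : cdiff (fun u => 2 * ((P u - P t) * ((P u - P t) * (P u - P t))) + wp_d1 tau u * wp_d1 tau u - wp_d1 tau t ^ 2) z
     (wp_d3 tau z * (P z - P t) + (wp_d2 tau z + wp_d2 tau t) * wp_d1 tau z)).
  { apply diff_ext_loc with (fun u => (wp_d2 tau u + wp_d2 tau t) * (P u - P t)); [auto| |].
    - exists (Rmin r1 r2). split; [now apply Rmin_pos|]. intros u Hu. unfold dI in Hu.
      rewrite <- relation; [ring| |easy|].
      + apply F1. eapply Rlt_le_trans; [exact Hu|apply Rmin_l].
      + apply F2. replace (u - t - (z - t)) with (u - z) by ring. eapply Rlt_le_trans; [exact Hu|apply Rmin_r].
    - eapply diff_eq.
      + apply diff_mult; [apply diff_plus; [now apply wp_d2_diff|apply diff_const]|].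
        apply diff_minus; [now apply wp_diff|apply diff_const].
      + cbv beta. ring. }
  assert (E := cdiff_unique _ _ _ _ A B).
  replace (wp_d2 tau t * wp_d1 tau z) with
    (wp_d3 tau z * (P z - P t) + (wp_d2 tau z + wp_d2 tau t) * wp_d1 tau z - wp_d3 tau z * (P z - P t) - wp_d2 tau z * wp_d1 tau z) by ring.
  rewrite <- E. ring.
Qed.

Lemma Cpow_cont n z : cont dC (fun u => u ^ n) z.
Proof. apply cont_pow, cont_id. Qed.

Lemma nl_near_0 : exists r, (0 < r)%R /\ forall v, (0 < Cmod v < r)%R -> nl v.
Proof.
  destruct (nl_punctured 0) as [r [Hr F]]. exists r. split; [easy|]. intros v Hv. apply F.
  now replace (v - 0) with v by ring.
Qed.

Lemma wp_d1_nonzero : exists z, nl z /\ wp_d1 tau z <> 0.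
Proof.
  destruct (excluded_middle_informative (exists z, nl z /\ wp_d1 tau z <> 0)) as [e|ne]; [easy|exfalso].
  destruct nl_near_0 as [r [Hr F]].
  set (h := fun u => 1 + u ^ 3 * pow_reg tau 3 u).
  assert (E : h 0 = 0).
  { apply (punctured_zero h 0 r Hr).
    - apply cont_plus; [apply cont_const|]. apply cont_mult; [apply Cpow_cont|apply pow_reg_cont_0; lia].
    - intros v Hv. replace (v - 0) with v in Hv by ring. assert (Hn := F v Hv). assert (V0 := nl_neq0 tau Htau v Hn).
      destruct (excluded_middle_informative (wp_d1 tau v = 0)) as [e0|n0]; [|exfalso; eauto].
      unfold h. unfold wp_d1 in e0. replace (1 + v ^ 3 * pow_reg tau 3 v) with ((-1/2) * v ^ 3 * (RtoC (-2) * (/ v ^ 3 + pow_reg tau 3 v))).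
      + rewrite e0. ring.
      + field. auto. }
  unfold h in E. replace (1 + 0 ^ 3 * pow_reg tau 3 0) with (RtoC 1) in E by ring.
  apply RtoC_inj in E. lra.
Qed.

(** For a fixed [z], [relation_diff] makes [wp'' t] a quadratic polynomial in
    [wp t].  Multiplied by [t ^ 2], the equation shows for [t -> 0] that the linear
    coefficient is 0, because [wp t - 1 / t ^ 2] tends to 0. *)
Lemma wp_ode : exists b : C, forall t, nl t -> wp_d2 tau t = 6 * P t ^ 2 + b.
Proof.
  destruct wp_d1_nonzero as [z [Hz Hn]].
  set (al := - 12 * P z + wp_d3 tau z / wp_d1 tau z). set (b := 6 * P z ^ 2 + wp_d2 tau z - wp_d3 tau z * P z / wp_d1 tau z).
  assert (A : forall t, nl t -> nl (z - t) -> wp_d2 tau t = 6 * P t ^ 2 + al * P t + b).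
  { intros t Ht H. assert (E := relation_diff z t Hz Ht H).
    replace (wp_d2 tau t) with (wp_d2 tau t * wp_d1 tau z / wp_d1 tau z) by (field; easy). rewrite E. unfold al, b. field. easy. }
  assert (B : forall t, nl t -> wp_d2 tau t = 6 * P t ^ 2 + al * P t + b).
  { intros t Ht. destruct (nl_punctured (z - t)) as [r [Hr F]]. destruct (nl_open tau Htau t Ht) as [r2 [Hr2 F2]].
    set (h := fun u => wp_d2 tau u - (6 * P u ^ 2 + al * P u + b)).
    assert (E : h t = 0).
    { apply (punctured_zero h t (Rmin r r2)); [now apply Rmin_pos| |].
      - apply cont_minus; [now apply wp_d2_cont|]. assert (PC := wp_cont t Ht).
        apply cont_plus; [|apply cont_const]. apply cont_plus; (apply cont_mult; [apply cont_const|]); [now apply cont_pow|easy].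
      - intros u Hu. unfold h. rewrite A; [ring| |].
        + apply F2. eapply Rlt_le_trans; [apply Hu|apply Rmin_r].
        + apply F. replace (z - u - (z - t)) with (- (u - t)) by ring. rewrite Cmod_opp. split; [easy|].
          eapply Rlt_le_trans; [apply Hu|apply Rmin_l]. }
    unfold h in E. replace (wp_d2 tau t) with (wp_d2 tau t - (6 * P t ^ 2 + al * P t + b) + (6 * P t ^ 2 + al * P t + b)) by ring.
    rewrite E. ring. }
  assert (Al : al = 0).
  { destruct nl_near_0 as [r [Hr F]].
    set (h := fun u => 6 * (u ^ 2 * pow_reg tau 4 u) - 12 * wp_reg tau u - 6 * (u ^ 2 * (wp_reg tau u * wp_reg tau u)) - al - al * (u ^ 2 * wp_reg tau u) - b * u ^ 2).
    assert (E : h 0 = 0).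
    { apply (punctured_zero h 0 r Hr).
      - assert (C2 := wp_reg_cont_0). assert (C4 := pow_reg_cont_0 4 ltac:(lia)). assert (CP := Cpow_cont 2 0).
        repeat first [assumption | apply cont_id | apply cont_const | apply cont_minus | apply cont_mult].
      - intros u Hu. replace (u - 0) with u in Hu by ring. assert (Hnl := F u Hu). assert (U0 := nl_neq0 tau Htau u Hnl).
        assert (E := B u Hnl). unfold h. unfold wp_d2 in E. rewrite wp_split in E.
        replace (6 * (u ^ 2 * pow_reg tau 4 u) - 12 * wp_reg tau u - 6 * (u ^ 2 * (wp_reg tau u * wp_reg tau u)) - al - al * (u ^ 2 * wp_reg tau u) - b * u ^ 2)
          with (u ^ 2 * (6 * (/ u ^ 4 + pow_reg tau 4 u) - (6 * (/ u ^ 2 + wp_reg tau u) ^ 2 + al * (/ u ^ 2 + wp_reg tau u) + b))) by (field; auto).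
        rewrite E. ring. }
    replace al with (- h 0) by (unfold h; rewrite wp_reg_0 by easy; ring). rewrite E. ring. }
  exists b. intros t Ht. rewrite B by easy. rewrite Al. ring.
Qed.

(** * Injectivity and surjectivity of the Weierstrass function *)

Lemma sum_squares_derive (f1 f2 f3 f4 : R -> R) (s l1 l2 l3 l4 : R) :
  is_derive f1 s l1 -> is_derive f2 s l2 -> is_derive f3 s l3 -> is_derive f4 s l4 ->
  is_derive (fun s => f1 s ^ 2 + f2 s ^ 2 + (f3 s ^ 2 + f4 s ^ 2))%R s
    (2 * f1 s * l1 + 2 * f2 s * l2 + (2 * f3 s * l3 + 2 * f4 s * l4))%R.
Proof.
  intros A1 A2 A3 A4. auto_derive.
  - repeat split; eexists; eassumption.
  - apply is_derive_unique in A1, A2, A3, A4. rewrite <- A1, <- A2, <- A3, <- A4.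
    change (fun x : R => f1 x) with f1. change (fun x : R => f2 x) with f2.
    change (fun x : R => f3 x) with f3. change (fun x : R => f4 x) with f4. ring.
Qed.

(** The energy [|d| ^ 2 + |e| ^ 2] satisfies [E' <= (1 + M) E] where [M] bounds
    [k], and it starts at 0. *)
Lemma gronwall_zero (d e k : R -> C) (T : R) : (0 <= T)%R ->
  (forall s, (0 <= s <= T)%R -> rdiff d s (e s)) -> (forall s, (0 <= s <= T)%R -> rdiff e s (k s * d s)) ->
  (forall s, (0 <= s <= T)%R -> cont dR k s) -> d 0%R = 0 -> e 0%R = 0 -> d T = 0.
Proof.
  intros HT Hd He Hk d0 e0.
  assert (B : exists M, (0 <= M)%R /\ forall s, (0 <= s <= T)%R -> (Cmod (k s) <= M)%R).
  { destruct (continuity_ab_maj (fun s => Cmod (k s)) 0 T HT) as [s0 [Hs0 _]].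
    - intros s Hs. intros eps Hep. destruct (Hk s Hs eps Hep) as [del [Hdel F]]. exists del. split; [easy|].
      intros t [_ Ht]. simpl in *. unfold R_dist in *.
      assert (T1 := Cmod_triangle_sub (k t) (k s)). assert (T2 := Cmod_triangle_sub (k s) (k t)).
      rewrite (Cmod_sub_sym (k s)) in T2. specialize (F t Ht). apply Rabs_def1; lra.
    - exists (Cmod (k s0)). split; [apply Cmod_ge_0|auto]. }
  destruct B as [M [HM HB]].
  set (E := fun s => (Re (d s) ^ 2 + Im (d s) ^ 2 + (Re (e s) ^ 2 + Im (e s) ^ 2))%R).
  set (E' := fun s => (2 * Re (d s) * Re (e s) + 2 * Im (d s) * Im (e s) + (2 * Re (e s) * Re (k s * d s) + 2 * Im (e s) * Im (k s * d s)))%R).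
  assert (DE : forall s, (0 <= s <= T)%R -> is_derive E s (E' s)).
  { intros s Hs. assert (A1 := rdiff_Re _ _ _ (Hd s Hs)). assert (A2 := rdiff_Im _ _ _ (Hd s Hs)).
    assert (A3 := rdiff_Re _ _ _ (He s Hs)). assert (A4 := rdiff_Im _ _ _ (He s Hs)).
    apply (sum_squares_derive (fun s => Re (d s)) (fun s => Im (d s)) (fun s => Re (e s)) (fun s => Im (e s))); assumption. }
  (* the weighted energy is nonincreasing *)
  set (h := fun s => (E s * exp (- (1 + M) * s))%R).
  assert (Dh : forall s, (0 <= s <= T)%R -> is_derive h s (E' s * exp (- (1 + M) * s) + E s * (- (1 + M) * exp (- (1 + M) * s)))%R).
  { intros s Hs. apply (is_derive_mult E (fun s => exp (- (1 + M) * s)) s); [now apply DE| |intros; apply Rmult_comm].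
    auto_derive; [easy|ring]. }
  assert (Hle : (h T <= h 0)%R).
  { destruct (MVT_gen h 0 T (fun s => E' s * exp (- (1 + M) * s) + E s * (- (1 + M) * exp (- (1 + M) * s)))%R) as [s [Hs Q]].
    - intros s Hs. rewrite Rmin_left, Rmax_right in Hs by easy. apply Dh. lra.
    - intros s Hs. rewrite Rmin_left, Rmax_right in Hs by easy. apply continuity_pt_filterlim.
      apply (@ex_derive_continuous R_AbsRing R_NormedModule). eexists. apply Dh. lra.
    - rewrite Rmin_left, Rmax_right in Hs by easy.
      assert (N : (E' s * exp (- (1 + M) * s) + E s * (- (1 + M) * exp (- (1 + M) * s)) <= 0)%R).
      { replace (_ + _)%R with ((E' s - (1 + M) * E s) * exp (- (1 + M) * s))%R by ring.
        assert (X := exp_pos (- (1 + M) * s)). apply Rmult_le_reg_r with (/ exp (- (1 + M) * s))%R; [now apply Rinv_0_lt_compat|].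
        rewrite Rmult_assoc, Rinv_r, Rmult_0_l, Rmult_1_r by lra.
        unfold E, E'.
        assert (C1 : (Re (d s) * Re (e s) + Im (d s) * Im (e s) <= Cmod (d s) * Cmod (e s))%R).
        { rewrite <- (Cmod_conj (d s)), <- Cmod_mult. eapply Rle_trans; [|apply re_le_Cmod].
          eapply Rle_trans; [|apply Rle_abs]. rewrite Re_mult, re_conj, im_conj. lra. }
        assert (C2 : (Re (e s) * Re (k s * d s) + Im (e s) * Im (k s * d s) <= M * (Cmod (d s) * Cmod (e s)))%R).
        { apply Rle_trans with (Cmod (k s) * (Cmod (d s) * Cmod (e s)))%R.
          - rewrite <- (Cmod_conj (e s)), <- !Cmod_mult.
            replace (k s * (d s * Cconj (e s))) with (Cconj (e s) * (k s * d s)) by ring.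
            eapply Rle_trans; [|apply re_le_Cmod]. eapply Rle_trans; [|apply Rle_abs].
            rewrite (Re_mult (Cconj (e s))), re_conj, im_conj. lra.
          - apply Rmult_le_compat_r; [apply Rmult_le_pos; apply Cmod_ge_0|]. now apply HB. }
        rewrite <- !Cmod2_alt. assert (Pd := Cmod_ge_0 (d s)). assert (Pe := Cmod_ge_0 (e s)).
        set (x := Cmod (d s)) in *. set (y := Cmod (e s)) in *.
        assert (AG : (2 * (x * y) <= x ^ 2 + y ^ 2)%R) by (generalize (pow2_ge_0 (x - y)); lra).
        assert (AG2 : (M * (2 * (x * y)) <= M * (x ^ 2 + y ^ 2))%R) by (apply Rmult_le_compat_l; lra).
        lra. }
      nra. }
  assert (h0 : h 0%R = 0%R). { unfold h, E. rewrite d0, e0. simpl. ring. }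
  rewrite h0 in Hle. unfold h in Hle. assert (X := exp_pos (- (1 + M) * T)).
  assert (E T <= 0)%R by nra. unfold E in H.
  apply C_ext; simpl; nra.
Qed.

Lemma nl_centred (x y : R) : (-1/2 <= x <= 1/2)%R -> (-1/2 <= y <= 1/2)%R -> (x <> 0 \/ y <> 0)%R -> nl (x + y * tau).
Proof.
  intros Hx Hy H m n E. assert (E1 := f_equal Re E). assert (E2 := f_equal Im E).
  rewrite lp_Re in E1 by easy. rewrite lp_Im in E2. autorewrite with cre in E1, E2. destruct Htau as [T1 T2].
  rewrite T1 in *.
  assert (X : IZR m = x) by lra. assert (Y : IZR n = y) by nra.
  assert (m0 : m = 0%Z). { assert (-1 < m < 1)%Z; [|lia]. split; apply lt_IZR; lra. }
  assert (n0 : n = 0%Z). { assert (-1 < n < 1)%Z; [|lia]. split; apply lt_IZR; lra. }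
  subst. simpl in *. lra.
Qed.

Lemma centred_closest (x y : R) m n : (-1/2 <= x <= 1/2)%R -> (-1/2 <= y <= 1/2)%R ->
  (Cmod (x + y * tau) <= Cmod (x + y * tau - lp m n))%R.
Proof.
  intros Hx Hy. unfold Cmod. apply sqrt_le_1_alt.
  assert (K : forall (x : R) (m : Z), (-1/2 <= x <= 1/2)%R -> (x ^ 2 <= (x - IZR m) ^ 2)%R).
  { clear. intros x m Hx. destruct (Z.eq_dec m 0) as [->|n]; [simpl; lra|].
    assert (m <= -1 \/ 1 <= m)%Z as [h|h] by lia; apply IZR_le in h; nra. }
  change (Re (x + y * tau) ^ 2 + Im (x + y * tau) ^ 2 <= Re (x + y * tau - lp m n) ^ 2 + Im (x + y * tau - lp m n) ^ 2)%R.
  rewrite Re_minus, Im_minus, lp_Re, lp_Im by easy. autorewrite with cre. destruct Htau as [-> T2].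
  assert (A := K x m Hx). assert (B := K y n Hy). nra.
Qed.

(** Both points are moved by [- z * s].  Uniqueness for [wp'' = 6 wp ^ 2 + b] keeps
    the two values equal as long as no pole is met.  As [z] is the point closer
    to the lattice, the first pole is met at [s = 1], where the first point arrives
    at 0; the second arrives at [p - z], which would have to be a pole too. *)
Lemma wp_unique_centred (x y x' y' : R) : let z := x + y * tau in let p := x' + y' * tau in
  (-1/2 <= x <= 1/2)%R -> (-1/2 <= y <= 1/2)%R -> (-1/2 <= x' <= 1/2)%R -> (-1/2 <= y' <= 1/2)%R ->
  nl z -> nl p -> (Cmod z <= Cmod p)%R -> P z = P p -> wp_d1 tau z = wp_d1 tau p -> ~ nl (p - z).
Proof.
  intros z p Hx Hy Hx' Hy' Hz Hp Hle E0 E1 Hpz.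
  destruct wp_ode as [b Hode].
  assert (Z0 := nl_neq0 tau Htau z Hz). assert (Zp : (0 < Cmod z)%R) by now apply Cmod_gt_0.
  assert (N1 : forall s, (0 <= s < 1)%R -> nl (z + (- z) * s)).
  { intros s Hs. replace (z + - z * s) with (RtoC ((1 - s) * x) + RtoC ((1 - s) * y) * tau)
      by (unfold z; rewrite !RtoC_mult, RtoC_minus; ring).
    apply nl_centred; [nra|nra|].
    assert (x <> 0 \/ y <> 0)%R as [h|h].
    { destruct (Req_dec x 0) as [->|]; [|now left]. right. intros ->. apply Z0. unfold z. ring. }
    - left. apply Rmult_integral_contrapositive. split; lra.
    - right. apply Rmult_integral_contrapositive. split; lra. }
  assert (N2 : forall s, (0 <= s < 1)%R -> nl (p + (- z) * s)).
  { intros s Hs m n E. assert (C := centred_closest x' y' m n Hx' Hy'). fold p in C.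
    replace (p - lp m n) with (z * s) in C by (rewrite E; ring).
    rewrite Cmod_mult, Cmod_R, Rabs_pos_eq in C by lra. nra. }
  assert (LD : forall u s, rdiff (fun s : R => u + - z * s) s (- z)).
  { intros. apply rdiff_line. }
  assert (D0 : forall T, (0 <= T < 1)%R -> P (z + - z * T) = P (p + - z * T)).
  { intros T HT.
    set (h := fun s : R => P (z + - z * s) - P (p + - z * s)).
    assert (Q : h T = 0).
    { apply (gronwall_zero h (fun s => (wp_d1 tau (z + - z * s) - wp_d1 tau (p + - z * s)) * - z)
        (fun s => z * z * (6 * (P (z + - z * s) + P (p + - z * s)))) T); [easy| | | | |].
      - intros s Hs. eapply diff_eq.
        + apply diff_minus.
          * apply (diff_comp RtoC P (fun s : R => z + - z * s)); [apply wp_diff; [easy|apply N1; lra]|apply LD].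
          * apply (diff_comp RtoC P (fun s : R => p + - z * s)); [apply wp_diff; [easy|apply N2; lra]|apply LD].
        + ring.
      - intros s Hs. eapply diff_eq.
        + apply diff_mult; [|apply diff_const]. apply diff_minus.
          * apply (diff_comp RtoC (wp_d1 tau) (fun s : R => z + - z * s)); [apply wp_d1_diff; [easy|apply N1; lra]|apply LD].
          * apply (diff_comp RtoC (wp_d1 tau) (fun s : R => p + - z * s)); [apply wp_d1_diff; [easy|apply N2; lra]|apply LD].
        + unfold h. cbv beta. rewrite (Hode (z + - z * s)), (Hode (p + - z * s)) by (apply N1 || apply N2; lra). ring.
      - intros s Hs. apply cont_dI_dR. apply cont_mult; [apply cont_const|]. apply cont_mult; [apply cont_const|].
        apply cont_plus.
        + apply (cont_comp _ P (fun s : R => z + - z * s)); [apply wp_cont, N1; lra|eapply diff_cont, LD].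
        + apply (cont_comp _ P (fun s : R => p + - z * s)); [apply wp_cont, N2; lra|eapply diff_cont, LD].
      - unfold h. replace (z + - z * 0) with z by ring. replace (p + - z * 0) with p by ring. rewrite E0. ring.
      - replace (z + - z * 0) with z by ring. replace (p + - z * 0) with p by ring. rewrite E1. ring. }
    unfold h in Q. replace (P (z + - z * T)) with (P (z + - z * T) - P (p + - z * T) + P (p + - z * T)) by ring.
    rewrite Q. ring. }
  (* g is 1 at s = 1, and (z - z s) ^ 2 times the difference of the two values before *)
  set (g := fun s : R => 1 + (z + - z * s) ^ 2 * wp_reg tau (z + - z * s) - (z + - z * s) ^ 2 * P (p + - z * s)).
  assert (Cg : cont dR g 1).
  { apply cont_dI_dR. unfold g.
    assert (CL : forall u, cont (dI RtoC) (fun s : R => u + - z * s) 1%R) by (intros; eapply diff_cont, LD).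
    apply cont_minus; [apply cont_plus; [apply cont_const|]|].
    - apply cont_mult; [apply cont_pow, CL|].
      apply (cont_comp _ (wp_reg tau) (fun s : R => z + - z * s)); [|apply CL].
      replace (z + - z * 1) with (RtoC 0) by ring. apply wp_reg_cont_0.
    - apply cont_mult; [apply cont_pow, CL|].
      apply (cont_comp _ P (fun s : R => p + - z * s)); [|apply CL].
      replace (p + - z * 1) with (p - z) by ring. now apply wp_cont. }
  assert (g1 : g 1%R = 1). { unfold g. replace (z + - z * 1) with (RtoC 0) by ring. ring. }
  destruct (Cg 1%R Rlt_0_1) as [del [Hdel F]]. set (s := Rmax 0 (1 - del / 2)).
  assert (Hs : (0 <= s < 1)%R) by (split; [apply Rmax_l|apply Rmax_lub_lt; lra]).
  assert (S2 : (1 - del / 2 <= s)%R) by apply Rmax_r.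
  specialize (F s). unfold dR in F. rewrite Rabs_left in F by lra. specialize (F ltac:(lra)).
  assert (gs : g s = 0).
  { unfold g. rewrite <- D0 by easy. rewrite wp_split. assert (NN := nl_neq0 tau Htau _ (N1 s Hs)). field. easy. }
  rewrite gs, g1 in F. replace (0 - 1) with (- (1)) in F by ring. rewrite Cmod_opp, Cmod_1 in F. lra.
Qed.

Lemma wp_unique z p : nl z -> nl p -> P z = P p -> wp_d1 tau z = wp_d1 tau p -> ~ nl (z - p).
Proof.
  intros Hz Hp E0 E1 H.
  destruct (reduce tau Htau z) as [m [n [x [y [Ez [Hx Hy]]]]]]. destruct (reduce tau Htau p) as [m' [n' [x' [y' [Ep [Hx' Hy']]]]]].
  rewrite Ez in Hz, E0, E1, H. rewrite Ep in Hp, E0, E1, H.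
  apply (nl_lp tau Htau) in Hz, Hp.
  rewrite !wp_lp in E0 by easy. rewrite !wp_d1_lp in E1 by easy.
  replace (x + y * tau + lp m n - (x' + y' * tau + lp m' n')) with (x + y * tau - (x' + y' * tau) + lp (m - m') (n - n')) in H
    by (unfold lattice_point; rewrite !minus_IZR, !RtoC_minus; ring).
  apply (nl_lp tau Htau) in H.
  destruct (Rle_lt_dec (Cmod (x + y * tau)) (Cmod (x' + y' * tau))) as [h|h].
  - refine (wp_unique_centred x y x' y' Hx Hy Hx' Hy' Hz Hp h E0 E1 _).
    replace (x' + y' * tau - (x + y * tau)) with (- (x + y * tau - (x' + y' * tau))) by ring. now apply nl_opp.
  - exact (wp_unique_centred x' y' x y Hx' Hy' Hx Hy Hp Hz (Rlt_le _ _ h) (eq_sym E0) (eq_sym E1) H).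
Qed.

(** With [wp z = wp p], [relation] gives [wp' z = wp' p] or [wp' z = - wp' p];
    these are the cases of [p] and of [- p]. *)
Lemma wp_injective z p : nl z -> nl p -> P z = P p -> ~ nl (z - p) \/ ~ nl (z + p).
Proof.
  intros Hz Hp E. destruct (excluded_middle_informative (nl (z - p))) as [H|H]; [|now left].
  assert (R := relation z p Hz Hp H). rewrite E in R.
  assert (Q : (wp_d1 tau z - wp_d1 tau p) * (wp_d1 tau z + wp_d1 tau p) = 0).
  { replace ((wp_d1 tau z - wp_d1 tau p) * (wp_d1 tau z + wp_d1 tau p)) with (2 * (P p - P p) ^ 3 + wp_d1 tau z ^ 2 - wp_d1 tau p ^ 2) by ring.
    rewrite R. ring. }
  assert (X : wp_d1 tau z - wp_d1 tau p = 0 \/ wp_d1 tau z + wp_d1 tau p = 0).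
  { destruct (excluded_middle_informative (wp_d1 tau z - wp_d1 tau p = 0)) as [e|n]; [now left|right].
    destruct (excluded_middle_informative (wp_d1 tau z + wp_d1 tau p = 0)) as [e|n2]; [easy|].
    exfalso. now apply (Cmult_neq_0 _ _ n n2). }
  destruct X as [X|X].
  - left. apply wp_unique; auto. replace (wp_d1 tau z) with (wp_d1 tau z - wp_d1 tau p + wp_d1 tau p) by ring. rewrite X. ring.
  - right. replace (z + p) with (z - - p) by ring. apply wp_unique; auto using nl_opp.
    + now rewrite wp_opp.
    + rewrite wp_d1_opp by easy. replace (wp_d1 tau z) with (wp_d1 tau z + wp_d1 tau p - wp_d1 tau p) by ring. rewrite X. ring.
Qed.

Lemma nl_half : nl (1 / 2).
Proof.
  replace (1 / 2) with (RtoC (1/2) + RtoC 0 * tau) by (rewrite RtoC_div; [field; auto|lra]).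
  apply nl_centred; lra.
Qed.

(** Otherwise [1 / (wp - lam)] would be an elliptic function without poles, hence
    constant, although it has zeros exactly at the lattice points. *)
Lemma wp_surjective lam : exists a, nl a /\ P a = lam.
Proof.
  destruct (excluded_middle_informative (exists a, nl a /\ P a = lam)) as [e|ne]; [easy|exfalso].
  assert (N : forall z, nl z -> P z - lam <> 0).
  { intros z Hz E. apply ne. exists z. split; [easy|]. replace (P z) with (P z - lam + lam) by ring. rewrite E. ring. }
  set (f := fun z => if excluded_middle_informative (nl z) then / (P z - lam) else 0).
  assert (fp : forall om z, is_period tau om -> f (z + om) = f z).
  { intros om z H. unfold f.
    destruct (excluded_middle_informative (nl (z + om))) as [r1|n1], (excluded_middle_informative (nl z)) as [r2|n2].
    - now rewrite wp_period.
    - exfalso. now apply (nl_period tau om z H) in r1.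
    - exfalso. now apply (nl_period tau om z H) in r2.
    - easy. }
  assert (fl : forall z, nl z -> exists r, (0 < r)%R /\ forall u, (dI (fun z => z) z u < r)%R -> / (P u - lam) = f u).
  { intros z Hz. destruct (nl_open tau Htau z Hz) as [r [Hr F]]. exists r. split; [easy|]. intros u Hu.
    unfold f. destruct (excluded_middle_informative (nl u)) as [_|n]; [easy|]. exfalso. now apply n, F. }
  assert (fd : forall z, nl z -> cdiff f z (- wp_d1 tau z / ((P z - lam) * (P z - lam)))).
  { intros z Hz. apply diff_ext_loc with (fun u => / (P u - lam)); [auto|now apply fl|].
    apply (diff_inv _ (fun u => P u - lam)); [now apply N|].
    eapply diff_eq; [apply diff_minus; [now apply wp_diff|apply diff_const]|ring]. }
  assert (f0 : f 0 = 0).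
  { unfold f. destruct (excluded_middle_informative (nl 0)) as [q|]; [|easy]. exfalso. apply (q 0 0)%Z, lp_00. }
  assert (fc0 : cont dC f 0).
  { destruct nl_near_0 as [r [Hr F]].
    apply cont_ext_loc with (fun u => u ^ 2 / (1 + u ^ 2 * (wp_reg tau u - lam))).
    - exists r. split; [easy|]. intros u Hu. unfold dC in Hu. replace (u - 0) with u in Hu by ring.
      destruct (excluded_middle_informative (u = 0)) as [->|n].
      + rewrite f0. unfold Cdiv. ring.
      + assert (Hn : nl u). { apply F. split; [now apply Cmod_gt_0|easy]. }
        unfold f. destruct (excluded_middle_informative (nl u)) as [_|n2]; [|easy].
        assert (Nu := N u Hn). rewrite wp_split in *.
        assert (X : 1 + u ^ 2 * (wp_reg tau u - lam) <> 0).
        { intros X. apply Nu. replace (/ u ^ 2 + wp_reg tau u - lam) with ((1 + u ^ 2 * (wp_reg tau u - lam)) / u ^ 2) by (field; auto).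
          rewrite X. unfold Cdiv. ring. }
        field. repeat split; auto. intros Y. apply X. rewrite <- Y. ring.
    - rewrite f0. unfold Cdiv. ring.
    - apply cont_div.
      + replace (1 + 0 ^ 2 * (wp_reg tau 0 - lam)) with (RtoC 1) by ring. intros X. apply RtoC_inj in X. lra.
      + apply Cpow_cont.
      + apply cont_plus; [apply cont_const|]. apply cont_mult; [apply Cpow_cont|].
        apply cont_minus; [apply wp_reg_cont_0|apply cont_const]. }
  assert (fn : forall z, removable_at f z).
  { intros z. split.
    - destruct (excluded_middle_informative (nl z)) as [Hz|Hz]; [apply (diff_cont (fun z => z) _ _ _ (fd z Hz))|].
      destruct (not_nl tau _ Hz) as [m [n ->]].
      apply cont_ext with (fun u => f (u + lp (- m) (- n))).
      + intros u. now apply (period_lp tau f).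
      + apply cont_shift. rewrite <- lp_opp. replace (lp m n + - lp m n) with (RtoC 0) by ring. apply fc0.
    - destruct (nl_punctured z) as [r [Hr HF]].
      exists r, (fun z => - wp_d1 tau z / ((P z - lam) * (P z - lam))). split; [easy|].
      intros u Hu. assert (H := HF u Hu). split; [now apply fd|].
      assert (CP := wp_cont u H). assert (X : cont dC (fun v => P v - lam) u) by (apply cont_minus; [easy|apply cont_const]).
      apply cont_div; [apply Cmult_neq_0; now apply N|apply cont_opp; now apply wp_d1_cont|now apply cont_mult]. }
  assert (E := liouville tau Htau f fp fn (1/2) 0). rewrite f0 in E. unfold f in E.
  assert (H := nl_half). destruct (excluded_middle_informative (nl (1/2))) as [_|n]; [|easy].
  assert (Q := N _ H). assert (Z : (P (1/2) - lam) * / (P (1/2) - lam) = 1) by (field; easy).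
  rewrite E in Z. apply (f_equal Re) in Z. simpl in Z. lra.
Qed.
End Add.

(** * Positivity of the growth exponent in a half period strip *)

Definition isZ (x : R) : Prop := exists m : Z, x = IZR m.

Lemma isZ_opp x : isZ x -> isZ (- x).
Proof. intros [m ->]. exists (- m)%Z. now rewrite opp_IZR. Qed.
Lemma isZ_plus x y : isZ x -> isZ y -> isZ (x + y).
Proof. intros [m ->] [n ->]. exists (m + n)%Z. now rewrite plus_IZR. Qed.
Lemma isZ_IZR m : isZ (IZR m). Proof. now exists m. Qed.
Lemma isZ_small x : isZ x -> (-1 < x < 1)%R -> x = 0%R.
Proof.
  intros [m ->] [H1 H2]. assert (m = 0)%Z; [|subst; easy].
  assert (-1 < m < 1)%Z; [|lia]. split; apply lt_IZR; lra.
Qed.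

Section Bands.
Variable tau : C.
Hypothesis Htau : Re tau = 0%R /\ (0 < Im tau)%R.
Notation lp := (lattice_point tau).
Notation zeta := (wzeta tau).
Notation P := (wp tau).
Notation nl := (off_lattice tau).

Lemma not_nl_iff z : ~ nl z <-> exists m n, z = lp m n.
Proof.
  split; [apply not_nl|]. intros [m [n ->]] H. now apply (H m n).
Qed.

Lemma coords_unique (x y x' y' : R) : x + y * tau = x' + y' * tau -> x = x' /\ y = y'.
Proof.
  intros E. assert (E1 := f_equal Re E). assert (E2 := f_equal Im E). autorewrite with cre in E1, E2.
  destruct Htau as [T1 T2]. rewrite T1 in *. split; [lra|]. nra.
Qed.

Lemma not_nl_coord (x y : R) : ~ nl (x + y * tau) <-> isZ x /\ isZ y.
Proof.
  rewrite not_nl_iff. split.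
  - intros [m [n E]]. apply coords_unique in E. destruct E as [-> ->]. split; apply isZ_IZR.
  - intros [[m ->] [n ->]]. now exists m, n.
Qed.

Lemma nl_coord (x y : R) : (~ isZ x \/ ~ isZ y) -> nl (x + y * tau).
Proof.
  intros H. destruct (excluded_middle_informative (nl (x + y * tau))) as [h|h]; [easy|].
  apply not_nl_coord in h. tauto.
Qed.

Section Direction.
Variables om om' : C.
Hypothesis Hom : is_period tau om.
Hypothesis Hom' : is_period tau om'.
Hypothesis Hnot0 : om <> 0.
Hypothesis Horth : Re (om * Cconj om') = 0%R.
Hypothesis Hnl : forall x y : R, ~ nl (x * om + y * om') <-> isZ x /\ isZ y.
Hypothesis Hcoord : forall z, exists x y : R, z = x * om + y * om'.
Hypothesis Heta : Re (om * eta tau om' - eta tau om * om') = 0%R.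

(** For [wp a = lam], [exp (floquet_exponent a)] is the factor by which the solution
    [sigma (z - a) / sigma z * exp (zeta a z)] of [w'' = (2 wp + lam) w] grows over
    the period [om]. *)
Definition floquet_exponent z : C := om * zeta z - eta tau om * z.
Notation u := (fun z => Re (floquet_exponent z)).

Hypothesis Hrefl : forall x y : R, Re (floquet_exponent (- x * om + y * om')) = (- Re (floquet_exponent (x * om + y * om')))%R.

Lemma exponent_om z : Re (floquet_exponent (z + om)) = Re (floquet_exponent z).
Proof.
  unfold floquet_exponent. rewrite zeta_period by easy. f_equal. ring.
Qed.

Lemma exponent_om' z : Re (floquet_exponent (z + om')) = Re (floquet_exponent z).
Proof.
  unfold floquet_exponent. rewrite zeta_period by easy.
  replace (om * (zeta z + eta tau om') - eta tau om * (z + om')) with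
    ((om * zeta z - eta tau om * z) + (om * eta tau om' - eta tau om * om')) by ring.
  rewrite Re_plus, Heta. ring.
Qed.

Lemma exponent_split z : z <> 0 -> floquet_exponent z = om / z + (om * zeta_reg tau z - eta tau om * z).
Proof. intros H. unfold floquet_exponent. rewrite wzeta_split. field. easy. Qed.

Lemma Cmod2_coords (x y : R) : (Cmod (x * om + y * om') ^ 2 = x ^ 2 * Cmod om ^ 2 + y ^ 2 * Cmod om' ^ 2)%R.
Proof.
  rewrite !Cmod2_alt. autorewrite with cre. rewrite Re_mult, re_conj, im_conj in Horth.
  replace (_ ^ 2 + _ ^ 2)%R with (x ^ 2 * (Re om ^ 2 + Im om ^ 2) + y ^ 2 * (Re om' ^ 2 + Im om' ^ 2)
    + 2 * x * y * (Re om * Re om' - Im om * - Im om'))%R by ring.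
  rewrite Horth. ring.
Qed.

(** The conjugate of [z] enters through [om / z], and [om'] is orthogonal to [om]:
    only the coordinate [x] contributes to the real part. *)
Lemma principal_nonneg (x y : R) : (0 <= x)%R -> x * om + y * om' <> 0 -> (0 <= Re (om / (x * om + y * om')))%R.
Proof.
  intros Hx Hz. set (z := x * om + y * om') in *.
  assert (Cz : Cconj z <> 0). { intros E. apply Hz. rewrite <- (Cconj_conj z), E. apply C_ext; simpl; ring. }
  assert (Pz : (0 < Cmod z ^ 2)%R) by (apply pow_lt; now apply Cmod_gt_0).
  replace (om / z) with (RtoC (/ (Cmod z ^ 2)) * (om * Cconj z)).
  2:{ rewrite RtoC_inv by lra. rewrite Cmod2_conj. field. auto. }
  replace (om * Cconj z) with (RtoC (x * Cmod om ^ 2) + RtoC y * (om * Cconj om')).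
  2:{ unfold z. rewrite Cplus_conj, !Cmult_conj, RtoC_mult, Cmod2_conj.
      replace (Cconj x) with (RtoC x) by (apply C_ext; simpl; ring).
      replace (Cconj y) with (RtoC y) by (apply C_ext; simpl; ring). ring. }
  rewrite Re_mult, Re_plus, (Re_mult (RtoC y)), Horth, !Re_RtoC, !Im_RtoC.
  assert (Q := Rinv_0_lt_compat _ Pz). assert (N := pow2_ge_0 (Cmod om)).
  assert (0 <= x * Cmod om ^ 2)%R by nra. nra.
Qed.

Lemma rest_small eps : (0 < eps)%R -> exists r, (0 < r)%R /\ forall z, (Cmod z < r)%R ->
  (Cmod (om * zeta_reg tau z - eta tau om * z) < eps)%R.
Proof.
  intros He. assert (H : cont dC (fun z => om * zeta_reg tau z - eta tau om * z) 0).
  { apply cont_minus; (apply cont_mult; [apply cont_const|]); [now apply zeta_reg_cont_0|apply cont_id]. }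
  destruct (H eps He) as [r [Hr F]]. exists r. split; [easy|]. intros z Hz.
  assert (Q := F z). unfold dC in Q. rewrite zeta_reg_0 in Q by easy.
  replace (om * zeta_reg tau z - eta tau om * z) with (om * zeta_reg tau z - eta tau om * z - (om * 0 - eta tau om * 0)) by ring.
  apply Q. now replace (z - 0) with z by ring.
Qed.

Lemma exponent_diff z : nl z -> cdiff floquet_exponent z (- om * P z - eta tau om).
Proof.
  intros H. eapply diff_eq.
  - apply diff_minus; [apply diff_scal; now apply wzeta_diff|apply diff_scal, diff_i].
  - ring.
Qed.

Lemma exponent_cont z : nl z -> cont dC floquet_exponent z.
Proof. intros H. apply (diff_cont (fun z => z) _ _ _ (exponent_diff z H)). Qed.

Lemma exponent_removable z : nl z -> removable_at (fun z => - floquet_exponent z) z.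
Proof.
  intros H. destruct (nl_open tau Htau z H) as [r [Hr F]].
  apply removable_regular with (fun z => - (- om * P z - eta tau om)) r; [easy|]. intros v Hv.
  assert (N := F v Hv). split; [now apply diff_opp, exponent_diff|].
  apply cont_opp, cont_minus; [|apply cont_const]. apply cont_mult; [apply cont_const|now apply wp_cont].
Qed.

Lemma om_pos : (0 < Cmod om)%R. Proof. now apply Cmod_gt_0. Qed.
Lemma not_isZ_open (x : R) : (0 < x < 1)%R -> ~ isZ x.
Proof. intros H Z. apply isZ_small in Z; lra. Qed.

Lemma nl_xy (x y : R) : (~ isZ x \/ ~ isZ y) -> nl (x * om + y * om').
Proof.
  intros H. destruct (excluded_middle_informative (nl (x * om + y * om'))) as [h|h]; [easy|].
  apply Hnl in h. tauto.
Qed.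

(** On these lines the reflection maps a point to itself or to its translate by
    [- om], while the function changes its sign. *)
Lemma exponent_zero_side (x y : R) : x = 0%R \/ x = (1/2)%R -> Re (floquet_exponent (x * om + y * om')) = 0%R.
Proof.
  intros H. assert (E := Hrefl x y). destruct H as [-> | ->].
  - replace (- 0 * om + y * om') with (0 * om + y * om') in E by ring. lra.
  - replace (- RtoC (1 / 2) * om + y * om') with (RtoC (1 / 2) * om + y * om' - om) in E
      by (rewrite RtoC_div by lra; field; auto).
    assert (Q := exponent_om (RtoC (1 / 2) * om + y * om' - om)).
    replace (RtoC (1 / 2) * om + y * om' - om + om) with (RtoC (1 / 2) * om + y * om') in Q by ring. lra.
Qed.

Lemma strip_open (x y : R) : (0 < x < 1/2)%R -> exists r, (0 < r)%R /\ forall v, (Cmod (v - (x * om + y * om')) < r)%R ->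
  exists x' y' : R, v = x' * om + y' * om' /\ (0 < x' < 1/2)%R.
Proof.
  intros Hx. assert (Po := om_pos). set (e := Rmin x (1/2 - x)). assert (He : (0 < e)%R) by (apply Rmin_pos; lra).
  exists (e * Cmod om)%R. split; [nra|]. intros v Hv. destruct (Hcoord v) as [x' [y' E]].
  exists x', y'. split; [easy|].
  assert (Q : (Rabs (x' - x) * Cmod om < e * Cmod om)%R).
  { eapply Rle_lt_trans; [|exact Hv]. rewrite E.
    replace (x' * om + y' * om' - (x * om + y * om')) with (RtoC (x' - x) * om + RtoC (y' - y) * om') by (rewrite !RtoC_minus; ring).
    apply Rsqr_incr_0_var; [|apply Cmod_ge_0]. rewrite !Rsqr_pow2, Cmod2_coords.
    rewrite Rpow_mult_distr, pow2_abs. assert (0 <= (y' - y) ^ 2 * Cmod om' ^ 2)%R by (apply Rmult_le_pos; apply pow2_ge_0). lra. }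
  apply Rmult_lt_reg_r in Q; [|easy]. apply Rabs_def2 in Q.
  assert (e <= x)%R by apply Rmin_l. assert (e <= 1/2 - x)%R by apply Rmin_r. lra.
Qed.

Lemma strip_segment (x y x1 y1 M : R) : (0 < x < 1/2)%R -> (0 < x1 <= 1/2)%R ->
  (forall x y : R, (0 < x < 1/2)%R -> (- Re (floquet_exponent (x * om + y * om')) <= M)%R) ->
  (- Re (floquet_exponent (x * om + y * om')) = M)%R -> (- Re (floquet_exponent (x1 * om + y1 * om')) = M)%R.
Proof.
  intros Hx Hx1 Hle HM.
  apply (segment_max (fun z => - floquet_exponent z) (x * om + y * om') (x1 * om + y1 * om') M); [|apply cont_opp, exponent_cont|easy].
  2:{ apply nl_xy. left. apply not_isZ_open. lra. }
  intros t Ht.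
  replace (x * om + y * om' + t * (x1 * om + y1 * om' - (x * om + y * om'))) with
    (RtoC (x + t * (x1 - x)) * om + RtoC (y + t * (y1 - y)) * om')
    by (rewrite !RtoC_plus, !RtoC_mult, !RtoC_minus; ring).
  assert (Hs : (0 < x + t * (x1 - x) < 1/2)%R).
  { replace (x + t * (x1 - x))%R with ((1 - t) * x + t * x1)%R by ring. split; [nra|].
    apply Rlt_le_trans with ((1 - t) * (1/2) + t * (1/2))%R; [nra|lra]. }
  split; [apply exponent_removable, nl_xy; left; apply not_isZ_open; lra|].
  destruct (strip_open _ (y + t * (y1 - y)) Hs) as [r [Hr F]]. exists r. split; [easy|].
  intros v Hv. destruct (F v Hv) as [x' [y' [-> Hx']]]. now apply Hle.
Qed.

Lemma exponent_shift_y (x y : R) (n : Z) : Re (floquet_exponent (x * om + RtoC (y + IZR n) * om')) = Re (floquet_exponent (x * om + y * om')).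
Proof.
  assert (A : forall k (z : C), Re (floquet_exponent (z + IZR (Z.of_nat k) * om')) = Re (floquet_exponent z)).
  { induction k as [|k IH]; intros z; [f_equal; f_equal; simpl; ring|].
    rewrite Nat2Z.inj_succ, succ_IZR, RtoC_plus.
    replace (z + (IZR (Z.of_nat k) + 1) * om') with (z + IZR (Z.of_nat k) * om' + om') by ring.
    now rewrite exponent_om'. }
  destruct (Z.le_ge_cases 0 n) as [h|h].
  - rewrite <- (A (Z.to_nat n) (x * om + y * om')). f_equal. f_equal. rewrite Z2Nat.id, RtoC_plus by easy. ring.
  - rewrite <- (A (Z.to_nat (- n)) (x * om + RtoC (y + IZR n) * om')). f_equal. f_equal.
    rewrite Z2Nat.id, opp_IZR, RtoC_opp, RtoC_plus by lia. ring.
Qed.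

Lemma exponent_shift_x (x y : R) (n : Z) : Re (floquet_exponent (RtoC (x + IZR n) * om + y * om')) = Re (floquet_exponent (x * om + y * om')).
Proof.
  assert (A : forall k (z : C), Re (floquet_exponent (z + IZR (Z.of_nat k) * om)) = Re (floquet_exponent z)).
  { induction k as [|k IH]; intros z; [f_equal; f_equal; simpl; ring|].
    rewrite Nat2Z.inj_succ, succ_IZR, RtoC_plus.
    replace (z + (IZR (Z.of_nat k) + 1) * om) with (z + IZR (Z.of_nat k) * om + om) by ring.
    now rewrite exponent_om. }
  destruct (Z.le_ge_cases 0 n) as [h|h].
  - rewrite <- (A (Z.to_nat n) (x * om + y * om')). f_equal. f_equal. rewrite Z2Nat.id, RtoC_plus by easy. ring.
  - rewrite <- (A (Z.to_nat (- n)) (RtoC (x + IZR n) * om + y * om')). f_equal. f_equal.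
    rewrite Z2Nat.id, opp_IZR, RtoC_opp, RtoC_plus by lia. ring.
Qed.

(** Minimum principle on the half cell.  On the sides the function vanishes, and
    at the pole 0 its principal part is nonnegative, so that the negative part
    [V] is continuous on the closed half cell and attains its maximum. *)
Lemma exponent_nonneg (x y : R) : (0 < x < 1/2)%R -> (0 <= Re (floquet_exponent (x * om + y * om')))%R.
Proof.
  (* the value 0 at the lattice points makes V continuous there *)
  set (V := fun x y : R => if excluded_middle_informative (nl (x * om + y * om')) then Rmax 0 (- Re (floquet_exponent (x * om + y * om'))) else 0%R).
  assert (V0 : forall x y, (0 <= V x y)%R).
  { intros. unfold V. destruct (excluded_middle_informative _); [apply Rmax_l|lra]. }
  destruct (rect_max 0 (1/2) (-1/2) (1/2) V) as [x0 [y0 [Hx0 [Hy0 HM]]]]; [lra|lra| |].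
  { intros a b Ha Hb eps He.
    destruct (excluded_middle_informative (nl (a * om + b * om'))) as [H|H].
    - destruct (nl_open tau Htau _ H) as [r [Hr F]].
      destruct (exponent_cont _ H eps He) as [del [Hd G]].
      assert (Hm : (0 < Rmin r del)%R) by now apply Rmin_pos.
      destruct (cont_plane (fun z => z) om om' (a * om + b * om') a b eq_refl (cont_id _) _ Hm) as [e [He' Q]].
      exists e. split; [easy|]. intros x' y' _ _ Hx Hy. specialize (Q x' y' Hx Hy).
      assert (N : nl (x' * om + y' * om')) by (apply F; eapply Rlt_le_trans; [exact Q|apply Rmin_l]).
      assert (G' : (Cmod (floquet_exponent (x' * om + y' * om')%C - floquet_exponent (a * om + b * om')%C) < eps)%R)
        by (apply G; eapply Rlt_le_trans; [exact Q|apply Rmin_r]).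
      unfold V. destruct (excluded_middle_informative (nl (x' * om + y' * om'))); [|easy].
      destruct (excluded_middle_informative (nl (a * om + b * om'))); [|easy].
      assert (R1 := Rle_lt_trans _ _ _ (re_le_Cmod _) G'). rewrite Re_minus in R1.
      apply Rabs_def2 in R1. apply Rabs_def1; unfold Rmax; repeat destruct (Rle_dec _ _); lra.
    - apply Hnl in H. destruct H as [Z1 Z2]. apply isZ_small in Z1, Z2; [|lra|lra]. subst.
      destruct (rest_small eps He) as [r [Hr F]].
      destruct (cont_plane (fun z => z) om om' 0 0 0 ltac:(ring) (cont_id _) _ Hr) as [e [He' Q]].
      exists e. split; [easy|]. intros x' y' Hx' _ Hx Hy. specialize (Q x' y' Hx Hy). cbv beta in Q.
      replace (x' * om + y' * om' - 0) with (x' * om + y' * om') in Q by ring.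
      assert (E0 : V 0%R 0%R = 0%R).
      { unfold V. destruct (excluded_middle_informative _) as [q|]; [exfalso|easy].
        apply (q 0 0)%Z. rewrite lp_00 by easy. ring. }
      rewrite E0, Rminus_0_r, Rabs_pos_eq by apply V0.
      unfold V. destruct (excluded_middle_informative _) as [N|]; [|easy].
      apply Rmax_lub_lt; [easy|]. assert (N0 := nl_neq0 tau Htau _ N). rewrite exponent_split, Re_plus by easy.
      assert (A := principal_nonneg x' y' (proj1 Hx') N0). specialize (F _ Q).
      assert (B := Rle_lt_trans _ _ _ (re_le_Cmod _) F). apply Rabs_def2 in B. lra. }
  set (M := V x0 y0) in *.
  assert (Below : forall x y : R, (0 < x < 1/2)%R -> (- Re (floquet_exponent (x * om + y * om')) <= M)%R).
  { intros a b Ha. destruct (Z_round b) as [n Hn].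
    replace b with ((b - IZR n) + IZR n)%R by ring. rewrite exponent_shift_y.
    apply Rle_trans with (V a (b - IZR n)%R); [|apply HM; lra]. unfold V.
    destruct (excluded_middle_informative _) as [N|N]; [apply Rmax_r|].
    exfalso. apply N, nl_xy. left. apply not_isZ_open. lra. }
  assert (M0 : M = 0%R).
  { destruct (Rle_lt_or_eq_dec 0 M (V0 _ _)) as [h|h]; [exfalso|easy].
    assert (EM : nl (x0 * om + y0 * om') /\ (- Re (floquet_exponent (x0 * om + y0 * om')) = M)%R).
    { revert h. unfold M, V. destruct (excluded_middle_informative _) as [N|N]; [|lra].
      intros h. split; [easy|]. revert h. unfold Rmax. destruct (Rle_dec _ _); lra. }
    destruct EM as [N EM].
    assert (Hx : (0 < x0 < 1/2)%R).
    { destruct (Req_dec x0 0) as [e|n1]; [rewrite (exponent_zero_side x0 y0) in EM by auto; lra|].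
      destruct (Req_dec x0 (1/2)) as [e|n2]; [rewrite (exponent_zero_side x0 y0) in EM by auto; lra|]. lra. }
    assert (Q := strip_segment x0 y0 (1/2) y0 M Hx ltac:(lra) Below EM).
    rewrite exponent_zero_side in Q by auto. lra. }
  intros Hx. specialize (Below x y Hx). lra.
Qed.

(** A zero inside the strip would be a minimum and would spread to points close to
    0, where the pole makes the function large. *)
Lemma exponent_pos (x y : R) : (0 < x < 1/2)%R -> (0 < Re (floquet_exponent (x * om + y * om')))%R.
Proof.
  intros Hx. destruct (Rle_lt_or_eq_dec _ _ (exponent_nonneg x y Hx)) as [h|h]; [easy|exfalso].
  assert (Po := om_pos).
  destruct (rest_small 1%R Rlt_0_1) as [r [Hr F]].
  set (d := Rmin (1/4) (r / (2 * Cmod om))).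
  assert (Hd : (0 < d)%R) by (apply Rmin_pos; [lra|apply Rdiv_lt_0_compat; lra]).
  assert (Hd1 : (d <= 1/4)%R) by apply Rmin_l.
  assert (Q := strip_segment x y d 0 0 Hx ltac:(lra)).
  assert (E : (- Re (floquet_exponent (d * om + 0 * om')) = 0)%R).
  { apply Q; [|lra]. intros a b Hab. generalize (exponent_nonneg a b Hab). lra. }
  replace (d * om + 0 * om') with (d * om) in E by ring.
  assert (Nd : RtoC d <> 0) by (intros X; apply RtoC_inj in X; lra).
  rewrite exponent_split, Re_plus in E by now apply Cmult_neq_0.
  assert (B : (Cmod (d * om) < r)%R).
  { rewrite Cmod_mult, Cmod_R, Rabs_pos_eq by lra.
    apply Rle_lt_trans with (r / (2 * Cmod om) * Cmod om)%R; [apply Rmult_le_compat_r; [lra|apply Rmin_r]|].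
    replace (r / (2 * Cmod om) * Cmod om)%R with (r / 2)%R by (field; lra). lra. }
  specialize (F _ B). assert (G := Rle_lt_trans _ _ _ (re_le_Cmod _) F). apply Rabs_def2 in G.
  replace (om / (d * om)) with (RtoC (/ d)) in E by (rewrite RtoC_inv by lra; field; auto).
  rewrite Re_RtoC in E. assert (1 < / d)%R; [|lra]. rewrite <- Rinv_1. apply Rinv_lt_contravar; lra.
Qed.

Lemma exponent_zero_iff (x y : R) : Re (floquet_exponent (x * om + y * om')) = 0%R <-> isZ (2 * x).
Proof.
  destruct (Z_round x) as [n Hn]. set (t := (x - IZR n)%R) in *.
  replace x with (t + IZR n)%R by (unfold t; ring). rewrite exponent_shift_x.
  assert (S : isZ (2 * (t + IZR n)) <-> isZ (2 * t)).
  { split; intros H.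
    - replace (2 * t)%R with (2 * (t + IZR n) + - IZR (2 * n))%R by (rewrite mult_IZR; ring).
      apply isZ_plus; [easy|]. apply isZ_opp, isZ_IZR.
    - replace (2 * (t + IZR n))%R with (2 * t + IZR (2 * n))%R by (rewrite mult_IZR; ring).
      apply isZ_plus; [easy|]. apply isZ_IZR. }
  rewrite S. split.
  - intros H. destruct (Rtotal_order t 0) as [h|[h|h]].
    + destruct (Req_dec t (-1/2)) as [->|n1]; [exists (-1)%Z; simpl; lra|exfalso].
      assert (Q := Hrefl (- t) y). rewrite RtoC_opp in Q. replace (- - t) with (RtoC t) in Q by ring.
      assert (X := exponent_pos (- t) y ltac:(lra)). rewrite RtoC_opp in X. lra.
    + exists 0%Z. rewrite h. simpl. ring.
    + destruct (Req_dec t (1/2)) as [->|n1]; [exists 1%Z; simpl; lra|exfalso].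
      assert (X := exponent_pos t y ltac:(lra)). lra.
  - intros [m E]. assert (m = 0 \/ m = 1 \/ m = -1)%Z as [->|[->| ->]].
    { assert (-2 < m < 2)%Z; [|lia]. split; apply lt_IZR; lra. }
    + apply exponent_zero_side. left. simpl in E. lra.
    + apply exponent_zero_side. right. simpl in E. lra.
    + assert (Q := exponent_zero_side (1/2) y (or_intror eq_refl)). assert (R := Hrefl (1/2) y).
      replace t with (- (1/2))%R by (simpl in E; lra). rewrite RtoC_opp. lra.
Qed.
End Direction.

Lemma conj_RtoC (x : R) : Cconj x = x.
Proof. apply C_ext; simpl; ring. Qed.
Lemma conj_tau : Cconj tau = - tau.
Proof. apply C_ext; simpl; [destruct Htau as [H _]; unfold Re in *; simpl in *; rewrite H; ring|ring]. Qed.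

Lemma coord_exists z : exists x y : R, z = x * 1 + y * tau.
Proof. exists (Re z), (Im z / Im tau)%R. rewrite (coords tau Htau z) at 1. ring. Qed.

Lemma tau_neq0 : tau <> 0.
Proof. intros E. destruct Htau as [_ H]. rewrite E in H. simpl in H. lra. Qed.

Lemma eta_swap_real : Re (1 * eta tau tau - eta tau 1 * tau) = 0%R.
Proof.
  rewrite Re_minus, !Re_mult, eta_tau_imag, eta_1_real by easy. destruct Htau as [-> _]. simpl. ring.
Qed.

Lemma exponent_zero_iff_1 (x y : R) : Re (floquet_exponent 1 (x + y * tau)) = 0%R <-> isZ (2 * x).
Proof.
  replace (x + y * tau) with (x * 1 + y * tau) by ring.
  apply exponent_zero_iff; try easy.
  - now left.
  - now right.
  - intros E. apply RtoC_inj in E. lra.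
  - rewrite conj_tau, Re_mult, Re_opp, Im_opp. destruct Htau as [-> _]. simpl. ring.
  - intros a b. replace (a * 1 + b * tau) with (a + b * tau) by ring. apply not_nl_coord.
  - apply coord_exists.
  - apply eta_swap_real.
  - intros a b. unfold floquet_exponent.
    replace (- a * 1 + b * tau) with (- Cconj (a * 1 + b * tau)).
    2:{ rewrite Cplus_conj, !Cmult_conj, !conj_RtoC, conj_tau. ring. }
    rewrite wzeta_opp, wzeta_conj by easy. set (s := a * 1 + b * tau).
    rewrite !Re_minus, !Re_mult, !Re_opp, !Im_opp, re_conj, im_conj, eta_1_real, re_conj by easy. simpl. ring.
Qed.

Lemma exponent_zero_iff_tau (x y : R) : Re (floquet_exponent tau (x + y * tau)) = 0%R <-> isZ (2 * y).
Proof.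
  replace (x + y * tau) with (y * tau + x * 1) by ring.
  apply exponent_zero_iff; try easy.
  - now right.
  - now left.
  - apply tau_neq0.
  - rewrite conj_RtoC, Re_mult. destruct Htau as [-> _]. simpl. ring.
  - intros a b. replace (a * tau + b * 1) with (b + a * tau) by ring. rewrite not_nl_coord. tauto.
  - intros z. destruct (coord_exists z) as [a [b E]]. exists b, a. rewrite E. ring.
  - assert (E := eta_swap_real). replace (tau * eta tau 1 - eta tau tau * 1) with (- (1 * eta tau tau - eta tau 1 * tau)) by ring.
    rewrite Re_opp, E. ring.
  - intros a b. unfold floquet_exponent.
    replace (- a * tau + b * 1) with (Cconj (a * tau + b * 1)).
    2:{ rewrite Cplus_conj, !Cmult_conj, !conj_RtoC, conj_tau. ring. }
    rewrite wzeta_conj by easy. set (s := a * tau + b * 1).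
    rewrite !Re_minus, !Re_mult, !re_conj, !im_conj, eta_tau_imag by easy. destruct Htau as [-> _]. ring.
Qed.

(** * Values on the half period lines *)

Lemma wp_real (x y : R) : isZ (2 * x) \/ isZ (2 * y) -> nl (x + y * tau) -> Im (P (x + y * tau)) = 0%R.
Proof.
  intros H Hn. set (z := x + y * tau) in *.
  assert (E : P (Cconj z) = P z).
  { destruct H as [[m E]|[m E]].
    - replace (Cconj z) with (- z + lp m 0).
      + rewrite wp_lp by (easy || now apply nl_opp). now apply wp_opp.
      + unfold z, lattice_point. rewrite <- E, Cplus_conj, Cmult_conj, !conj_RtoC, conj_tau, RtoC_mult. ring.
    - replace (Cconj z) with (z + lp 0 (- m)).
      + now apply wp_lp.
      + unfold z, lattice_point. rewrite opp_IZR, <- E, Cplus_conj, Cmult_conj, !conj_RtoC, conj_tau, RtoC_opp, RtoC_mult. ring. }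
  rewrite wp_conj in E by easy. apply (f_equal Im) in E. rewrite im_conj in E. lra.
Qed.

Lemma ivt_segment (c d : C) (t0 t1 lam : R) : (t0 <= t1)%R ->
  (forall t, (t0 <= t <= t1)%R -> nl (c + t * d) /\ Im (P (c + t * d)) = 0%R) ->
  (Re (P (c + t0 * d)) <= lam <= Re (P (c + t1 * d)) \/ Re (P (c + t1 * d)) <= lam <= Re (P (c + t0 * d)))%R ->
  exists t, (t0 <= t <= t1)%R /\ P (c + t * d) = RtoC lam.
Proof.
  intros Ht H Hlam. set (g := fun t : R => (Re (P (c + t * d)) - lam)%R).
  assert (Cg : forall t, (t0 <= t <= t1)%R -> continuity_pt g t).
  { intros t Htt. apply continuity_pt_minus; [|apply continuity_pt_const; now intros ? ?].
    apply continuity_pt_filterlim. apply (cont_dR_continuous_Re (fun t : R => P (c + t * d))).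
    apply cont_dI_dR. apply (cont_comp _ P (fun t : R => c + t * d)); [apply wp_cont; [easy|now apply H]|].
    apply cont_plus; [apply cont_const|apply cont_mult; [apply cont_i|apply cont_const]]. }
  assert (Fin : forall t, (t0 <= t <= t1)%R -> g t = 0%R -> exists t, (t0 <= t <= t1)%R /\ P (c + t * d) = RtoC lam).
  { intros t Htt E. exists t. split; [easy|]. apply C_ext; [unfold g in E; simpl in *; lra|]. now apply H. }
  destruct (Req_dec (g t0) 0) as [e|n0]; [apply (Fin t0); [lra|easy]|].
  destruct (Req_dec (g t1) 0) as [e|n1]; [apply (Fin t1); [lra|easy]|].
  assert (Hlt : (t0 < t1)%R).
  { destruct (Req_dec t0 t1) as [->|]; [|lra]. exfalso. unfold g in *. lra. }
  destruct Hlam as [h|h].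
  - destruct (IVT_interv g t0 t1 Cg Hlt) as [t [Htt E]]; [unfold g in *; lra|unfold g in *; lra|]. now apply (Fin t).
  - destruct (IVT_interv (fun t => (- g t)%R) t0 t1) as [t [Htt E]]; [|easy|unfold g in *; lra|unfold g in *; lra|].
    + intros t Htt. apply continuity_pt_opp. now apply Cg.
    + apply (Fin t); [easy|lra].
Qed.

(** The number [s] is positive for [w = 1] and negative for [w = tau]; it decides
    which infinity [wp] tends to along the axis. *)
Lemma pole_axis (w : C) (s lam : R) : w <> 0 -> (1 / w ^ 2 = RtoC s) -> s <> 0%R ->
  exists d : R, (0 < d < 1/2)%R /\ (0 < s -> lam <= Re (P (d * w)))%R /\ (s < 0 -> Re (P (d * w)) <= lam)%R.
Proof.
  intros Hw Es Hs.
  destruct (wp_reg_cont_0 tau Htau 1%R Rlt_0_1) as [r [Hr F]].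
  assert (Pw : (0 < Cmod w)%R) by now apply Cmod_gt_0. assert (Ps : (0 < Rabs s)%R) by now apply Rabs_pos_lt.
  set (B := (Rabs lam + 1)%R). assert (PB : (1 <= B)%R) by (unfold B; generalize (Rabs_pos lam); lra).
  set (d := Rmin (Rmin (1/4) (r / (2 * Cmod w))) (Rabs s / (B + Rabs s))).
  assert (Hd : (0 < d)%R). { repeat apply Rmin_pos; try lra; apply Rdiv_lt_0_compat; lra. }
  assert (D1 : (d <= 1/4)%R) by (eapply Rle_trans; [apply Rmin_l|apply Rmin_l]).
  assert (D2 : (d <= r / (2 * Cmod w))%R) by (eapply Rle_trans; [apply Rmin_l|apply Rmin_r]).
  assert (D3 : (d <= Rabs s / (B + Rabs s))%R) by apply Rmin_r.
  assert (Nd : RtoC d <> 0) by (intros X; apply RtoC_inj in X; lra).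
  exists d. split; [lra|].
  assert (E : P (d * w) = RtoC (s / d ^ 2) + wp_reg tau (d * w)).
  { rewrite wp_split. f_equal. rewrite RtoC_div, <- Es, RtoC_pow by (apply pow_nonzero; lra). field. auto. }
  assert (Q : (Rabs (Re (wp_reg tau (d * w))) < 1)%R).
  { eapply Rle_lt_trans; [apply re_le_Cmod|]. specialize (F (d * w)). rewrite wp_reg_0 in F by easy.
    replace (wp_reg tau (d * w)) with (wp_reg tau (d * w) - 0) by ring. apply F. unfold dC.
    replace (d * w - 0) with (d * w) by ring. rewrite Cmod_mult, Cmod_R, Rabs_pos_eq by lra.
    apply Rle_lt_trans with (r / (2 * Cmod w) * Cmod w)%R; [now apply Rmult_le_compat_r; [lra|]|].
    replace (r / (2 * Cmod w) * Cmod w)%R with (r / 2)%R by (field; lra). lra. }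
  apply Rabs_def2 in Q. rewrite E, Re_plus, Re_RtoC.
  assert (G : (B <= Rabs s / d ^ 2)%R).
  { apply Rmult_le_reg_r with (d ^ 2)%R; [apply pow_lt; lra|].
    replace (Rabs s / d ^ 2 * d ^ 2)%R with (Rabs s) by (field; lra).
    assert (X : (d * (B + Rabs s) <= Rabs s)%R).
    { apply Rle_trans with (Rabs s / (B + Rabs s) * (B + Rabs s))%R; [apply Rmult_le_compat_r; lra|].
      apply Req_le. field. lra. }
    assert (d ^ 2 <= d)%R by nra. nra. }
  assert (L := Rle_abs lam). assert (L2 := Rle_abs (- lam)). rewrite Rabs_Ropp in L2. split; intros h.
  - rewrite Rabs_pos_eq in G by lra. unfold B in *. lra.
  - rewrite Rabs_left in G by lra. unfold B in *. replace (- s / d ^ 2)%R with (- (s / d ^ 2))%R in G by (field; lra). lra.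
Qed.

(** The numbers [e_k], which are real by [wp_real]. *)
Definition root1 := Re (e tau 1).
Definition root2 := Re (e tau 2).
Definition root3 := Re (e tau 3).

Lemma half_not_isZ : ~ isZ (1/2).
Proof. intros [m E]. assert (X : (2 * m = 1)%Z) by (apply eq_IZR; rewrite mult_IZR; lra). lia. Qed.

Lemma half_isZ2 : isZ (2 * (1/2)).
Proof. exists 1%Z. simpl. lra. Qed.
Lemma zero_isZ2 : isZ (2 * 0).
Proof. exists 0%Z. simpl. lra. Qed.

Lemma e_eq1 : e tau 1 = P (RtoC (1/2) + RtoC 0 * tau).
Proof. unfold e, omega. f_equal. rewrite RtoC_div by lra. field. Qed.
Lemma e_eq2 : e tau 2 = P (RtoC 0 + RtoC (1/2) * tau).
Proof. unfold e, omega. f_equal. rewrite RtoC_div by lra. field. Qed.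
Lemma e_eq3 : e tau 3 = P (RtoC (1/2) + RtoC (1/2) * tau).
Proof. unfold e, omega. f_equal. rewrite RtoC_div by lra. field. Qed.

Lemma root1_correct : e tau 1 = RtoC root1.
Proof.
  apply C_ext; [easy|]. rewrite e_eq1. apply wp_real; [left; apply half_isZ2|]. apply nl_coord. left. apply half_not_isZ.
Qed.
Lemma root2_correct : e tau 2 = RtoC root2.
Proof.
  apply C_ext; [easy|]. rewrite e_eq2. apply wp_real; [right; apply half_isZ2|]. apply nl_coord. right. apply half_not_isZ.
Qed.
Lemma root3_correct : e tau 3 = RtoC root3.
Proof.
  apply C_ext; [easy|]. rewrite e_eq3. apply wp_real; [right; apply half_isZ2|]. apply nl_coord. right. apply half_not_isZ.
Qed.

Lemma wp_eq_coords (x y x' y' : R) : nl (x + y * tau) -> nl (x' + y' * tau) -> P (x + y * tau) = P (x' + y' * tau) ->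
  (isZ (x - x') /\ isZ (y - y')) \/ (isZ (x + x') /\ isZ (y + y')).
Proof.
  intros H H' E. destruct (wp_injective tau Htau _ _ H H' E) as [N|N]; [left|right]; apply not_nl_coord.
  - intros q. apply N. replace (x + y * tau - (x' + y' * tau)) with (RtoC (x - x') + RtoC (y - y') * tau) by (rewrite !RtoC_minus; ring). easy.
  - intros q. apply N. replace (x + y * tau + (x' + y' * tau)) with (RtoC (x + x') + RtoC (y + y') * tau) by (rewrite !RtoC_plus; ring). easy.
Qed.

Lemma isZ_double_pm (x x' : R) : isZ (x - x') \/ isZ (x + x') -> isZ (2 * x') -> isZ (2 * x).
Proof.
  intros [H|H] H'.
  - replace (2 * x)%R with ((x - x') + (x - x') + 2 * x')%R by ring. auto using isZ_plus.
  - replace (2 * x)%R with ((x + x') + (x + x') + - (2 * x'))%R by ring. auto using isZ_plus, isZ_opp.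
Qed.

Lemma onto_real_axis lam : (root1 <= lam)%R -> exists x : R, (0 < x <= 1/2)%R /\ P (x + RtoC 0 * tau) = RtoC lam.
Proof.
  intros H. destruct (pole_axis 1 1 lam) as [d [Hd [Q _]]].
  - intros E. apply RtoC_inj in E. lra.
  - field.
  - lra.
  - specialize (Q Rlt_0_1).
    destruct (ivt_segment 0 1 d (1/2) lam) as [t [Ht E]]; [lra| | |].
    + intros t Ht. replace (0 + t * 1) with (t + RtoC 0 * tau) by ring.
      assert (N : nl (t + RtoC 0 * tau)) by (apply nl_coord; left; apply not_isZ_open; lra).
      split; [easy|]. apply wp_real; [right; apply zero_isZ2|easy].
    + right. replace (0 + RtoC (1/2) * 1) with (RtoC (1/2) + RtoC 0 * tau) by ring.
      replace (0 + d * 1) with (d * 1) by ring. rewrite <- e_eq1. split; [exact H|easy].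
    + exists t. split; [lra|]. rewrite <- E. f_equal. ring.
Qed.

Lemma onto_imag_axis lam : (lam <= root2)%R -> exists y : R, (0 < y <= 1/2)%R /\ P (RtoC 0 + y * tau) = RtoC lam.
Proof.
  intros H. assert (T0 := tau_neq0). destruct Htau as [T1 T2].
  destruct (pole_axis tau (- / (Im tau ^ 2)) lam) as [d [Hd [_ Q]]].
  - easy.
  - assert (E : tau ^ 2 = RtoC (- (Im tau ^ 2))).
    { apply C_ext; unfold Re, Im in *; simpl; rewrite T1; ring. }
    rewrite E, !RtoC_opp, RtoC_inv by (apply pow_nonzero; lra). field.
    intros X. apply RtoC_inj in X. apply pow_nonzero in X; lra.
  - apply Ropp_neq_0_compat, Rinv_neq_0_compat, pow_nonzero. lra.
  - assert (Q' : (Re (P (d * tau)) <= lam)%R).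
    { apply Q. apply Ropp_lt_gt_0_contravar, Rinv_0_lt_compat, pow_lt, T2. }
    destruct (ivt_segment 0 tau d (1/2) lam) as [t [Ht E]]; [lra| | |].
    + intros t Ht.
      assert (N : nl (RtoC 0 + t * tau)) by (apply nl_coord; right; apply not_isZ_open; lra).
      split; [easy|]. apply wp_real; [left; apply zero_isZ2|easy].
    + left. rewrite <- e_eq2. replace (0 + d * tau) with (d * tau) by ring. split; [easy|exact H].
    + exists t. split; [lra|easy].
Qed.

(** Otherwise the intermediate value theorem on the real axis produces a point
    with the same value as [(1 + tau) / 2], against injectivity. *)
Lemma root3_lt_root1 : (root3 < root1)%R.
Proof.
  destruct (Rlt_le_dec root3 root1) as [h|h]; [easy|exfalso].
  destruct (onto_real_axis root3 h) as [x [Hx E]]. rewrite <- root3_correct, e_eq3 in E.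
  apply wp_eq_coords in E.
  - destruct E as [[_ Z]|[_ Z]].
    + apply half_not_isZ. replace (1/2)%R with (- (0 - 1/2))%R by ring. now apply isZ_opp.
    + apply half_not_isZ. now replace (1/2)%R with (0 + 1/2)%R by ring.
  - apply nl_coord. left. apply not_isZ_open. lra.
  - apply nl_coord. left. apply half_not_isZ.
Qed.

Lemma root2_lt_root3 : (root2 < root3)%R.
Proof.
  destruct (Rlt_le_dec root2 root3) as [h|h]; [easy|exfalso].
  destruct (onto_imag_axis root3 h) as [y [Hy E]]. rewrite <- root3_correct, e_eq3 in E.
  apply wp_eq_coords in E.
  - destruct E as [[Z _]|[Z _]].
    + apply half_not_isZ. replace (1/2)%R with (- (0 - 1/2))%R by ring. now apply isZ_opp.
    + apply half_not_isZ. now replace (1/2)%R with (0 + 1/2)%R by ring.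
  - apply nl_coord. right. apply not_isZ_open. lra.
  - apply nl_coord. left. apply half_not_isZ.
Qed.

Lemma onto_tau_half_line lam : (root2 <= lam <= root3)%R -> exists x : R, P (x + RtoC (1/2) * tau) = RtoC lam.
Proof.
  intros H. destruct (ivt_segment (RtoC (1/2) * tau) 1 0 (1/2) lam) as [t [Ht E]]; [lra| | |].
  - intros t Ht. replace (RtoC (1 / 2) * tau + t * 1) with (t + RtoC (1/2) * tau) by ring.
    assert (N : nl (t + RtoC (1/2) * tau)) by (apply nl_coord; right; apply half_not_isZ).
    split; [easy|]. apply wp_real; [right; apply half_isZ2|easy].
  - left. replace (RtoC (1 / 2) * tau + 0 * 1) with (RtoC 0 + RtoC (1/2) * tau) by ring.
    replace (RtoC (1 / 2) * tau + RtoC (1/2) * 1) with (RtoC (1/2) + RtoC (1/2) * tau) by ring.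
    rewrite <- e_eq2, <- e_eq3. exact H.
  - exists t. rewrite <- E. f_equal. ring.
Qed.

Lemma onto_one_half_line lam : (root3 <= lam <= root1)%R -> exists y : R, P (RtoC (1/2) + y * tau) = RtoC lam.
Proof.
  intros H. destruct (ivt_segment (RtoC (1/2)) tau 0 (1/2) lam) as [t [Ht E]]; [lra| | |].
  - intros t Ht.
    assert (N : nl (RtoC (1/2) + t * tau)) by (apply nl_coord; left; apply half_not_isZ).
    split; [easy|]. apply wp_real; [left; apply half_isZ2|easy].
  - right. rewrite <- e_eq1, <- e_eq3. exact H.
  - exists t. exact E.
Qed.

(** The values of [wp] on the lines [Re a] in [(1/2) Z].  For [band2] these are the
    lines on which [Im a] is a multiple of [Im tau / 2]. *)
Definition band1 (lam : C) : Prop := Im lam = 0%R /\ (Re lam <= root2 \/ root3 <= Re lam <= root1)%R.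
Definition band2 (lam : C) : Prop := Im lam = 0%R /\ (root2 <= Re lam <= root3 \/ root1 <= Re lam)%R.

Lemma real_eq lam : Im lam = 0%R -> lam = RtoC (Re lam).
Proof. intros H. apply C_ext; [easy|exact H]. Qed.

(** Each value in the band is attained on one of these lines, and [wp] is injective
    up to sign and periods. *)
Lemma band1_isZ (x y : R) : nl (x + y * tau) -> band1 (P (x + y * tau)) -> isZ (2 * x).
Proof.
  intros Hn [HI H]. apply real_eq in HI. destruct H as [H|H].
  - destruct (onto_imag_axis _ H) as [y' [Hy' E]]. rewrite <- HI in E.
    assert (N : nl (RtoC 0 + y' * tau)) by (apply nl_coord; right; apply not_isZ_open; lra).
    apply isZ_double_pm with 0%R; [|apply zero_isZ2].
    destruct (wp_eq_coords x y 0 y' Hn N (eq_sym E)) as [[Z _]|[Z _]]; auto.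
  - destruct (onto_one_half_line _ H) as [y' E]. rewrite <- HI in E.
    assert (N : nl (RtoC (1/2) + y' * tau)) by (apply nl_coord; left; apply half_not_isZ).
    apply isZ_double_pm with (1/2)%R; [|apply half_isZ2].
    destruct (wp_eq_coords x y (1/2) y' Hn N (eq_sym E)) as [[Z _]|[Z _]]; auto.
Qed.

Lemma band2_isZ (x y : R) : nl (x + y * tau) -> band2 (P (x + y * tau)) -> isZ (2 * y).
Proof.
  intros Hn [HI H]. apply real_eq in HI. destruct H as [H|H].
  - destruct (onto_tau_half_line _ H) as [x' E]. rewrite <- HI in E.
    assert (N : nl (x' + RtoC (1/2) * tau)) by (apply nl_coord; right; apply half_not_isZ).
    apply isZ_double_pm with (1/2)%R; [|apply half_isZ2].
    destruct (wp_eq_coords x y x' (1/2) Hn N (eq_sym E)) as [[_ Z]|[_ Z]]; auto.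
  - destruct (onto_real_axis _ H) as [x' [Hx' E]]. rewrite <- HI in E.
    assert (N : nl (x' + RtoC 0 * tau)) by (apply nl_coord; left; apply not_isZ_open; lra).
    apply isZ_double_pm with 0%R; [|apply zero_isZ2].
    destruct (wp_eq_coords x y x' 0 Hn N (eq_sym E)) as [[_ Z]|[_ Z]]; auto.
Qed.

Lemma half_values (x y : R) : nl (x + y * tau) -> isZ (2 * x) -> isZ (2 * y) ->
  P (x + y * tau) = RtoC root1 \/ P (x + y * tau) = RtoC root2 \/ P (x + y * tau) = RtoC root3.
Proof.
  intros Hn [k Hk] [l Hl].
  assert (D : forall (x : R) (k : Z), (2 * x = IZR k)%R -> exists m : Z, x = IZR m \/ x = (1/2 + IZR m)%R).
  { clear. intros x k H. exists (k / 2)%Z. assert (B := Z.mod_pos_bound k 2 ltac:(lia)). assert (E := Z.div_mod k 2 ltac:(lia)).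
    assert (k mod 2 = 0 \/ k mod 2 = 1)%Z as [h|h] by lia; rewrite h in E; apply (f_equal IZR) in E;
    rewrite plus_IZR, mult_IZR in E; [left|right]; simpl in E; lra. }
  destruct (D x k Hk) as [m Hm]. destruct (D y l Hl) as [n Hn'].
  assert (S : forall a b : R, nl (a + b * tau) -> P (RtoC (a + IZR m) + RtoC (b + IZR n) * tau) = P (a + b * tau)).
  { intros a b H. rewrite <- (wp_lp tau Htau _ m n H). f_equal. unfold lattice_point. rewrite !RtoC_plus. ring. }
  rewrite <- root1_correct, <- root2_correct, <- root3_correct, e_eq1, e_eq2, e_eq3.
  destruct Hm as [Hm|Hm], Hn' as [Hn'|Hn'].
  - exfalso. apply (not_nl_coord x y); [|easy]. split; [now exists m|now exists n].
  - right; left. rewrite <- (S 0 (1/2))%R by (apply nl_coord; right; apply half_not_isZ). rewrite Hm, Hn'. f_equal. f_equal. f_equal. ring.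
  - left. rewrite <- (S (1/2) 0)%R by (apply nl_coord; left; apply half_not_isZ). rewrite Hm, Hn'. f_equal. f_equal. f_equal. f_equal. ring.
  - right; right. rewrite <- (S (1/2) (1/2))%R by (apply nl_coord; left; apply half_not_isZ). now rewrite Hm, Hn'.
Qed.

Lemma band_cover (r : R) : band1 (RtoC r) \/ band2 (RtoC r).
Proof.
  unfold band1, band2. simpl. assert (A := root2_lt_root3). assert (B := root3_lt_root1).
  destruct (Rle_lt_dec r root2); [left; lra|]. destruct (Rle_lt_dec r root3); [right; lra|].
  destruct (Rle_lt_dec r root1); [left; lra|right; lra].
Qed.

(** A value on one of these lines is real, hence in one of the two bands.  If it
    is in the other one, then [x + y * tau] is a half period and the value is one of
    the common end points. *)
Lemma band1_iff (x y : R) : nl (x + y * tau) -> (isZ (2 * x) <-> band1 (P (x + y * tau))).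
Proof.
  intros Hn. split; [|now apply band1_isZ]. intros H.
  assert (R := real_eq _ (wp_real x y (or_introl H) Hn)).
  destruct (band_cover (Re (P (x + y * tau)))) as [h|h]; rewrite <- R in h; [easy|].
  assert (A := root2_lt_root3). assert (B := root3_lt_root1).
  destruct (half_values x y Hn H (band2_isZ x y Hn h)) as [-> |[-> | ->]]; split; simpl; try easy; lra.
Qed.

Lemma band2_iff (x y : R) : nl (x + y * tau) -> (isZ (2 * y) <-> band2 (P (x + y * tau))).
Proof.
  intros Hn. split; [|now apply band2_isZ]. intros H.
  assert (R := real_eq _ (wp_real x y (or_intror H) Hn)).
  destruct (band_cover (Re (P (x + y * tau)))) as [h|h]; rewrite <- R in h; [|easy].
  assert (A := root2_lt_root3). assert (B := root3_lt_root1).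
  destruct (half_values x y Hn (band1_isZ x y Hn h) H) as [-> |[-> | ->]]; split; simpl; try easy; lra.
Qed.
End Bands.

(** * Curves: exponentials of primitives and bounded derivatives *)

Lemma exp_primitive (g : R -> C) : (forall t, cont dR g t) -> exists E : R -> C,
  E 0%R = 1 /\ (forall t, E t <> 0) /\ (forall t, rdiff E t (g t * E t)) /\
  forall t, Cmod (E t) = exp (RInt (fun s => Re (g s)) 0 t).
Proof.
  intros Hg. set (a := fun t => RInt (fun s => Re (g s)) 0 t). set (b := fun t => RInt (fun s => Im (g s)) 0 t).
  assert (Da : forall t, is_derive a t (Re (g t))).
  { intros t. apply (is_derive_RInt (fun s => Re (g s)) _ 0%R); [|now apply cont_dR_continuous_Re].
    apply filter_forall. intros x. apply (RInt_correct (fun s => Re (g s))).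
    apply (@ex_RInt_continuous R_CompleteNormedModule). intros; now apply cont_dR_continuous_Re. }
  assert (Db : forall t, is_derive b t (Im (g t))).
  { intros t. apply (is_derive_RInt (fun s => Im (g s)) _ 0%R); [|now apply cont_dR_continuous_Im].
    apply filter_forall. intros x. apply (RInt_correct (fun s => Im (g s))).
    apply (@ex_RInt_continuous R_CompleteNormedModule). intros; now apply cont_dR_continuous_Im. }
  exists (fun t => (exp (a t) * cos (b t), exp (a t) * sin (b t))%R).
  assert (M : forall t, Cmod (exp (a t) * cos (b t), exp (a t) * sin (b t))%R = exp (a t)).
  { intros t. unfold Cmod. simpl.
    replace (_ + _)%R with ((exp (a t)) ^ 2 * (Rsqr (sin (b t)) + Rsqr (cos (b t))))%R by (unfold Rsqr; ring).
    rewrite sin2_cos2, Rmult_1_r, sqrt_pow2; [easy|]. apply Rlt_le, exp_pos. }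
  split; [|split; [|split]].
  - unfold a, b. rewrite !RInt_point. unfold zero; simpl. rewrite exp_0, cos_0, sin_0. apply C_ext; simpl; ring.
  - intros t. apply Cmod_gt_0. rewrite M. apply exp_pos.
  - intros t. apply is_derive_rdiff.
    + unfold Re at 1. simpl fst. auto_derive.
      * repeat match goal with |- _ /\ _ => split | |- True => exact I | |- ex_derive ?f t => first [exists (Re (g t)); apply Da | exists (Im (g t)); apply Db] end.
      * replace (Derive (fun x => a x) t) with (Re (g t)) by (symmetry; apply is_derive_unique, Da).
        replace (Derive (fun x => b x) t) with (Im (g t)) by (symmetry; apply is_derive_unique, Db).
        unfold Re, Im; simpl. ring.
    + unfold Im at 1. simpl snd. auto_derive.
      * repeat match goal with |- _ /\ _ => split | |- True => exact I | |- ex_derive ?f t => first [exists (Re (g t)); apply Da | exists (Im (g t)); apply Db] end.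
      * replace (Derive (fun x => a x) t) with (Re (g t)) by (symmetry; apply is_derive_unique, Da).
        replace (Derive (fun x => b x) t) with (Im (g t)) by (symmetry; apply is_derive_unique, Db).
        unfold Re, Im; simpl. ring.
  - exact M.
Qed.

Lemma CInt_Re (f : R -> C) a b : Re (CInt f a b) = RInt (fun s => Re (f s)) a b.
Proof. reflexivity. Qed.

Definition bdd (f : R -> C) : Prop := exists M, forall t, (Cmod (f t) <= M)%R.

Lemma bdd_plus f g : bdd f -> bdd g -> bdd (fun t => f t + g t).
Proof.
  intros [M H] [N G]. exists (M + N)%R. intros t. eapply Rle_trans; [apply Cmod_triangle|].
  specialize (H t); specialize (G t); lra.
Qed.
Lemma bdd_mult f g : bdd f -> bdd g -> bdd (fun t => f t * g t).
Proof.
  intros [M H] [N G]. exists (M * N)%R. intros t. rewrite Cmod_mult.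
  apply Rmult_le_compat; auto using Cmod_ge_0.
Qed.
Lemma bdd_const c : bdd (fun _ => c).
Proof. exists (Cmod c). intros; lra. Qed.
Lemma bdd_opp f : bdd f -> bdd (fun t => - f t).
Proof. intros [M H]. exists M. intros t. now rewrite Cmod_opp. Qed.
Lemma bdd_minus f g : bdd f -> bdd g -> bdd (fun t => f t - g t).
Proof. intros. apply bdd_plus; [easy|]. now apply bdd_opp. Qed.
Lemma bdd_ext f g : (forall t, f t = g t) -> bdd f -> bdd g.
Proof. intros E [M H]. exists M. intros t. now rewrite <- E. Qed.

Lemma cont_bounded_interval (f : R -> C) (a b : R) : (a <= b)%R -> (forall t, (a <= t <= b)%R -> cont dR f t) ->
  exists M, forall t, (a <= t <= b)%R -> (Cmod (f t) <= M)%R.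
Proof.
  intros Hab H. destruct (continuity_ab_maj (fun s => Cmod (f s)) a b Hab) as [s0 [Hs0 _]].
  - intros s Hs. intros eps Hep. destruct (H s Hs eps Hep) as [del [Hdel F]]. exists del. split; [easy|].
    intros t [_ Ht]. simpl in *. unfold R_dist in *.
    assert (T1 := Cmod_triangle_sub (f t) (f s)). assert (T2 := Cmod_triangle_sub (f s) (f t)).
    rewrite (Cmod_sub_sym (f s)) in T2. specialize (F t Ht). apply Rabs_def1; lra.
  - now exists (Cmod (f s0)).
Qed.

Lemma shift_Z (P : R -> Prop) : (forall t, P t <-> P (t + 1)%R) -> forall t (k : Z), P t <-> P (t + IZR k)%R.
Proof.
  intros H.
  assert (A : forall k t, P t <-> P (t + IZR (Z.of_nat k))%R).
  { induction k as [|k IH]; intros t; [simpl; now rewrite Rplus_0_r|].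
    rewrite (IH t), H. rewrite Nat2Z.inj_succ, succ_IZR, Rplus_assoc. easy. }
  intros t k. destruct (Z.le_ge_cases 0 k) as [h|h].
  - replace k with (Z.of_nat (Z.to_nat k)) by lia. apply A.
  - symmetry. rewrite (A (Z.to_nat (- k)) (t + IZR k)%R).
    replace (t + IZR k + IZR (Z.of_nat (Z.to_nat (- k))))%R with t; [easy|].
    rewrite Z2Nat.id by lia. rewrite opp_IZR. ring.
Qed.

Lemma Cmod_periodic_bdd (f : R -> C) : (forall t, cont dR f t) -> (forall t, Cmod (f (t + 1)%R) = Cmod (f t)) -> bdd f.
Proof.
  intros Hc Hp. destruct (cont_bounded_interval f 0 1) as [M HM]; [lra|auto|].
  exists M. intros t. destruct (archimed t) as [A B]. set (k := up t) in *.
  apply (shift_Z (fun t => (Cmod (f t) <= M)%R)) with (k := (1 - k)%Z).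
  - intros s. now rewrite Hp.
  - apply HM. rewrite minus_IZR. lra.
Qed.

Lemma periodic_bdd (f : R -> C) : (forall t, cont dR f t) -> (forall t, f (t + 1)%R = f t) -> bdd f.
Proof. intros Hc Hp. apply Cmod_periodic_bdd; [easy|]. intros. now rewrite Hp. Qed.

(** The mean value theorem on [t, t + 1] provides a point where [f'] is bounded by
    [2 M]; from there to [t] the derivative changes by at most [N]. *)
Lemma landau_real (f f' f'' : R -> R) (M N : R) : (forall t, is_derive f t (f' t)) -> (forall t, is_derive f' t (f'' t)) ->
  (forall t, (Rabs (f t) <= M)%R) -> (forall t, (Rabs (f'' t) <= N)%R) -> forall t, (Rabs (f' t) <= 2 * M + N)%R.
Proof.
  intros D1 D2 H0 H2 t.
  assert (C1 : forall t, continuity_pt f t) by (intros; apply continuity_pt_filterlim, (@ex_derive_continuous R_AbsRing R_NormedModule); eexists; apply D1).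
  assert (C2 : forall t, continuity_pt f' t) by (intros; apply continuity_pt_filterlim, (@ex_derive_continuous R_AbsRing R_NormedModule); eexists; apply D2).
  destruct (MVT_gen f t (t + 1) f') as [x [Hx E]]; [auto|auto|].
  rewrite Rmin_left, Rmax_right in Hx by lra. replace (t + 1 - t)%R with 1%R in E by ring.
  destruct (MVT_gen f' t x f'') as [y [_ E2]]; [auto|auto|].
  assert (A := H0 t). assert (B := H0 (t + 1)%R). assert (C := H2 y).
  apply Rabs_le_between in A, B, C. apply Rabs_le_between.
  assert (X : (- N <= f'' y * (x - t) <= N)%R) by (split; nra). lra.
Qed.

Lemma landau (f f' f'' : R -> C) : (forall t, rdiff f t (f' t)) -> (forall t, rdiff f' t (f'' t)) ->
  bdd f -> bdd f'' -> bdd f'.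
Proof.
  intros D1 D2 [M H0] [N H2]. exists (2 * (2 * M + N))%R. intros t.
  eapply Rle_trans; [apply Cmod_le_Re_Im|].
  assert (A : (Rabs (Re (f' t)) <= 2 * M + N)%R).
  { apply (landau_real (fun t => Re (f t)) (fun t => Re (f' t)) (fun t => Re (f'' t))).
    - intros; now apply rdiff_Re.
    - intros; now apply rdiff_Re.
    - intros. eapply Rle_trans; [apply re_le_Cmod|auto].
    - intros. eapply Rle_trans; [apply re_le_Cmod|auto]. }
  assert (B : (Rabs (Im (f' t)) <= 2 * M + N)%R).
  { apply (landau_real (fun t => Im (f t)) (fun t => Im (f' t)) (fun t => Im (f'' t))).
    - intros; now apply rdiff_Im.
    - intros; now apply rdiff_Im.
    - intros. eapply Rle_trans; [apply im_le_Cmod|auto].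
    - intros. eapply Rle_trans; [apply im_le_Cmod|auto]. }
  lra.
Qed.

Lemma rdiff_0_eq (f : R -> C) : (forall t, rdiff f t 0) -> forall s t, f s = f t.
Proof.
  intros H s t. set (m := (Rabs s + Rabs t + 1)%R).
  assert (A := Rle_abs s). assert (B := Rle_abs (- s)). assert (C := Rle_abs t). assert (D := Rle_abs (- t)).
  rewrite Rabs_Ropp in B, D. assert (E := Rabs_pos s). assert (F := Rabs_pos t).
  apply (rdiff_0_constant f (- m) m); unfold m; auto; lra.
Qed.

Lemma pow_small (q K : R) : (0 < q < 1)%R -> forall eps, (0 < eps)%R -> exists n, (K * q ^ n < eps)%R.
Proof.
  intros Hq eps He. destruct (pow_lt_1_zero q) with (y := (eps / (Rabs K + 1))%R) as [N H].
  - rewrite Rabs_pos_eq; lra.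
  - apply Rdiv_lt_0_compat; [easy|]. generalize (Rabs_pos K); lra.
  - exists N. specialize (H N (le_n _)). assert (P : (0 < q ^ N)%R) by now apply pow_lt.
    rewrite Rabs_pos_eq in H by lra. assert (A := Rle_abs K). assert (B := Rabs_pos K).
    assert (X : (q ^ N * (Rabs K + 1) < eps)%R).
    { apply Rlt_le_trans with (eps / (Rabs K + 1) * (Rabs K + 1))%R; [apply Rmult_lt_compat_r; lra|].
      apply Req_le. field. lra. }
    nra.
Qed.

(** * The period integral of zeta *)

Section Floquet.
Variable tau : C.
Hypothesis Htau : Re tau = 0%R /\ (0 < Im tau)%R.
Notation lp := (lattice_point tau).
Notation zeta := (wzeta tau).
Notation P := (wp tau).
Notation nl := (off_lattice tau).
Notation W1 := (wp_d1 tau).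
Variables om om' : C.
Hypothesis Hom : is_period tau om.
Hypothesis Hom' : is_period tau om'.
Hypothesis Hnot0 : om <> 0.
Hypothesis Hnl : forall x y : R, ~ nl (x * om + y * om') <-> isZ x /\ isZ y.
Hypothesis Hcoord : forall z, exists x y : R, z = x * om + y * om'.
Hypothesis Heta : Re (om * eta tau om' - eta tau om * om') = 0%R.
Notation expo := (floquet_exponent tau om).

Definition line_off z : Prop := forall t : R, nl (z + om * t).

Lemma off_iff (x y : R) : line_off (x * om + y * om') <-> ~ isZ y.
Proof.
  split.
  - intros H Z. specialize (H (- x)%R). apply (proj2 (Hnl 0 y)); [split; [exists 0%Z; easy|easy]|].
    replace (0 * om + y * om') with (x * om + y * om' + om * RtoC (- x)); [easy|]. rewrite RtoC_opp. ring.
  - intros H t. destruct (excluded_middle_informative (nl (x * om + y * om' + om * t))) as [h|h]; [easy|exfalso].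
    apply H. apply (Hnl (x + t) y).
    now replace (RtoC (x + t) * om + y * om') with (x * om + y * om' + om * t) by (rewrite RtoC_plus; ring).
Qed.

Lemma line_diff (f : C -> C) z (t : R) l : cdiff f (z + om * t) l -> rdiff (fun s : R => f (z + om * s)) t (om * l).
Proof.
  intros H. eapply diff_eq; [apply (diff_comp RtoC f (fun s : R => z + om * s)); [exact H|apply rdiff_line]|]. ring.
Qed.

Lemma line_cont (f : C -> C) z (t : R) : cont dC f (z + om * t) -> cont dR (fun s : R => f (z + om * s)) t.
Proof.
  intros H. apply cont_dI_dR. apply (cont_comp _ f (fun s : R => z + om * s)); [exact H|].
  eapply diff_cont, rdiff_line.
Qed.

Lemma line_succ z (t : R) : z + om * RtoC (t + 1) = z + om * t + om.
Proof. rewrite RtoC_plus. ring. Qed.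

Definition zeta_int z : C := CInt (fun s => om * zeta (z + om * s)) 0 1.

(** The derivative of [om * zeta] along the line is the integrand of the derivative
    in [v], up to the factor [d / om]. *)
Lemma zeta_int_diff z d (a b u : R) : (a < u < b)%R -> (forall v, (a < v < b)%R -> line_off (z + v * d)) ->
  rdiff (fun v : R => zeta_int (z + v * d)) u (d * eta tau om).
Proof.
  intros Hu Hoff. eapply diff_eq.
  - apply (param_integral (fun v s : R => om * zeta (z + v * d + om * s)) (fun v s : R => om * (om * - P (z + v * d + om * s)))
      (fun _ => d / om) a b u Hu).
    + intros v s Hv. eapply diff_eq.
      * apply diff_scal. apply (diff_comp RtoC zeta (fun v : R => z + v * d + om * s)).
        -- apply wzeta_diff; [easy|]. now apply Hoff.
        -- apply diff_plus; [apply diff_plus; [apply diff_const|apply diff_mult; [apply diff_i|apply diff_const]]|apply diff_const].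
      * cbv beta. field. easy.
    + intros v s Hv. apply diff_scal. apply line_diff. apply wzeta_diff; [easy|]. now apply Hoff.
    + intros v s Hv. apply cont_mult; [apply cont_const|]. apply cont_mult; [apply cont_const|]. apply cont_opp.
      apply (cont_comp d2 P (fun p : R * R => z + fst p * d + om * snd p)).
      * apply wp_cont; [easy|]. now apply Hoff.
      * assert (Cf : cont d2 (fun p : R * R => RtoC (fst p)) (v, s)).
        { intros eps He. exists eps. split; [easy|]. intros p Hp. simpl. rewrite <- RtoC_minus, Cmod_R.
          eapply Rle_lt_trans; [|exact Hp]. apply Rmax_l. }
        assert (Cs : cont d2 (fun p : R * R => RtoC (snd p)) (v, s)).
        { intros eps He. exists eps. split; [easy|]. intros p Hp. simpl. rewrite <- RtoC_minus, Cmod_R.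
          eapply Rle_lt_trans; [|exact Hp]. apply Rmax_r. }
        apply cont_plus; [apply cont_plus; [apply cont_const|apply cont_mult; [exact Cf|apply cont_const]]|].
        apply cont_mult; [apply cont_const|exact Cs].
    + intros v _. apply cont_const.
  - cbv beta. replace (z + u * d + om * 1) with (z + u * d + om) by ring. replace (z + u * d + om * 0) with (z + u * d) by ring.
    rewrite zeta_period by easy. field. easy.
Qed.

Lemma zeta_int_affine z d (a b u v : R) : (a < u < b)%R -> (a < v < b)%R -> (forall v, (a < v < b)%R -> line_off (z + v * d)) ->
  zeta_int (z + u * d) - eta tau om * (z + u * d) = zeta_int (z + v * d) - eta tau om * (z + v * d).
Proof.
  intros Hu Hv Hoff.
  apply (rdiff_0_constant (fun v : R => zeta_int (z + v * d) - eta tau om * (z + v * d)) a b); [|easy|easy].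
  intros t Ht. eapply diff_eq.
  - apply diff_minus; [now apply (zeta_int_diff z d a b t)|].
    apply diff_scal. apply diff_plus; [apply diff_const|]. apply diff_mult; [apply diff_i|apply diff_const].
  - cbv beta. ring.
Qed.

Lemma zeta_line_ex z : line_off z -> (forall t : R, cont dR (fun s : R => om * zeta (z + om * s)) t).
Proof.
  intros H t. apply cont_mult; [apply cont_const|]. apply line_cont. apply zeta_cont; [easy|apply H].
Qed.

Lemma zeta_int_om' z : line_off z -> Re (zeta_int (z + om')) = Re (zeta_int z + om * eta tau om').
Proof.
  intros H. rewrite Re_plus. unfold zeta_int. rewrite !CInt_Re.
  assert (Ex : ex_RInt (fun s : R => Re (om * zeta (z + om * s))) 0 1).
  { apply (@ex_RInt_continuous R_CompleteNormedModule). intros t _.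
    apply (cont_dR_continuous_Re (fun s : R => om * zeta (z + om * s))). now apply zeta_line_ex. }
  rewrite (RInt_ext _ (fun s : R => plus (Re (om * zeta (z + om * s))) (Re (om * eta tau om')))).
  - rewrite (RInt_plus (fun s : R => Re (om * zeta (z + om * s))) (fun _ => Re (om * eta tau om')));
      [|exact Ex|apply ex_RInt_const].
    rewrite RInt_const. unfold plus, scal; simpl; unfold mult; simpl. f_equal. ring.
  - intros s _. replace (z + om' + om * s) with (z + om * s + om') by ring.
    rewrite zeta_period by easy.
    change (Re (om * (zeta (z + om * s) + eta tau om')) = (Re (om * zeta (z + om * s)%C) + Re (om * eta tau om'))%R).
    rewrite <- Re_plus. f_equal. ring.
Qed.

(** Within a strip between two rows of poles [zeta_int z - eta om * z] is constant;
    from one strip to the next its real part is preserved by [Heta]. *)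
Lemma zeta_int_reduced (x y : R) : ~ isZ y ->
  Re (zeta_int (x * om + y * om') - eta tau om * (x * om + y * om')) =
  Re (zeta_int (RtoC (1/2) * om') - eta tau om * (RtoC (1/2) * om')).
Proof.
  intros Hy.
  assert (Step : forall y : R, ~ isZ y -> Re (zeta_int (x * om + RtoC (y + 1) * om') - eta tau om * (x * om + RtoC (y + 1) * om'))
    = Re (zeta_int (x * om + y * om') - eta tau om * (x * om + y * om'))).
  { intros s Hs. replace (x * om + RtoC (s + 1) * om') with (x * om + s * om' + om') by (rewrite RtoC_plus; ring).
    rewrite Re_minus, zeta_int_om' by now apply off_iff. rewrite Re_plus.
    rewrite Re_minus in Heta.
    replace (eta tau om * (x * om + s * om' + om')) with (eta tau om * (x * om + s * om') + eta tau om * om') by ring.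
    rewrite !Re_minus, Re_plus. lra. }
  set (c := Re (zeta_int (RtoC (1/2) * om') - eta tau om * (RtoC (1/2) * om'))).
  set (Q := fun y : R => isZ y \/ Re (zeta_int (x * om + y * om') - eta tau om * (x * om + y * om')) = c).
  assert (HQ : forall t, Q t <-> Q (t + 1)%R).
  { intros t. unfold Q. assert (I : isZ t <-> isZ (t + 1)).
    { split; intros H.
      - apply isZ_plus; [easy|apply (isZ_IZR 1)].
      - replace t with (t + 1 + - (1))%R by ring. apply isZ_plus; [easy|]. apply isZ_opp, (isZ_IZR 1). }
    destruct (excluded_middle_informative (isZ t)) as [h|h].
    - split; intros _; left; tauto.
    - rewrite (Step t h). tauto. }
  assert (Base : forall y : R, (0 < y < 1)%R -> Re (zeta_int (x * om + y * om') - eta tau om * (x * om + y * om')) = c).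
  { intros s Hs. unfold c.
    rewrite (zeta_int_affine (x * om) om' 0 1 s (1/2)); [|lra|lra|].
    2:{ intros v Hv. apply off_iff. now apply not_isZ_open. }
    replace (x * om + RtoC (1/2) * om') with (RtoC (1/2) * om' + x * om) by ring.
    set (m := (Rabs x + 1)%R). assert (A := Rle_abs x). assert (B := Rle_abs (- x)). rewrite Rabs_Ropp in B.
    rewrite (zeta_int_affine (RtoC (1/2) * om') om (- m) m x 0); [|unfold m; lra|unfold m; generalize (Rabs_pos x); lra|].
    2:{ intros v Hv. replace (RtoC (1/2) * om' + v * om) with (v * om + RtoC (1/2) * om') by ring.
        apply off_iff. apply not_isZ_open. lra. }
    now replace (RtoC (1/2) * om' + 0 * om) with (RtoC (1/2) * om') by ring. }
  assert (Fin : Q y); [|destruct Fin; [easy|assumption]].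
  destruct (archimed y) as [A B]. apply (shift_Z Q HQ y (1 - up y)%Z).
  rewrite minus_IZR. unfold Q.
  destruct (Req_dec (y + (1 - IZR (up y))) 0) as [e|n]; [left; exists 0%Z; simpl; lra|].
  right. apply Base. destruct (Req_dec (y + (1 - IZR (up y))) 1) as [e|n2]; [|lra].
  exfalso. apply Hy. exists (up y). lra.
Qed.

Lemma zeta_int_Re z z' : line_off z -> line_off z' -> Re (zeta_int z - eta tau om * z) = Re (zeta_int z' - eta tau om * z').
Proof.
  destruct (Hcoord z) as [x [y ->]]. destruct (Hcoord z') as [x' [y' ->]]. rewrite !off_iff. intros H H'.
  now rewrite !zeta_int_reduced.
Qed.

(** * The Lame equation on a line *)

(** The derivative [dW] is taken with respect to the complex variable, whence the
    factors [om]. *)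
Definition lame z0 (lam : C) (W dW : R -> C) : Prop := forall t : R,
  rdiff W t (om * dW t) /\ rdiff dW t (om * ((2 * P (z0 + om * t) + lam) * W t)).

Definition lame_bdd z0 (lam : C) : Prop := exists W dW, lame z0 lam W dW /\ (exists t, W t <> 0) /\ bdd W.

(** The logarithmic derivative of [sigma (z - a) / sigma z * exp (zeta a z)]. *)
Definition ba_logder z0 a (t : R) : C := zeta (z0 + om * t - a) - zeta (z0 + om * t) + zeta a.

Section OneLine.
Variables z0 : C.
Hypothesis Hz0 : line_off z0.

Lemma wp_line_bdd : bdd (fun t => P (z0 + om * t)).
Proof.
  apply periodic_bdd.
  - intros t. apply line_cont, wp_cont; [easy|apply Hz0].
  - intros t. rewrite line_succ. apply wp_period; auto.
Qed.

Lemma lame_derivative_bdd lam W dW : lame z0 lam W dW -> bdd W -> bdd dW.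
Proof.
  intros H B.
  assert (D : bdd (fun t => om * dW t)).
  { apply (landau W (fun t => om * dW t) (fun t => om * (om * ((2 * P (z0 + om * t) + lam) * W t)))).
    - intros; apply H.
    - intros. apply diff_scal, H.
    - easy.
    - apply bdd_mult; [apply bdd_const|]. apply bdd_mult; [apply bdd_const|]. apply bdd_mult; [|easy].
      apply bdd_plus; [|apply bdd_const]. apply bdd_mult; [apply bdd_const|apply wp_line_bdd]. }
  apply bdd_ext with (fun t => / om * (om * dW t)); [intros; field; easy|].
  apply bdd_mult; [apply bdd_const|easy].
Qed.

Section Shifted.
Variable a : C.
Hypothesis Ha : nl a.
Hypothesis Hza : line_off (z0 - a).
Notation v := (ba_logder z0 a).

Lemma nl_shift (t : R) : nl (z0 + om * t - a).
Proof. replace (z0 + om * t - a) with (z0 - a + om * t) by ring. apply Hza. Qed.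

Lemma ba_logder_diff (t : R) : rdiff v t (om * (P (z0 + om * t) - P (z0 + om * t - a))).
Proof.
  assert (A := nl_shift t). eapply diff_eq.
  - apply (line_diff (fun z => zeta (z - a) - zeta z + zeta a)).
    apply diff_plus; [apply diff_minus|apply diff_const]; [now apply zeta_diff_minus|apply wzeta_diff; [easy|apply Hz0]].
  - ring.
Qed.

Lemma ba_logder_cont (t : R) : cont dR v t.
Proof. apply cont_dI_dR. eapply diff_cont, ba_logder_diff. Qed.

(** Together with [ba_logder_diff] this is the Riccati equation
    [v' + v ^ 2 = 2 wp z + wp a]. *)
Lemma ba_logder_sq (t : R) : v t * v t = P (z0 + om * t - a) + P (z0 + om * t) + P a.
Proof. apply squared_addition; auto. apply nl_shift. Qed.

Lemma ba_logder_period (t : R) : v (t + 1)%R = v t.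
Proof.
  unfold ba_logder. rewrite line_succ. replace (z0 + om * t + om - a) with (z0 + om * t - a + om) by ring.
  rewrite !zeta_period by easy. ring.
Qed.

Lemma ba_logder_bdd : bdd v.
Proof. apply periodic_bdd; [apply ba_logder_cont|apply ba_logder_period]. Qed.

(** Darboux transformation [u = w' - v w] with the logarithmic derivative [v] of the
    solution at the energy [wp a]: the new potential [2 wp z - 2 v'] is
    [2 wp (z - a)].  From [u' + v u = (lam - wp a) w] one sees that [u] vanishes
    identically only if [w] does. *)
Lemma darboux_shift lam : P a <> lam -> lame_bdd z0 lam -> lame_bdd (z0 - a) lam.
Proof.
  intros Hl [W [dW [H [[t0 Hn] B]]]].
  set (u := fun t => dW t - v t * W t). set (du := fun t => (lam - P a) * W t - v t * u t).
  assert (Du : forall t, rdiff u t (om * du t)).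
  { intros t. eapply diff_eq.
    - apply diff_minus; [apply H|]. apply diff_mult; [apply ba_logder_diff|apply H].
    - unfold du, u. assert (S := ba_logder_sq t).
      replace (om * ((lam - P a) * W t - v t * (dW t - v t * W t))) with
        (om * ((lam - P a + v t * v t) * W t - v t * dW t)) by ring.
      rewrite S. ring. }
  assert (Ddu : forall t, rdiff du t (om * ((2 * P (z0 - a + om * t) + lam) * u t))).
  { intros t. eapply diff_eq.
    - apply diff_minus; [apply diff_scal, H|]. apply diff_mult; [apply ba_logder_diff|apply Du].
    - replace (z0 - a + om * t) with (z0 + om * t - a) by ring. assert (S := ba_logder_sq t). unfold du.
      replace (dW t) with (u t + v t * W t) by (unfold u; ring).
      replace (om * ((2 * P (z0 + om * t - a) + lam) * u t)) with
        (om * ((lam - P a + (P (z0 + om * t - a) + P (z0 + om * t) + P a) + P (z0 + om * t - a) - P (z0 + om * t)) * u t)) by ring.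
      rewrite <- S. ring. }
  exists u, du. split; [intros t; split; auto|]. split.
  - destruct (excluded_middle_informative (exists t, u t <> 0)) as [e|ne]; [easy|exfalso].
    assert (U0 : forall t, u t = 0).
    { intros t. destruct (excluded_middle_informative (u t = 0)) as [e|n]; [easy|]. exfalso. eauto. }
    assert (D0 : om * du t0 = 0).
    { apply (rdiff_unique u t0); [apply Du|]. apply diff_ext with (fun _ => RtoC 0); [intros; now rewrite U0|apply diff_const]. }
    unfold du in D0. rewrite U0 in D0.
    assert (N : om * ((lam - P a) * W t0) <> 0).
    { apply Cmult_neq_0; [easy|]. apply Cmult_neq_0; [|easy]. now apply Csub_neq, not_eq_sym. }
    apply N. rewrite <- D0. ring.
  - apply bdd_minus; [now apply (lame_derivative_bdd lam W dW)|]. apply bdd_mult; [apply ba_logder_bdd|easy].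
Qed.

Lemma floquet_solution : exists W, lame z0 (P a) W (fun t => v t * W t) /\ (forall t, W t <> 0) /\
  W 0%R = 1 /\ (forall t, W (t + 1)%R = W 1%R * W t) /\ Cmod (W 1%R) = exp (Re (expo a)).
Proof.
  destruct (exp_primitive (fun t => om * v t)) as [W [W0 [Wn [Wd Wm]]]].
  { intros t. apply cont_mult; [apply cont_const|apply ba_logder_cont]. }
  exists W. split; [|split; [easy|split; [easy|split]]].
  - intros t. split; [eapply diff_eq; [apply Wd|ring]|]. eapply diff_eq.
    + apply diff_mult; [apply ba_logder_diff|apply Wd].
    + assert (S := ba_logder_sq t).
      replace (om * ((2 * P (z0 + om * t) + P a) * W t)) with
        (om * ((P (z0 + om * t) - P (z0 + om * t - a)) + (P (z0 + om * t - a) + P (z0 + om * t) + P a)) * W t) by ring.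
      rewrite <- S. ring.
  - intros t.
    set (h := fun s : R => W (s + 1)%R / W s).
    assert (E : forall s, h s = h 0%R).
    { intros s. apply (rdiff_0_eq h). intros r. unfold h. eapply diff_eq.
      - apply diff_div; [easy| |apply Wd].
        apply (diff_ext RtoC (fun r => W (r + 1)%R)) with (l := (om * v (r + 1)%R * W (r + 1)%R)); [easy|].
        destruct (Wd (r + 1)%R) as [phi [C1 [C2 C3]]]. exists (fun s => phi (s + 1)%R). split; [|split].
        + intros eps He. destruct (C1 eps He) as [del [Hd F]]. exists del; split; [easy|].
          intros y Hy. apply F. rewrite dI_dR in *. unfold dR in *. now replace (y + 1 - (r + 1))%R with (y - r)%R by ring.
        + exact C2.
        + intros y. rewrite (C3 (y + 1)%R). rewrite !RtoC_plus. ring.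
      - rewrite ba_logder_period. field. apply Wn. }
    specialize (E t). unfold h in E. rewrite W0, Rplus_0_l in E.
    replace (W (t + 1)%R) with (W (t + 1)%R / W t * W t) by (field; apply Wn). rewrite E. field.
  - rewrite Wm. f_equal.
    assert (E : RInt (fun s => Re (om * v s)) 0 1 = (Re (zeta_int (z0 - a)) - Re (zeta_int z0) + Re (om * zeta a))%R).
    { unfold zeta_int. rewrite !CInt_Re.
      assert (ExA : ex_RInt (fun s : R => Re (om * zeta (z0 - a + om * s))) 0 1).
      { apply (@ex_RInt_continuous R_CompleteNormedModule). intros t _.
        apply (cont_dR_continuous_Re (fun s : R => om * zeta (z0 - a + om * s))). now apply zeta_line_ex. }
      assert (ExB : ex_RInt (fun s : R => Re (om * zeta (z0 + om * s))) 0 1).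
      { apply (@ex_RInt_continuous R_CompleteNormedModule). intros t _.
        apply (cont_dR_continuous_Re (fun s : R => om * zeta (z0 + om * s))). now apply zeta_line_ex. }
      rewrite (RInt_ext _ (fun s : R => plus (minus (Re (om * zeta (z0 - a + om * s))) (Re (om * zeta (z0 + om * s)))) (Re (om * zeta a)))).
      - rewrite (RInt_plus (fun s : R => minus (Re (om * zeta (z0 - a + om * s))) (Re (om * zeta (z0 + om * s)))) (fun _ => Re (om * zeta a)));
          [|now apply @ex_RInt_minus|apply ex_RInt_const].
        rewrite (RInt_minus (fun s : R => Re (om * zeta (z0 - a + om * s))) (fun s : R => Re (om * zeta (z0 + om * s))));
          [|exact ExA|exact ExB].
        rewrite RInt_const. unfold minus, plus, opp, scal; simpl; unfold mult; simpl. ring.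
      - intros s _. replace (z0 - a + om * s) with (z0 + om * s - a) by ring. unfold ba_logder.
        change (Re (om * (zeta (z0 + om * s - a) - zeta (z0 + om * s) + zeta a)) =
          (Re (om * zeta (z0 + om * s - a)%C) + - Re (om * zeta (z0 + om * s)%C) + Re (om * zeta a))%R).
        rewrite <- Re_opp, <- !Re_plus. f_equal. ring. }
    rewrite E. assert (Q := zeta_int_Re _ _ Hza Hz0). rewrite !Re_minus in Q.
    unfold floquet_exponent. rewrite Re_minus.
    replace (eta tau om * (z0 - a)) with (eta tau om * z0 - eta tau om * a) in Q by ring. rewrite Re_minus in Q. lra.
Qed.

(** The solution [W] of [floquet_solution] is bounded if its multiplier has modulus
    1.  Otherwise it tends to 0 in one direction; there its Wronskian with a
    bounded solution tends to 0, so the Wronskian is 0 and the two solutions are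
    proportional.  But [W] is unbounded in the other direction. *)
Lemma lame_bdd_iff_aux : lame_bdd z0 (P a) <-> Re (expo a) = 0%R.
Proof.
  destruct floquet_solution as [W [HW [Wn [W0 [Wp Wm]]]]].
  set (mu := W 1%R) in *. assert (Mun : mu <> 0) by apply Wn.
  assert (Cw : forall t, cont dR W t) by (intros t; apply cont_dI_dR; eapply diff_cont, HW).
  split.
  - intros [Y [dY [HY [[t0 Yn] BY]]]].
    destruct (Req_dec (Re (expo a)) 0) as [e|ne]; [easy|exfalso].
    assert (BdY := lame_derivative_bdd _ _ _ HY BY).
    (* the values of W at the integers are the powers of the multiplier *)
    assert (Pn : forall n, W (INR n) = mu ^ n).
    { induction n as [|n IH]; [easy|]. rewrite S_INR, Wp, IH. now rewrite Cpow_S. }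
    assert (Pm : forall n, W (- INR n)%R = / mu ^ n).
    { induction n as [|n IH]; [simpl; rewrite Ropp_0, W0; field; intros X; apply RtoC_inj in X; lra|].
      assert (E := Wp (- INR (S n))%R). replace (- INR (S n) + 1)%R with (- INR n)%R in E by (rewrite S_INR; ring).
      rewrite IH in E. rewrite Cpow_S.
      replace (W (- INR (S n))%R) with (/ mu * (mu * W (- INR (S n))%R)) by (field; easy). rewrite <- E.
      field. split; [now apply Cpow_nz|easy]. }
    (* s runs towards the end where W decays, s' towards the other one *)
    assert (Dec : exists (q : R) (s : nat -> R) (s' : nat -> R), (0 < q < 1)%R /\ (forall n, Cmod (W (s n)) = q ^ n)%R /\ (forall n, (q ^ n * Cmod (W (s' n)) = 1)%R)).
    { assert (Pmu : (0 < Cmod mu)%R) by now apply Cmod_gt_0.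
      destruct (Rlt_le_dec (Re (expo a)) 0) as [h|h].
      - exists (Cmod mu), INR, (fun n => (- INR n)%R). split; [|split].
        + split; [easy|]. rewrite Wm, <- exp_0. now apply exp_increasing.
        + intros n. now rewrite Pn, Cmod_pow.
        + intros n. rewrite Pm, Cmod_inv, Cmod_pow by now apply Cpow_nz. apply Rinv_r, pow_nonzero. lra.
      - assert (L : (1 < Cmod mu)%R) by (rewrite Wm, <- exp_0; apply exp_increasing; lra).
        exists (/ Cmod mu)%R, (fun n => (- INR n)%R), INR. split; [|split].
        + split; [now apply Rinv_0_lt_compat|]. rewrite <- Rinv_1. apply Rinv_lt_contravar; lra.
        + intros n. rewrite Pm, Cmod_inv, Cmod_pow, pow_inv by now apply Cpow_nz. easy.
        + intros n. rewrite Pn, Cmod_pow, pow_inv. apply Rinv_l, pow_nonzero. lra. }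
    destruct Dec as [q [s [s' [Hq [Ws Ws']]]]].
    (* the Wronskian of Y and W *)
    set (wr := fun t => Y t * (v t * W t) - dY t * W t).
    assert (Wr : forall t, rdiff wr t 0).
    { intros t. destruct (HW t) as [A1 A2]. destruct (HY t) as [B1 B2]. eapply diff_eq.
      - apply diff_minus; apply diff_mult; [exact B1|exact A2|exact B2|exact A1].
      - cbv beta. ring. }
    destruct ba_logder_bdd as [Mv Hv]. destruct BY as [MY HBY]. destruct BdY as [MdY HBdY].
    assert (Wr0 : forall t, wr t = 0).
    { intros t. apply Cmod_eq_0. apply Rle_antisym; [|apply Cmod_ge_0]. apply le_epsilon. intros eps He. rewrite Rplus_0_l.
      destruct (pow_small q (MY * Mv + MdY) Hq eps He) as [n Hn]. apply Rlt_le. eapply Rle_lt_trans; [|exact Hn].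
      rewrite (rdiff_0_eq wr Wr t (s n)). unfold wr.
      replace (Y (s n) * (v (s n) * W (s n)) - dY (s n) * W (s n)) with ((Y (s n) * v (s n) - dY (s n)) * W (s n)) by ring.
      rewrite Cmod_mult, Ws. apply Rmult_le_compat_r; [apply pow_le; lra|].
      eapply Rle_trans; [apply Cmod_triangle|]. rewrite Cmod_opp, Cmod_mult. apply Rplus_le_compat; [|apply HBdY].
      apply Rmult_le_compat; auto using Cmod_ge_0. }
    set (h := fun t : R => Y t / W t).
    assert (Prop' : forall t, h t = h t0).
    { intros t. apply (rdiff_0_eq h). intros r. unfold h. destruct (HW r) as [A1 A2]. destruct (HY r) as [B1 B2]. eapply diff_eq.
      - apply diff_div; [apply Wn|exact B1|exact A1].
      - replace (om * dY r * W r - Y r * (om * (v r * W r))) with (- om * wr r) by (unfold wr; ring).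
        rewrite Wr0. unfold Cdiv. ring. }
    set (c := Y t0 / W t0).
    assert (Pc : (0 < Cmod c)%R).
    { apply Cmod_gt_0. unfold c, Cdiv. apply Cmult_neq_0; [easy|]. intros X.
      assert (Z : W t0 * / W t0 = 1) by (field; apply Wn). rewrite X in Z. apply (f_equal Re) in Z. simpl in Z. lra. }
    destruct (pow_small q MY Hq _ Pc) as [n Hn].
    assert (E : Y (s' n) = c * W (s' n)).
    { change c with (h t0). rewrite <- (Prop' (s' n)). unfold h. field. apply Wn. }
    assert (X := HBY (s' n)). rewrite E, Cmod_mult in X. specialize (Ws' n).
    assert (0 < q ^ n)%R by (apply pow_lt; lra). nra.
  - intros H. exists W, (fun t => v t * W t). split; [easy|]. split; [now exists 0%R|].
    apply Cmod_periodic_bdd; [easy|]. intros t. rewrite Wp, Cmod_mult, Wm, H, exp_0. ring.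
Qed.
End Shifted.
End OneLine.

Lemma exponent_opp a : Re (expo (- a)) = (- Re (expo a))%R.
Proof.
  unfold floquet_exponent. rewrite wzeta_opp by easy. rewrite <- Re_opp. f_equal. ring.
Qed.

(** Since [wp (- a) = wp a], the solution of [a] or that of [- a] can be used.  Both
    have zeros on the line only if [z0] and [a] lie half a period off the axis;
    then a Darboux transformation moves the line by a quarter period. *)
Theorem lame_bdd_iff z0 a : line_off z0 -> nl a -> lame_bdd z0 (P a) <-> Re (expo a) = 0%R.
Proof.
  intros Hz Ha. destruct (Hcoord z0) as [x0 [y0 E0]]. destruct (Hcoord a) as [xa [ya Ea]].
  assert (Off : forall z (y : R), (exists x : R, z = x * om + y * om') -> ~ isZ y -> line_off z).
  { intros z y [x ->] H. now apply off_iff. }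
  assert (Ny0 : ~ isZ y0) by (rewrite E0 in Hz; now apply off_iff in Hz).
  destruct (excluded_middle_informative (isZ (y0 - ya))) as [h1|h1].
  2:{ apply lame_bdd_iff_aux; auto. apply Off with (y0 - ya)%R; [|easy].
      exists (x0 - xa)%R. rewrite E0, Ea, !RtoC_minus. ring. }
  destruct (excluded_middle_informative (isZ (y0 + ya))) as [h2|h2].
  2:{ rewrite <- (wp_opp tau Htau a). rewrite (lame_bdd_iff_aux z0 Hz (- a)).
      - rewrite exponent_opp. split; intros; lra.
      - now apply nl_opp.
      - apply Off with (y0 + ya)%R; [|easy]. exists (x0 + xa)%R. rewrite E0, Ea, !RtoC_plus. ring. }
  set (b := RtoC (1/4) * om').
  assert (Q4 : ~ isZ (1/4)) by (apply not_isZ_open; lra).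
  assert (Q2 : ~ isZ (1/2)) by (apply not_isZ_open; lra).
  assert (Y2 : isZ (2 * y0)). { replace (2 * y0)%R with ((y0 - ya) + (y0 + ya))%R by ring. now apply isZ_plus. }
  assert (A2 : isZ (2 * ya)). { replace (2 * ya)%R with ((y0 + ya) + - (y0 - ya))%R by ring. apply isZ_plus; [easy|now apply isZ_opp]. }
  assert (Nb : nl b).
  { replace b with (0 * om + RtoC (1/4) * om') by (unfold b; ring).
    destruct (excluded_middle_informative (nl (0 * om + RtoC (1/4) * om'))) as [h|h]; [easy|]. apply Hnl in h. tauto. }
  assert (Hzb : line_off (z0 - b)).
  { apply Off with (y0 - 1/4)%R; [exists x0; rewrite E0; unfold b; rewrite RtoC_minus; ring|].
    intros Z. apply Q2. replace (1/2)%R with (2 * y0 + - ((y0 - 1/4) + (y0 - 1/4)))%R by field.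
    apply isZ_plus; [easy|]. apply isZ_opp. now apply isZ_plus. }
  assert (Hzba : line_off (z0 - b - a)).
  { apply Off with (y0 - 1/4 - ya)%R; [exists (x0 - xa)%R; rewrite E0, Ea; unfold b; rewrite !RtoC_minus; ring|].
    intros Z. apply Q4. replace (1/4)%R with ((y0 - ya) + - (y0 - 1/4 - ya))%R by field.
    apply isZ_plus; [easy|]. now apply isZ_opp. }
  assert (Pb : P b <> P a).
  { intros E. destruct (wp_injective tau Htau b a Nb Ha E) as [N|N].
    - assert (Z : isZ (1/4 - ya)).
      { apply (Hnl (0 - xa) (1/4 - ya)). replace (RtoC (0 - xa) * om + RtoC (1/4 - ya) * om') with (b - a); [easy|].
        rewrite Ea. unfold b. rewrite !RtoC_minus. ring. }
      apply Q2. replace (1/2)%R with ((1/4 - ya) + (1/4 - ya) + 2 * ya)%R by field. auto using isZ_plus.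
    - assert (Z : isZ (1/4 + ya)).
      { apply (Hnl (0 + xa) (1/4 + ya)). replace (RtoC (0 + xa) * om + RtoC (1/4 + ya) * om') with (b + a); [easy|].
        rewrite Ea. unfold b. rewrite !RtoC_plus. ring. }
      apply Q2. replace (1/2)%R with ((1/4 + ya) + (1/4 + ya) + - (2 * ya))%R by field. auto using isZ_plus, isZ_opp. }
  rewrite <- (lame_bdd_iff_aux (z0 - b) Hzb a Ha Hzba). split.
  - now apply darboux_shift.
  - intros H. replace z0 with (z0 - b - - b) by ring. apply darboux_shift; auto.
    + now apply nl_opp.
    + now replace (z0 - b - - b) with z0 by ring.
    + now rewrite wp_opp.
Qed.
End Floquet.

(** * The potential *)

Lemma line_derive_rdiff w (f : C -> C) (t : R) l :
  is_line_derive w f (w * t) l <-> rdiff (fun s : R => f (w * s)) t (w * l).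
Proof.
  unfold is_line_derive. rewrite is_derive_C_rdiff. split; intros H.
  - destruct H as [phi [C1 [C2 C3]]]. exists (fun s => phi (s - t)%R). split; [|split].
    + intros eps He. replace (t - t)%R with 0%R by ring. destruct (C1 eps He) as [del [Hd F]]. exists del. split; [easy|].
      intros s Hs. apply F. rewrite dI_dR in *. unfold dR in *. now replace (s - t - 0)%R with (s - t)%R by ring.
    + rewrite <- C2. f_equal. ring.
    + intros s. specialize (C3 (s - t)%R). cbv beta in C3.
      replace (w * t + w * RtoC (s - t)) with (w * s) in C3 by (rewrite RtoC_minus; ring).
      replace (w * t + w * 0) with (w * t) in C3 by ring. rewrite C3, RtoC_minus. ring.
  - destruct H as [phi [C1 [C2 C3]]]. exists (fun s => phi (t + s)%R). split; [|split].
    + intros eps He. rewrite Rplus_0_r. destruct (C1 eps He) as [del [Hd F]]. exists del. split; [easy|].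
      intros s Hs. apply F. rewrite dI_dR in *. unfold dR in *. now replace (t + s - t)%R with (s - 0)%R by ring.
    + now rewrite Rplus_0_r.
    + intros s. specialize (C3 (t + s)%R). cbv beta in C3.
      replace (w * t + w * s) with (w * RtoC (t + s)) by (rewrite RtoC_plus; ring).
      replace (w * t + w * 0) with (w * t) by ring. rewrite C3, RtoC_plus. ring.
Qed.

Lemma spectral_set_param (om tau p z0 T : C) : om <> 0 ->
  spectral_set om tau p z0 T <-> exists Y dY : R -> C,
    (forall t : R, rdiff Y t (om * dY t) /\ rdiff dY t (om * (q tau p T (z0 + om * t) * Y t))) /\
    (exists t, Y t <> 0) /\ bdd Y.
Proof.
  intros H0. split.
  - intros [y [[dy Hy] [[x [[t0 Hx] Hn]] [M HM]]]].
    exists (fun t => y (om * t)), (fun t => dy (om * t)). split; [|split].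
    + intros t. destruct (Hy (om * t)) as [A B]; [now exists t|]. apply line_derive_rdiff in A, B.
      split; [exact A|]. rewrite Cplus_comm. exact B.
    + exists t0. now rewrite <- Hx.
    + exists M. intros t. apply HM. now exists t.
  - intros [Y [dY [HY [[t Hn] [M HM]]]]].
    assert (E : forall t : R, Re (om * t / om) = t).
    { intros s. replace (om * s / om) with (RtoC s) by (field; easy). easy. }
    exists (fun x => Y (Re (x / om))). split; [|split].
    + exists (fun x => dY (Re (x / om))). intros x [s ->]. destruct (HY s) as [A B]. split; apply line_derive_rdiff.
      * rewrite E. apply (diff_ext RtoC Y); [|exact A]. intros r. now rewrite E.
      * rewrite E, Cplus_comm. apply (diff_ext RtoC dY); [|exact B]. intros r. now rewrite E.
    + exists (om * t). split; [now exists t|]. now rewrite E.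
    + exists M. intros x _. apply HM.
Qed.

Section Potential.
Variables tau p : C.
Hypothesis Htau : Re tau = 0%R /\ (0 < Im tau)%R.
Hypothesis Hp : forall k : nat, (k <= 3)%nat -> ~ in_lattice tau (p - omega tau k / 2).
Notation lp := (lattice_point tau).
Notation zeta := (wzeta tau).
Notation P := (wp tau).
Notation nl := (off_lattice tau).
Notation W1 := (wp_d1 tau).
Notation W2 := (wp_d2 tau).

Lemma p_nl : nl p.
Proof.
  intros m n E. apply (Hp 0%nat); [lia|]. exists m, n. rewrite E. unfold omega. field.
Qed.

(** Half of a lattice point is congruent to one of the [omega k / 2]. *)
Lemma two_p_nl : nl (p + p).
Proof.
  intros m n E.
  assert (Par : forall k : Z, exists j : Z, k = (2 * j)%Z \/ k = (2 * j + 1)%Z).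
  { intros k. exists (k / 2)%Z. assert (B := Z.mod_pos_bound k 2 ltac:(lia)). assert (F := Z.div_mod k 2 ltac:(lia)). lia. }
  assert (Ep : p = lp m n / 2) by (rewrite E; field).
  destruct (Par m) as [m' Hm]. destruct (Par n) as [n' Hn].
  destruct Hm as [-> | ->], Hn as [-> | ->].
  - apply (Hp 0%nat); [lia|]. exists m', n'. rewrite Ep. unfold lattice_point, omega. rewrite !mult_IZR, !RtoC_mult. field.
  - apply (Hp 2%nat); [lia|]. exists m', n'. rewrite Ep. unfold lattice_point, omega. rewrite ?plus_IZR, !mult_IZR, ?RtoC_plus, !RtoC_mult. field.
  - apply (Hp 1%nat); [lia|]. exists m', n'. rewrite Ep. unfold lattice_point, omega. rewrite ?plus_IZR, !mult_IZR, ?RtoC_plus, !RtoC_mult. field.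
  - apply (Hp 3%nat); [lia|]. exists m', n'. rewrite Ep. unfold lattice_point, omega. rewrite ?plus_IZR, !mult_IZR, ?RtoC_plus, !RtoC_mult. field.
Qed.

(** Otherwise [p] and [- p] would have the same value and the same derivative, so
    that [2 p] would be a period. *)
Lemma wp_d1_p_neq0 : W1 p <> 0.
Proof.
  intros E. apply (wp_unique tau Htau p (- p) p_nl (nl_opp tau _ p_nl)).
  - now rewrite wp_opp.
  - rewrite wp_d1_opp, E by easy. ring.
  - replace (p - - p) with (p + p) by ring. apply two_p_nl.
Qed.

Definition off_poles z : Prop := nl z /\ nl (z + p) /\ nl (z - p).

Definition wp_gap z := P z - P p.

Lemma wp_gap_neq0 z : off_poles z -> wp_gap z <> 0.
Proof.
  intros [H1 [H2 H3]] E. destruct (wp_injective tau Htau z p H1 p_nl) as [N|N]; [|easy|easy].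
  unfold wp_gap in E. replace (P z) with (P z - P p + P p) by ring. rewrite E. ring.
Qed.

(** The right-hand side is the potential which the gauge transformation makes out of
    [2 wp + T ^ 2 - 2 wp p].  The zeta differences in [q] are
    [wp' z / D] and [2 zeta p - wp' p / D] by the addition theorem, and the squared
    addition theorem gives [wp (z + p) + wp (z - p)]; [wp' p] is then eliminated
    by [relation] and [wp'' p] by [wp_ode]. *)
Lemma q_formula z T : off_poles z ->
  q tau p T z = 2 * wp_gap z + T ^ 2 + T * W1 z / wp_gap z - W2 z / (2 * wp_gap z) + 3 / 4 * (W1 z / wp_gap z) ^ 2.
Proof.
  intros G. assert (Dn := wp_gap_neq0 z G). destruct G as [H1 [H2 H3]]. assert (Hpn := p_nl). assert (W1n := wp_d1_p_neq0).
  unfold wp_gap in *.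
  assert (Np : nl (p - z)). { replace (p - z) with (- (z - p)) by ring. now apply nl_opp. }
  assert (S1 := addition_sym tau Htau z p H1 Hpn H2 H3).
  assert (S2 := addition_sym tau Htau p z Hpn H1).
  rewrite (Cplus_comm p z) in S2. specialize (S2 H2 Np).
  replace (p - z) with (- (z - p)) in S2 by ring. rewrite wzeta_opp in S2 by easy.
  assert (A := squared_addition tau Htau (z + p) (z) ).
  assert (A1 := addition tau Htau z p H1 Hpn H2).
  assert (A2 := addition tau Htau z (- p) H1 (nl_opp tau _ Hpn)).
  rewrite wzeta_opp, wp_opp, wp_d1_opp in A2 by easy. replace (z + - p) with (z - p) in A2 by ring. specialize (A2 H3).
  assert (B1 := squared_addition tau Htau z (- p)).
  assert (SQ : forall b, nl b -> nl (z + b) -> (zeta (z + b) - zeta z - zeta b) * (zeta (z + b) - zeta z - zeta b) = P (z + b) + P z + P b).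
  { intros b Hb Hzb. assert (Q := squared_addition tau Htau z (- b) (nl_opp tau _ Hb) H1).
    replace (z - - b) with (z + b) in Q by ring. rewrite wzeta_opp, wp_opp in Q by easy. rewrite <- Q by easy. ring. }
  assert (Q1 := SQ p Hpn H2). assert (Q2 := SQ (- p) (nl_opp tau _ Hpn)).
  replace (z + - p) with (z - p) in Q2 by ring. rewrite wzeta_opp, wp_opp in Q2 by easy. specialize (Q2 H3).
  assert (Rl := relation tau Htau z p H1 Hpn H3).
  destruct (wp_ode tau Htau) as [b Hode]. assert (O1 := Hode z H1). assert (O2 := Hode p Hpn).
  clear A B1 SQ Hode.
  set (x := P z) in *. set (y := P p) in *. set (x1 := W1 z) in *. set (y1 := W1 p) in *.
  set (zp := zeta (z + p)) in *. set (zm := zeta (z - p)) in *. set (zz := zeta z) in *. set (zzp := zeta p) in *.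
  assert (E1 : zp + zm - 2 * zz = x1 / (x - y)) by (rewrite <- S1; field; easy).
  assert (Dn' : y - x <> 0). { intros E. apply Dn. replace (x - y) with (- (y - x)) by ring. rewrite E. ring. }
  assert (E2 : zp - zm = 2 * zzp - y1 / (x - y)).
  { rewrite <- S2. field. easy. }
  assert (F1 : zp - zz - zzp = (x1 - y1) / (2 * (x - y))) by (rewrite <- A1; field; easy).
  assert (F2 : zm - zz - - zzp = (x1 + y1) / (2 * (x - y))).
  { replace (x1 + y1) with (x1 - - y1) by ring. rewrite <- A2. field. easy. }
  rewrite F1 in Q1. rewrite F2 in Q2.
  assert (G1 : P (z + p) = (x1 - y1) / (2 * (x - y)) * ((x1 - y1) / (2 * (x - y))) - x - y) by (rewrite Q1; ring).
  assert (G2 : P (z - p) = (x1 + y1) / (2 * (x - y)) * ((x1 + y1) / (2 * (x - y))) - x - y) by (rewrite Q2; ring).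
  assert (Y : y1 * y1 = 2 * (x - y) ^ 3 + x1 ^ 2 - (W2 z + W2 p) * (x - y)).
  { rewrite <- Rl. ring. }
  assert (O3 : W2 p = W2 z - 6 * (x - y) * (x + y)) by (rewrite O1, O2; ring).
  unfold q, Bconst. rewrite wp'_closed, wp''_closed by easy. fold x y y1 zp zm zz zzp.
  rewrite E1, E2, G1, G2.
  assert (G12 : (x1 - y1) / (2 * (x - y)) * ((x1 - y1) / (2 * (x - y))) - x - y + ((x1 + y1) / (2 * (x - y)) * ((x1 + y1) / (2 * (x - y))) - x - y)
    = (x1 ^ 2 + y1 * y1) / (2 * (x - y) ^ 2) - 2 * x - 2 * y) by (field; easy).
  rewrite G12, Y, O3. field. split; easy.
Qed.

Lemma wp_d2_period (om z : C) : is_period tau om -> nl z -> W2 (z + om) = W2 z.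
Proof.
  intros Hom. apply (deriv_period tau Htau W1 W2 om Hom); intros; [now apply wp_d1_diff|now apply wp_d1_period].
Qed.

(** * Gauge transformation along a line *)

Section Line.
Variables om z0 T : C.
Hypothesis Hom : is_period tau om.
Hypothesis Hom0 : om <> 0.
Hypothesis Hgood : forall t : R, off_poles (z0 + om * t).
Notation L t := (z0 + om * RtoC t).
Let lam := T ^ 2 - 2 * P p.

Lemma line_off_z0 : line_off tau om z0.
Proof. intros t. apply Hgood. Qed.

Lemma gap_line_neq0 (t : R) : wp_gap (L t) <> 0.
Proof. apply wp_gap_neq0, Hgood. Qed.

Lemma wp_line_diff (t : R) : rdiff (fun s : R => P (L s)) t (om * W1 (L t)).
Proof. apply line_diff, wp_diff; [easy|apply Hgood]. Qed.
Lemma gap_line_diff (t : R) : rdiff (fun s : R => wp_gap (L s)) t (om * W1 (L t)).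
Proof.
  eapply diff_eq; [apply diff_minus; [apply wp_line_diff|apply diff_const]|]. ring.
Qed.
Lemma wp_d1_line_diff (t : R) : rdiff (fun s : R => W1 (L s)) t (om * W2 (L t)).
Proof. apply line_diff, wp_d1_diff; [easy|apply Hgood]. Qed.

Lemma rdiff_cont (f : R -> C) t l : rdiff f t l -> cont dR f t.
Proof. intros H. apply cont_dI_dR. eapply diff_cont, H. Qed.

Lemma gap_line_period (t : R) : wp_gap (L (t + 1)) = wp_gap (L t).
Proof. unfold wp_gap. rewrite line_succ, wp_period; auto. apply Hgood. Qed.
Lemma wp_d1_line_period (t : R) : W1 (L (t + 1)) = W1 (L t).
Proof. rewrite line_succ, wp_d1_period; auto. apply Hgood. Qed.
Lemma wp_d2_line_period (t : R) : W2 (L (t + 1)) = W2 (L t).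
Proof. rewrite line_succ, wp_d2_period; auto. apply Hgood. Qed.

Lemma gap_line_bdd : bdd (fun t => wp_gap (L t)).
Proof. apply periodic_bdd; [intros; eapply rdiff_cont, gap_line_diff|apply gap_line_period]. Qed.
Lemma gap_line_inv_bdd : bdd (fun t => / wp_gap (L t)).
Proof.
  apply periodic_bdd; [|intros; now rewrite gap_line_period].
  intros t. apply cont_inv; [apply gap_line_neq0|eapply rdiff_cont, gap_line_diff].
Qed.
Lemma wp_d1_line_bdd : bdd (fun t => W1 (L t)).
Proof. apply periodic_bdd; [intros; eapply rdiff_cont, wp_d1_line_diff|apply wp_d1_line_period]. Qed.
Lemma wp_d2_line_bdd : bdd (fun t => W2 (L t)).
Proof.
  apply periodic_bdd; [|apply wp_d2_line_period]. intros t. apply line_cont, wp_d2_cont; [easy|apply Hgood].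
Qed.

(** A square root of [wp_gap] along the line, up to a constant factor: the
    exponential of the primitive of half the logarithmic derivative. *)
Lemma sqrt_branch : exists s : R -> C, (forall t, s t <> 0) /\
  (forall t, rdiff s t (om * (W1 (L t) / (2 * wp_gap (L t)) * s t))) /\ bdd s /\ bdd (fun t => / s t).
Proof.
  destruct (exp_primitive (fun t => om * (W1 (L t) / (2 * wp_gap (L t))))) as [s [s0 [sn [sd _]]]].
  { intros t. apply cont_mult; [apply cont_const|]. apply cont_div.
    - apply Cmult_neq_0; [intros X; apply RtoC_inj in X; lra|apply gap_line_neq0].
    - eapply rdiff_cont, wp_d1_line_diff.
    - apply cont_mult; [apply cont_const|eapply rdiff_cont, gap_line_diff]. }
  set (h := fun t : R => s t * s t / wp_gap (L t)).
  assert (E : forall t, h t = h 0%R).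
  { intros t. apply (rdiff_0_eq h). intros r. assert (Dn := gap_line_neq0 r). eapply diff_eq.
    - apply diff_div; [easy|apply diff_mult; apply sd|apply gap_line_diff].
    - cbv beta. field. easy. }
  assert (h0 : h 0%R = / wp_gap (L 0)) by (unfold h; rewrite s0; unfold Cdiv; ring).
  assert (S2 : forall t, s t * s t = wp_gap (L t) * / wp_gap (L 0)).
  { intros t. rewrite <- h0, <- (E t). unfold h. field. apply gap_line_neq0. }
  assert (Sq : forall (f : R -> C), bdd (fun t => f t * f t) -> bdd f).
  { intros f [M HM]. exists (M + 1)%R. intros t. specialize (HM t). rewrite Cmod_mult in HM.
    assert (Q := Cmod_ge_0 (f t)). nra. }
  exists s. split; [easy|split; [|split]].
  - intros t. eapply diff_eq; [apply sd|ring].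
  - apply Sq. apply bdd_ext with (fun t => wp_gap (L t) * / wp_gap (L 0)); [intros; now rewrite S2|].
    apply bdd_mult; [apply gap_line_bdd|apply bdd_const].
  - apply Sq. apply bdd_ext with (fun t => / wp_gap (L t) * wp_gap (L 0)).
    + intros t. assert (A := gap_line_neq0 t). assert (B := gap_line_neq0 0). assert (C := sn t).
      replace (/ s t * / s t) with (/ (s t * s t)) by (field; easy). rewrite S2. field. split; easy.
    + apply bdd_mult; [apply gap_line_inv_bdd|apply bdd_const].
Qed.

Lemma q_line_bdd : bdd (fun t => q tau p T (L t)).
Proof.
  apply bdd_ext with (fun t => 2 * wp_gap (L t) + T ^ 2 + T * (W1 (L t) * / wp_gap (L t)) - / 2 * (W2 (L t) * / wp_gap (L t))
     + 3 / 4 * ((W1 (L t) * / wp_gap (L t)) * (W1 (L t) * / wp_gap (L t)))).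
  - intros t. rewrite q_formula by apply Hgood. field. apply gap_line_neq0.
  - assert (A := gap_line_bdd). assert (B := gap_line_inv_bdd). assert (C := wp_d1_line_bdd). assert (E := wp_d2_line_bdd).
    repeat first [assumption | apply bdd_const | apply bdd_minus | apply bdd_opp | apply bdd_plus | apply bdd_mult].
Qed.

(** [y = u / s] with [u = w' - T w].  If [u] vanishes identically, so does
    [u' + T u = 2 D w]. *)
Lemma lame_to_q : lame_bdd tau om z0 lam -> spectral_set om tau p z0 T.
Proof.
  intros [W [dW [HW [[t0 Hn] BW]]]]. apply spectral_set_param; [easy|].
  assert (BdW := lame_derivative_bdd tau Htau om Hom Hom0 z0 line_off_z0 lam W dW HW BW).
  destruct sqrt_branch as [s [sn [sd [sb sib]]]].
  set (u := fun t => dW t - T * W t). set (du := fun t => 2 * wp_gap (L t) * W t - T * u t).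
  assert (Hl : forall t, 2 * P (L t) + lam = 2 * wp_gap (L t) + T ^ 2) by (intros; unfold lam, wp_gap; ring).
  assert (Du : forall t, rdiff u t (om * du t)).
  { intros t. destruct (HW t) as [A B]. rewrite Hl in B. eapply diff_eq; [apply diff_minus; [exact B|apply diff_scal, A]|].
    unfold du, u. ring. }
  assert (Ddu : forall t, rdiff du t (om * (2 * W1 (L t) * W t + 2 * wp_gap (L t) * dW t - T * du t))).
  { intros t. eapply diff_eq.
    - apply diff_minus; [apply diff_mult; [apply diff_scal, gap_line_diff|apply HW]|apply diff_scal, Du].
    - cbv beta. ring. }
  exists (fun t => u t / s t), (fun t => (du t - W1 (L t) / (2 * wp_gap (L t)) * u t) / s t). split; [|split].
  - intros t. assert (Dn := gap_line_neq0 t). assert (N2 : 2 * wp_gap (L t) <> 0).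
    { apply Cmult_neq_0; [intros X; apply RtoC_inj in X; lra|easy]. } split.
    + eapply diff_eq; [apply diff_div; [easy|apply Du|apply sd]|]. field. auto.
    + eapply diff_eq.
      * apply diff_div; [easy| |apply sd]. apply diff_minus; [apply Ddu|]. apply diff_mult; [|apply Du].
        apply diff_div; [easy|apply wp_d1_line_diff|apply diff_scal, gap_line_diff].
      * cbv beta. rewrite q_formula by apply Hgood. unfold du, u. field. auto.
  - destruct (excluded_middle_informative (exists t, u t / s t <> 0)) as [e|ne]; [easy|exfalso].
    assert (U0 : forall t, u t = 0).
    { intros t. destruct (excluded_middle_informative (u t / s t = 0)) as [e|n]; [|exfalso; eauto].
      replace (u t) with (u t / s t * s t) by (field; auto). rewrite e. ring. }
    assert (D0 : om * du t0 = 0).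
    { apply (rdiff_unique u t0); [apply Du|]. apply diff_ext with (fun _ => RtoC 0); [intros; now rewrite U0|apply diff_const]. }
    unfold du in D0. rewrite U0 in D0.
    assert (N : om * (2 * wp_gap (L t0) * W t0) <> 0).
    { repeat apply Cmult_neq_0; auto using gap_line_neq0. intros X; apply RtoC_inj in X; lra. }
    apply N. rewrite <- D0. ring.
  - apply bdd_mult; [|exact sib]. apply bdd_minus; [exact BdW|]. apply bdd_mult; [apply bdd_const|exact BW].
Qed.

(** The inverse [w = (u' + T u) / (2 D)] with [u = s y]; here [w' - T w = u], so
    that [w] does not vanish identically. *)
Lemma q_to_lame : spectral_set om tau p z0 T -> lame_bdd tau om z0 lam.
Proof.
  intros H. apply spectral_set_param in H; [|easy]. destruct H as [Y [dY [HY [[t0 Hn] BY]]]].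
  assert (BdY : bdd dY).
  { apply bdd_ext with (fun t => / om * (om * dY t)); [intros; field; easy|]. apply bdd_mult; [apply bdd_const|].
    apply (landau Y (fun t => om * dY t) (fun t => om * (om * (q tau p T (L t) * Y t)))).
    - intros; apply HY.
    - intros; apply diff_scal, HY.
    - easy.
    - repeat (apply bdd_mult; [apply bdd_const|]). apply bdd_mult; [apply q_line_bdd|easy]. }
  destruct sqrt_branch as [s [sn [sd [sb sib]]]].
  set (u := fun t => s t * Y t). set (du := fun t => s t * (dY t + W1 (L t) / (2 * wp_gap (L t)) * Y t)).
  assert (Du : forall t, rdiff u t (om * du t)).
  { intros t. assert (Dn := gap_line_neq0 t). eapply diff_eq; [apply diff_mult; [apply sd|apply HY]|].
    unfold du. field. easy. }
  assert (Ddu : forall t, rdiff du t (om * (W1 (L t) / wp_gap (L t) * du t + (2 * wp_gap (L t) + T ^ 2 + T * (W1 (L t) / wp_gap (L t))) * u t))).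
  { intros t. assert (Dn := gap_line_neq0 t). assert (N2 : 2 * wp_gap (L t) <> 0).
    { apply Cmult_neq_0; [intros X; apply RtoC_inj in X; lra|easy]. } eapply diff_eq.
    - apply diff_mult; [apply sd|]. apply diff_plus; [apply HY|]. apply diff_mult; [|apply HY].
      apply diff_div; [easy|apply wp_d1_line_diff|apply diff_scal, gap_line_diff].
    - cbv beta. rewrite q_formula by apply Hgood. unfold du, u. field. auto. }
  assert (Hl : forall t, 2 * P (L t) + lam = 2 * wp_gap (L t) + T ^ 2) by (intros; unfold lam, wp_gap; ring).
  set (W := fun t => (du t + T * u t) / (2 * wp_gap (L t))).
  exists W, (fun t => u t + T * W t).
  assert (DW : forall t, rdiff W t (om * (u t + T * W t))).
  { intros t. assert (Dn := gap_line_neq0 t). assert (N2 : 2 * wp_gap (L t) <> 0).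
    { apply Cmult_neq_0; [intros X; apply RtoC_inj in X; lra|easy]. } eapply diff_eq.
    - apply diff_div; [easy|apply diff_plus; [apply Ddu|apply diff_scal, Du]|apply diff_scal, gap_line_diff].
    - cbv beta. unfold W. field. auto. }
  split; [|split].
  - intros t. split; [apply DW|]. eapply diff_eq; [apply diff_plus; [apply Du|apply diff_scal, DW]|].
    rewrite Hl. unfold W. field. apply gap_line_neq0.
  - destruct (excluded_middle_informative (exists t, W t <> 0)) as [e|ne]; [easy|exfalso].
    assert (Z0 : forall t, W t = 0).
    { intros t. destruct (excluded_middle_informative (W t = 0)) as [e|n]; [easy|]. exfalso. eauto. }
    assert (D0 : om * (u t0 + T * W t0) = 0).
    { apply (rdiff_unique W t0); [apply DW|]. apply diff_ext with (fun _ => RtoC 0); [intros; now rewrite Z0|apply diff_const]. }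
    rewrite Z0 in D0.
    assert (N : om * (s t0 * Y t0) <> 0) by (repeat apply Cmult_neq_0; auto).
    apply N. rewrite <- D0. unfold u. ring.
  - assert (Bu : bdd u) by (now apply bdd_mult).
    assert (Bdu : bdd du).
    { apply bdd_mult; [easy|]. apply bdd_plus; [easy|]. apply bdd_mult; [|easy].
      apply bdd_ext with (fun t => / 2 * (W1 (L t) * / wp_gap (L t))); [intros; field; apply gap_line_neq0|].
      apply bdd_mult; [apply bdd_const|]. apply bdd_mult; [apply wp_d1_line_bdd|apply gap_line_inv_bdd]. }
    apply bdd_ext with (fun t => (du t + T * u t) * (/ 2 * / wp_gap (L t))); [intros; unfold W; field; apply gap_line_neq0|].
    apply bdd_mult; [apply bdd_plus; [easy|apply bdd_mult; [apply bdd_const|easy]]|].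
    apply bdd_mult; [apply bdd_const|apply gap_line_inv_bdd].
Qed.

Lemma spectral_iff_lame : spectral_set om tau p z0 T <-> lame_bdd tau om z0 lam.
Proof. split; [apply q_to_lame|apply lame_to_q]. Qed.
End Line.

(** * Smooth lines avoid the poles of the potential *)

(** [c] is the coefficient of [1 / (v - z) ^ 2] of a function with at most a double
    pole at [z]. *)
Definition extends (f : C -> C) z (c : C) : Prop := exists g : C -> C, cont dC g z /\ g z = c /\
  exists r, (0 < r)%R /\ forall v, (0 < Cmod (v - z) < r)%R -> (v - z) ^ 2 * f v = g v.

Lemma extends_cont f z : cont dC f z -> extends f z 0.
Proof.
  intros H. exists (fun v => (v - z) ^ 2 * f v). split; [|split].
  - apply cont_mult; [|easy]. apply cont_pow, cont_minus; [apply cont_id|apply cont_const].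
  - ring.
  - exists 1%R. split; [lra|easy].
Qed.

Lemma extends_plus f g z c d : extends f z c -> extends g z d -> extends (fun v => f v + g v) z (c + d).
Proof.
  intros [F [C1 [E1 [r1 [R1 H1]]]]] [G [C2 [E2 [r2 [R2 H2]]]]].
  exists (fun v => F v + G v). split; [now apply cont_plus|]. split; [now rewrite E1, E2|].
  exists (Rmin r1 r2). split; [now apply Rmin_pos|]. intros v Hv.
  rewrite <- H1, <- H2; [ring| |]; (split; [easy|]); eapply Rlt_le_trans; try apply Hv; [apply Rmin_r|apply Rmin_l].
Qed.

Lemma extends_scal k f z c : extends f z c -> extends (fun v => k * f v) z (k * c).
Proof.
  intros [F [C1 [E1 [r1 [R1 H1]]]]]. exists (fun v => k * F v). split; [apply cont_mult; [apply cont_const|easy]|].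
  split; [now rewrite E1|]. exists r1. split; [easy|]. intros v Hv. rewrite <- H1 by easy. ring.
Qed.

Lemma extends_ext f g z c : (forall v, f v = g v) -> extends f z c -> extends g z c.
Proof.
  intros E [F [C1 [E1 [r1 [R1 H1]]]]]. exists F. split; [easy|split; [easy|]]. exists r1. split; [easy|].
  intros v Hv. rewrite <- E. auto.
Qed.

Lemma extends_wp_pole z a m n : z + a = lp m n -> extends (fun v => P (v + a)) z 1.
Proof.
  intros E. destruct (nl_near_0 tau Htau) as [r [Hr F]].
  exists (fun v => 1 + (v - z) ^ 2 * wp_reg tau (v - z)). split; [|split].
  - assert (Cv : cont dC (fun v => v - z) z) by (apply cont_minus; [apply cont_id|apply cont_const]).
    apply cont_plus; [apply cont_const|]. apply cont_mult; [now apply cont_pow|].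
    apply (cont_comp dC (wp_reg tau) (fun v => v - z)); [|easy]. replace (z - z) with (RtoC 0) by ring. now apply wp_reg_cont_0.
  - replace (z - z) with (RtoC 0) by ring. ring.
  - exists r. split; [easy|]. intros v Hv. assert (N := F (v - z) Hv).
    replace (v + a) with (v - z + lp m n) by (rewrite <- E; ring). rewrite wp_lp, wp_split by easy.
    field. now apply (nl_neq0 tau Htau).
Qed.

Lemma zeta_lp m n : exists c, forall z, zeta (z + lp m n) = zeta z + c.
Proof.
  assert (A : forall om, is_period tau om -> forall k, exists c, forall z, zeta (z + IZR (Z.of_nat k) * om) = zeta z + c).
  { intros om Hom k. induction k as [|k [c IH]].
    - exists 0. intros z. simpl. replace (z + 0 * om) with z by ring. ring.
    - exists (c + eta tau om). intros z. rewrite Nat2Z.inj_succ, succ_IZR, RtoC_plus.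
      replace (z + (IZR (Z.of_nat k) + 1) * om) with (z + IZR (Z.of_nat k) * om + om) by ring.
      rewrite zeta_period, IH by easy. ring. }
  assert (B : forall om, is_period tau om -> forall k, exists c, forall z, zeta (z + IZR k * om) = zeta z + c).
  { intros om Hom k. destruct (Z.le_ge_cases 0 k) as [h|h].
    - destruct (A om Hom (Z.to_nat k)) as [c H]. exists c. intros z. rewrite <- H. now rewrite Z2Nat.id.
    - destruct (A om Hom (Z.to_nat (- k))) as [c H]. exists (- c). intros z.
      specialize (H (z + IZR k * om)). rewrite Z2Nat.id, opp_IZR, RtoC_opp in H by lia.
      replace (z + IZR k * om + - IZR k * om) with z in H by ring. rewrite H. ring. }
  destruct (B 1 (or_introl eq_refl) m) as [c1 H1]. destruct (B tau (or_intror eq_refl) n) as [c2 H2].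
  exists (c1 + c2). intros z. unfold lattice_point. replace (z + (IZR m + IZR n * tau)) with (z + IZR m * 1 + IZR n * tau) by ring.
  rewrite H2, H1. ring.
Qed.

Lemma extends_zeta_pole z a m n : z + a = lp m n -> extends (fun v => zeta (v + a)) z 0.
Proof.
  intros E. destruct (zeta_lp m n) as [c Hc].
  exists (fun v => (v - z) + (v - z) ^ 2 * (zeta_reg tau (v - z) + c)). split; [|split].
  - assert (Cv : cont dC (fun v => v - z) z) by (apply cont_minus; [apply cont_id|apply cont_const]).
    apply cont_plus; [easy|]. apply cont_mult; [now apply cont_pow|]. apply cont_plus; [|apply cont_const].
    apply (cont_comp dC (zeta_reg tau) (fun v => v - z)); [|easy]. replace (z - z) with (RtoC 0) by ring. now apply zeta_reg_cont_0.
  - ring.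
  - exists 1%R. split; [lra|]. intros v Hv.
    replace (v + a) with (v - z + lp m n) by (rewrite <- E; ring). rewrite Hc, wzeta_split.
    field. apply Cmod_gt_0. apply Hv.
Qed.

Lemma extends_wp z a : exists c : R, (c = 0%R \/ c = 1%R) /\ extends (fun v => P (v + a)) z c /\ (~ nl (z + a) -> c = 1%R) .
Proof.
  destruct (excluded_middle_informative (nl (z + a))) as [H|H].
  - exists 0%R. split; [now left|]. split; [|easy]. apply extends_cont, (cont_shift P), wp_cont; easy.
  - exists 1%R. split; [now right|]. split; [|easy]. destruct (not_nl tau _ H) as [m [n E]]. now apply extends_wp_pole with m n.
Qed.

Lemma extends_zeta z a : extends (fun v => zeta (v + a)) z 0.
Proof.
  destruct (excluded_middle_informative (nl (z + a))) as [H|H].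
  - apply extends_cont, (cont_shift zeta), zeta_cont; easy.
  - destruct (not_nl tau _ H) as [m [n E]]. now apply extends_zeta_pole with m n.
Qed.

(** The three double poles of [q] have the positive coefficients 2, 3/4 and 3/4, so
    that they cannot cancel even where they coincide. *)
Lemma q_extends z : ~ off_poles z -> exists c, c <> 0 /\ extends (q tau p 0) z c.
Proof.
  intros H.
  destruct (extends_wp z 0) as [c0 [D0 [X0 N0]]]. destruct (extends_wp z p) as [c1 [D1 [X1 N1]]].
  destruct (extends_wp z (- p)) as [c2 [D2 [X2 N2]]].
  exists (2 * c0 + (3/4 * (c1 + c2) + 0)). split.
  - assert (S : (0 < 2 * c0 + 3/4 * (c1 + c2))%R).
    { assert (c0 = 1 \/ c1 = 1 \/ c2 = 1)%R as [e|[e|e]]; [|lra|lra|lra].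
      destruct (excluded_middle_informative (nl (z + 0))) as [h0|h0]; [|left; auto].
      destruct (excluded_middle_informative (nl (z + p))) as [h1|h1]; [|right; left; auto].
      destruct (excluded_middle_informative (nl (z + - p))) as [h2|h2]; [|right; right; auto].
      exfalso. apply H. replace (z + 0) with z in h0 by ring. replace (z + - p) with (z - p) in h2 by ring. now split. }
    intros E. apply (f_equal Re) in E. replace (2 * c0 + (3/4 * (c1 + c2) + 0)) with (RtoC (2 * c0 + 3/4 * (c1 + c2))) in E.
    + simpl in E. lra.
    + rewrite RtoC_plus, !RtoC_mult, RtoC_div, RtoC_plus by lra. ring.
  - set (k := wp'' tau p / (4 * wp' tau p)).
    apply extends_ext with (fun v => 2 * P (v + 0) + (3/4 * (P (v + p) + P (v + - p)) +
      (- k * (zeta (v + p) + RtoC (-1) * zeta (v + - p)) + Bconst tau p 0))).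
    + intros v. unfold q. fold k. replace (v + 0) with v by ring. replace (v + - p) with (v - p) by ring. ring.
    + apply extends_plus; [now apply extends_scal|]. apply extends_plus; [apply extends_scal; now apply extends_plus|].
      replace (RtoC 0) with (- k * (0 + RtoC (-1) * 0) + 0) by ring.
      apply extends_plus; [|apply extends_cont, cont_const].
      apply extends_scal, extends_plus; [apply extends_zeta|]. apply extends_scal, extends_zeta.
Qed.

(** At a pole on the line [(v - z) ^ 2 * q v] would tend to [c <> 0], whereas the
    continuity of [q] along the line makes it tend to 0. *)
Lemma smooth_off_poles (om z0 : C) : om <> 0 -> smooth_on_line om (fun x => q tau p 0 (x + z0)) -> forall t : R, off_poles (z0 + om * t).
Proof.
  intros H0 [Dn [E Hd]] t.
  destruct (excluded_middle_informative (off_poles (z0 + om * t))) as [h|h]; [easy|exfalso].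
  destruct (q_extends _ h) as [c [Hc [g [Cg [Eg [r [Hr Hg]]]]]]].
  assert (C : cont dR (fun s : R => q tau p 0 (om * s + z0)) t).
  { assert (A := Hd 0%nat (om * t) (ex_intro _ t eq_refl)). apply line_derive_rdiff in A.
    apply cont_ext with (fun s : R => Dn 0%nat (om * s)).
    - intros s. apply E. now exists s.
    - eapply rdiff_cont, A. }
  set (z := z0 + om * t) in *.
  set (F := fun s : R => (om * RtoC (s - t)) ^ 2 * q tau p 0 (om * s + z0) - g (z0 + om * s)).
  assert (CF : cont dR F t).
  { apply cont_minus.
    - apply cont_mult; [|exact C]. apply cont_pow, cont_mult; [apply cont_const|]. apply cont_dI_dR.
      apply cont_ext with (fun s : R => RtoC s - RtoC t); [intros; now rewrite RtoC_minus|].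
      apply cont_minus; [apply cont_i|apply cont_const].
    - apply (line_cont om g z0 t). exact Cg. }
  assert (Ft : F t = - c).
  { unfold F. fold z. rewrite Eg. replace (t - t)%R with 0%R by ring. ring. }
  assert (Pom : (0 < Cmod om)%R) by now apply Cmod_gt_0.
  destruct (CF (Cmod c)) as [del [Hdel FF]]; [now apply Cmod_gt_0|].
  set (eps := Rmin (del / 2) (r / (2 * Cmod om))).
  assert (He : (0 < eps)%R) by (apply Rmin_pos; [lra|apply Rdiv_lt_0_compat; lra]).
  assert (He1 : (eps <= del / 2)%R) by apply Rmin_l. assert (He2 : (eps <= r / (2 * Cmod om))%R) by apply Rmin_r.
  specialize (FF (t + eps)%R). unfold dR in FF. replace (t + eps - t)%R with eps in FF by ring.
  rewrite Rabs_pos_eq in FF by lra. specialize (FF ltac:(lra)).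
  assert (Z : F (t + eps)%R = 0).
  { unfold F. replace (t + eps - t)%R with eps by ring. replace (om * RtoC (t + eps) + z0) with (z0 + om * RtoC (t + eps)) by ring.
    set (v := z0 + om * RtoC (t + eps)). assert (Ev : om * eps = v - z) by (unfold v, z; rewrite RtoC_plus; ring).
    rewrite Ev, Hg; [ring|]. rewrite <- Ev, Cmod_mult, Cmod_R, Rabs_pos_eq by lra. split; [nra|].
    apply Rle_lt_trans with (Cmod om * (r / (2 * Cmod om)))%R; [apply Rmult_le_compat_l; lra|].
    replace (Cmod om * (r / (2 * Cmod om)))%R with (r / 2)%R by (field; lra). lra. }
  rewrite Z, Ft in FF. replace (0 - - c) with c in FF by ring. lra.
Qed.

(** * The spectral sets *)

Lemma sigma1_iff z0 T : smooth_on_line 1 (fun x => q tau p 0 (x + z0)) ->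
  sigma1 tau p z0 T <-> band1 tau (T ^ 2 - 2 * P p).
Proof.
  intros Hs. assert (N1 : RtoC 1 <> 0) by (intros X; apply RtoC_inj in X; lra).
  assert (G := smooth_off_poles 1 z0 N1 Hs). unfold sigma1.
  rewrite (spectral_iff_lame 1 z0 T (or_introl eq_refl) N1 G).
  destruct (wp_surjective tau Htau (T ^ 2 - 2 * P p)) as [a [Ha Ea]]. rewrite <- Ea.
  destruct (coord_exists tau Htau a) as [x [y Exy]]. replace (x * 1 + y * tau) with (x + y * tau) in Exy by ring.
  rewrite (lame_bdd_iff tau Htau 1 tau); auto.
  - subst a. rewrite exponent_zero_iff_1 by easy. now apply band1_iff.
  - now left.
  - now right.
  - intros u v. replace (u * 1 + v * tau) with (u + v * tau) by ring. now apply not_nl_coord.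
  - apply coord_exists, Htau.
  - apply eta_swap_real, Htau.
  - intros t. apply G.
Qed.

Lemma sigma2_iff z0 T : smooth_on_line tau (fun x => q tau p 0 (x + z0)) ->
  sigma2 tau p z0 T <-> band2 tau (T ^ 2 - 2 * P p).
Proof.
  intros Hs. assert (N1 := tau_neq0 tau Htau).
  assert (G := smooth_off_poles tau z0 N1 Hs). unfold sigma2.
  rewrite (spectral_iff_lame tau z0 T (or_intror eq_refl) N1 G).
  destruct (wp_surjective tau Htau (T ^ 2 - 2 * P p)) as [a [Ha Ea]]. rewrite <- Ea.
  destruct (coord_exists tau Htau a) as [x [y Exy]]. replace (x * 1 + y * tau) with (x + y * tau) in Exy by ring.
  rewrite (lame_bdd_iff tau Htau tau 1); auto.
  - subst a. rewrite exponent_zero_iff_tau by easy. now apply band2_iff.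
  - now right.
  - now left.
  - intros u v. replace (u * tau + v * 1) with (v + u * tau) by ring. rewrite not_nl_coord by easy. tauto.
  - intros z. destruct (coord_exists tau Htau z) as [u [v E]]. exists v, u. rewrite E. ring.
  - assert (E := eta_swap_real tau Htau). replace (tau * eta tau 1 - eta tau tau * 1) with (- (1 * eta tau tau - eta tau 1 * tau)) by ring.
    rewrite Re_opp, E. ring.
  - intros t. apply G.
Qed.
End Potential.

Local Close Scope C_scope.
Local Open Scope R_scope.

Lemma sq_le_iff (s x : R) : 0 <= s -> (- s <= x <= s <-> x * x <= s * s).
Proof. intros Hs. split; [intros; nra|]. intros H. split; nra. Qed.

Lemma sq_ge_iff (s x : R) : 0 <= s -> (x <= - s \/ s <= x <-> s * s <= x * x).
Proof.
  intros Hs. split; [intros [H|H]; nra|]. intros H.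
  destruct (Rle_lt_dec s x); [now right|left]. nra.
Qed.

Lemma sq_between_iff (r s x : R) : 0 <= r -> 0 <= s ->
  (- s <= x <= - r \/ r <= x <= s <-> r * r <= x * x <= s * s).
Proof.
  intros Hr Hs. split; [intros [H|H]; nra|]. intros [H1 H2].
  apply sq_le_iff in H2; [|easy]. apply sq_ge_iff in H1; [|easy]. lra.
Qed.

Lemma rays_iff (s : R) (T : C) : 0 <= s ->
  (imag_ray_below (- s) T \/ imag_ray_above s T <-> Re T = 0 /\ s * s <= Im T * Im T).
Proof.
  intros Hs. rewrite <- (sq_ge_iff s (Im T) Hs). unfold imag_ray_below, imag_ray_above. tauto.
Qed.

Lemma imag_seg_iff (s : R) (T : C) : 0 <= s ->
  (imag_seg (- s) s T <-> Re T = 0 /\ Im T * Im T <= s * s).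
Proof. intros Hs. now rewrite <- (sq_le_iff s (Im T) Hs). Qed.

Lemma imag_segs_iff (r s : R) (T : C) : 0 <= r -> 0 <= s ->
  (imag_seg (- s) (- r) T \/ imag_seg r s T <-> Re T = 0 /\ r * r <= Im T * Im T <= s * s).
Proof.
  intros Hr Hs. rewrite <- (sq_between_iff r s (Im T) Hr Hs). unfold imag_seg. tauto.
Qed.

Lemma real_seg_iff (s : R) (T : C) : 0 <= s ->
  (real_seg (- s) s T <-> Im T = 0 /\ Re T * Re T <= s * s).
Proof. intros Hs. now rewrite <- (sq_le_iff s (Re T) Hs). Qed.

Lemma real_segs_iff (r s : R) (T : C) : 0 <= r -> 0 <= s ->
  (real_seg (- s) (- r) T \/ real_seg r s T <-> Im T = 0 /\ r * r <= Re T * Re T <= s * s).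
Proof.
  intros Hr Hs. rewrite <- (sq_between_iff r s (Re T) Hr Hs). unfold real_seg. tauto.
Qed.

Lemma Cmult_eq_0 (z w : C) : (z * w = 0)%C -> z = 0%C \/ w = 0%C.
Proof.
  intros H. destruct (excluded_middle_informative (z = 0%C)) as [e|n]; [now left|].
  destruct (excluded_middle_informative (w = 0%C)) as [e|n']; [now right|].
  exfalso. now apply (Cmult_neq_0 _ _ n n').
Qed.

(** [x] and [y] stand for the real and imaginary parts of [T], and [c_k] for
    [2 wp p + e_k]. *)
Definition in_band1 (c1 c2 c3 x y : R) : Prop := x * y = 0 /\ (x * x - y * y <= c2 \/ c3 <= x * x - y * y <= c1).
Definition in_band2 (c1 c2 c3 x y : R) : Prop := x * y = 0 /\ (c2 <= x * x - y * y <= c3 \/ c1 <= x * x - y * y).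

Ltac find_branch :=
  first [exfalso; lra | repeat split; lra | left; find_branch | right; find_branch].

Ltac band_cases T :=
  unfold in_band1; generalize (Re T) (Im T);
  let x := fresh "x" in let y := fresh "y" in let E := fresh "E" in let K := fresh "K" in
  intros x y;
  assert (0 <= x * x) by apply Rle_0_sqr; assert (0 <= y * y) by apply Rle_0_sqr;
  split;
  [ intros [E K]; apply Rmult_integral in E; destruct E as [E|E]; subst; destruct K as [K|K];
    try (assert (x = 0) by nra; subst); try (assert (y = 0) by nra; subst); find_branch
  | intros K; repeat match goal with L : _ \/ _ |- _ => destruct L end;
    repeat match goal with L : _ /\ _ |- _ => destruct L end; subst; (split; [ring|find_branch]) ].

Theorem theorem2p10 (tau p z0 : C)
  (Htau : Re tau = 0 /\ 0 < Im tau)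
  (Hp : forall k : nat, (k <= 3)%nat ->
          ~ in_lattice tau (p - omega tau k / 2)%C)
  (Hreal : Im (wp tau p) = 0)
  (Hz1 : forall T : C, smooth_on_line 1 (fun x : C => q tau p T (x + z0)%C))
  (Hz2 : forall T : C, smooth_on_line tau (fun x : C => q tau p T (x + z0)%C)) :
  let P := Re (wp tau p) in
  let e1 := Re (e tau 1) in
  let e2 := Re (e tau 2) in
  let e3 := Re (e tau 3) in
  let a1 := a tau p 1 in
  let a2 := a tau p 2 in
  let a3 := a tau p 3 in
  let b1 := b tau p 1 in
  let b2 := b tau p 2 in
  let b3 := b tau p 3 in
  let s1 := sigma1 tau p z0 in
  let s2 := sigma2 tau p z0 in
  (forall T : C, s1 T -> real_axis T \/ imag_axis T) /\
  (forall T : C, s2 T -> real_axis T \/ imag_axis T) /\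
  (forall T : C, s1 T \/ s2 T <-> real_axis T \/ imag_axis T) /\
  (forall T : C, s1 T /\ s2 T <-> Qpoly tau p T = 0) /\
  (P < - e1 / 2 ->
   forall T : C, s1 T <->
     imag_ray_below (- b2) T \/ imag_seg (- b3) (- b1) T \/
     imag_seg b1 b3 T \/ imag_ray_above b2 T) /\
  (P = - e1 / 2 ->
   forall T : C, s1 T <->
     imag_ray_below (- b2) T \/ imag_seg (- b3) b3 T \/ imag_ray_above b2 T) /\
  (- e1 / 2 < P < - e3 / 2 ->
   forall T : C, s1 T <->
     imag_ray_below (- b2) T \/ imag_seg (- b3) b3 T \/
     imag_ray_above b2 T \/ real_seg (- a1) a1 T) /\
  (P = - e3 / 2 ->
   forall T : C, s1 T <->
     imag_ray_below (- b2) T \/ imag_ray_above b2 T \/ real_seg (- a1) a1 T) /\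
  (- e3 / 2 < P < - e2 / 2 ->
   forall T : C, s1 T <->
     imag_ray_below (- b2) T \/ imag_ray_above b2 T \/
     real_seg (- a1) (- a3) T \/ real_seg a3 a1 T) /\
  (P = - e2 / 2 ->
   forall T : C, s1 T <->
     imag_axis T \/ real_seg (- a1) (- a3) T \/ real_seg a3 a1 T) /\
  (- e2 / 2 < P ->
   forall T : C, s1 T <->
     imag_axis T \/ real_seg (- a1) (- a3) T \/
     real_seg (- a2) a2 T \/ real_seg a3 a1 T).
Proof.
  intros P e1 e2 e3 a1 a2 a3 b1 b2 b3 s1 s2.
  assert (L23 : e2 < e3) by exact (root2_lt_root3 tau Htau).
  assert (L31 : e3 < e1) by exact (root3_lt_root1 tau Htau).
  set (c1 := 2 * P + e1). set (c2 := 2 * P + e2). set (c3 := 2 * P + e3).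
  assert (HRe : forall T : C, Re (T ^ 2 - 2 * wp tau p)%C = Re T * Re T - Im T * Im T - 2 * P).
  { intros T. replace (T ^ 2)%C with (T * T)%C by ring. autorewrite with cre. rewrite Hreal. unfold P. ring. }
  assert (HIm : forall T : C, Im (T ^ 2 - 2 * wp tau p)%C = 2 * (Re T * Im T)).
  { intros T. replace (T ^ 2)%C with (T * T)%C by ring. autorewrite with cre. rewrite Hreal. ring. }
  assert (S1 : forall T, s1 T <-> in_band1 c1 c2 c3 (Re T) (Im T)).
  { intros T. unfold s1. rewrite (sigma1_iff tau p Htau Hp z0 T (Hz1 0%C)).
    unfold band1, in_band1. rewrite HRe, HIm.
    change (root1 tau) with e1. change (root2 tau) with e2. change (root3 tau) with e3. unfold c1, c2, c3.
    split; intros [A B]; (split; [lra|]); lra. }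
  assert (S2 : forall T, s2 T <-> in_band2 c1 c2 c3 (Re T) (Im T)).
  { intros T. unfold s2. rewrite (sigma2_iff tau p Htau Hp z0 T (Hz2 0%C)).
    unfold band2, in_band2. rewrite HRe, HIm.
    change (root1 tau) with e1. change (root2 tau) with e2. change (root3 tau) with e3. unfold c1, c2, c3.
    split; intros [A B]; (split; [lra|]); lra. }
  assert (Ax : forall T, Re T * Im T = 0 <-> real_axis T \/ imag_axis T).
  { intros T. unfold real_axis, imag_axis. split.
    - intros H. apply Rmult_integral in H. tauto.
    - intros [H|H]; rewrite H; ring. }
  assert (SqA : forall k, 0 <= 2 * P + Re (e tau k) -> 0 <= a tau p k /\ a tau p k * a tau p k = 2 * P + Re (e tau k)).
  { intros k H. split; [apply sqrt_pos|now apply sqrt_sqrt]. }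
  assert (SqB : forall k, 2 * P + Re (e tau k) <= 0 -> 0 <= b tau p k /\ b tau p k * b tau p k = - (2 * P + Re (e tau k))).
  { intros k H. split; [apply sqrt_pos|]. apply sqrt_sqrt. fold P. lra. }
  split; [|split; [|split; [|split; [|split; [|split; [|split; [|split; [|split; [|split]]]]]]]]].
  - intros T H. apply Ax. exact (proj1 (proj1 (S1 T) H)).
  - intros T H. apply Ax. exact (proj1 (proj1 (S2 T) H)).
  - intros T. rewrite S1, S2, <- Ax. unfold in_band1, in_band2, c1, c2, c3 in *. split; [tauto|]. intros H.
    destruct (Rle_lt_dec (Re T * Re T - Im T * Im T) (2 * P + e2)); [left; split; [easy|lra]|].
    destruct (Rle_lt_dec (Re T * Re T - Im T * Im T) (2 * P + e3)); [right; split; [easy|lra]|].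
    destruct (Rle_lt_dec (Re T * Re T - Im T * Im T) (2 * P + e1)); [left; split; [easy|lra]|right; split; [easy|lra]].
  - intros T. rewrite S1, S2. unfold Qpoly.
    rewrite (root1_correct tau Htau), (root2_correct tau Htau), (root3_correct tau Htau).
    change (root1 tau) with e1. change (root2 tau) with e2. change (root3 tau) with e3.
    set (lam := (T ^ 2 - 2 * wp tau p)%C) in *.
    assert (Lk : forall r : R, (lam - r)%C = 0%C <-> Re T * Im T = 0 /\ Re T * Re T - Im T * Im T = 2 * P + r).
    { intros r. assert (X := HRe T). assert (Y := HIm T). fold lam in X, Y. split.
      - intros H. assert (A := f_equal Re H). assert (B := f_equal Im H). rewrite Re_minus, X, !Re_RtoC in A. rewrite Im_minus, Y, !Im_RtoC in B.
        split; lra.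
      - intros [A B]. apply C_ext; [rewrite Re_minus, X, !Re_RtoC|rewrite Im_minus, Y, !Im_RtoC]; lra. }
    transitivity ((lam - e1)%C = 0%C \/ (lam - e2)%C = 0%C \/ (lam - e3)%C = 0%C).
    + rewrite !Lk. unfold in_band1, in_band2, c1, c2, c3.
      split; [intros [[A B] [_ D]]|intros [[A B]|[[A B]|[A B]]]; split; split; try easy; lra].
      destruct B as [B|B], D as [D|D].
      * right; left. split; [easy|lra].
      * exfalso. lra.
      * right; right. split; [easy|lra].
      * left. split; [easy|lra].
    + split.
      * intros [H|[H|H]]; rewrite H; apply C_ext; simpl; ring.
      * intros H. apply Cmult_eq_0 in H. destruct H as [H|H].
        { exfalso. apply (f_equal Re) in H. simpl in H. lra. }
        apply Cmult_eq_0 in H. destruct H as [H|H]; [|tauto]. apply Cmult_eq_0 in H. tauto.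
  - intros HP T.
    destruct (SqB 1%nat) as [P1 Q1]; [fold e1; lra|]. fold b1 in P1, Q1. fold e1 in Q1. fold c1 in Q1.
    destruct (SqB 2%nat) as [P2 Q2]; [fold e2; lra|]. fold b2 in P2, Q2. fold e2 in Q2. fold c2 in Q2.
    destruct (SqB 3%nat) as [P3 Q3]; [fold e3; lra|]. fold b3 in P3, Q3. fold e3 in Q3. fold c3 in Q3.
    assert (C23 : c2 < c3) by (unfold c2, c3; lra). assert (C31 : c3 < c1) by (unfold c1, c3; lra).
    assert (N1 : c1 < 0) by (unfold c1; lra).
    transitivity ((Re T = 0 /\ b2 * b2 <= Im T * Im T) \/ (Re T = 0 /\ b1 * b1 <= Im T * Im T <= b3 * b3)).
    + rewrite S1, Q1, Q2, Q3. clearbody c1 c2 c3. clear - C23 C31 N1. band_cases T.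
    + rewrite <- rays_iff, <- imag_segs_iff by easy. unfold imag_axis. tauto.
  - intros HP T.
    destruct (SqB 2%nat) as [P2 Q2]; [fold e2; lra|]. fold b2 in P2, Q2. fold e2 in Q2. fold c2 in Q2.
    destruct (SqB 3%nat) as [P3 Q3]; [fold e3; lra|]. fold b3 in P3, Q3. fold e3 in Q3. fold c3 in Q3.
    assert (C23 : c2 < c3) by (unfold c2, c3; lra). assert (C31 : c3 < c1) by (unfold c1, c3; lra).
    assert (N1 : c1 = 0) by (unfold c1; lra).
    transitivity ((Re T = 0 /\ b2 * b2 <= Im T * Im T) \/ (Re T = 0 /\ Im T * Im T <= b3 * b3)).
    + rewrite S1, Q2, Q3. clearbody c1 c2 c3. clear - C23 C31 N1. band_cases T.
    + rewrite <- rays_iff, <- imag_seg_iff by easy. unfold imag_axis. tauto.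
  - intros HP T.
    destruct (SqA 1%nat) as [P1 Q1]; [fold e1; lra|]. fold a1 in P1, Q1. fold e1 in Q1. fold c1 in Q1.
    destruct (SqB 2%nat) as [P2 Q2]; [fold e2; lra|]. fold b2 in P2, Q2. fold e2 in Q2. fold c2 in Q2.
    destruct (SqB 3%nat) as [P3 Q3]; [fold e3; lra|]. fold b3 in P3, Q3. fold e3 in Q3. fold c3 in Q3.
    assert (C23 : c2 < c3) by (unfold c2, c3; lra). assert (C31 : c3 < c1) by (unfold c1, c3; lra).
    assert (N1 : 0 < c1) by (unfold c1; lra).
    assert (N3 : c3 < 0) by (unfold c3; lra).
    transitivity ((Re T = 0 /\ b2 * b2 <= Im T * Im T) \/ (Re T = 0 /\ Im T * Im T <= b3 * b3) \/ (Im T = 0 /\ Re T * Re T <= a1 * a1)).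
    + rewrite S1, Q1, Q2, Q3. clearbody c1 c2 c3. clear - C23 C31 N1 N3. band_cases T.
    + rewrite <- rays_iff, <- imag_seg_iff, <- real_seg_iff by easy. unfold imag_axis. tauto.
  - intros HP T.
    destruct (SqA 1%nat) as [P1 Q1]; [fold e1; lra|]. fold a1 in P1, Q1. fold e1 in Q1. fold c1 in Q1.
    destruct (SqB 2%nat) as [P2 Q2]; [fold e2; lra|]. fold b2 in P2, Q2. fold e2 in Q2. fold c2 in Q2.
    assert (C23 : c2 < c3) by (unfold c2, c3; lra). assert (C31 : c3 < c1) by (unfold c1, c3; lra).
    assert (N3 : c3 = 0) by (unfold c3; lra).
    transitivity ((Re T = 0 /\ b2 * b2 <= Im T * Im T) \/ (Im T = 0 /\ Re T * Re T <= a1 * a1)).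
    + rewrite S1, Q1, Q2. clearbody c1 c2 c3. clear - C23 C31 N3. band_cases T.
    + rewrite <- rays_iff, <- real_seg_iff by easy. unfold imag_axis. tauto.
  - intros HP T.
    destruct (SqA 1%nat) as [P1 Q1]; [fold e1; lra|]. fold a1 in P1, Q1. fold e1 in Q1. fold c1 in Q1.
    destruct (SqB 2%nat) as [P2 Q2]; [fold e2; lra|]. fold b2 in P2, Q2. fold e2 in Q2. fold c2 in Q2.
    destruct (SqA 3%nat) as [P3 Q3]; [fold e3; lra|]. fold a3 in P3, Q3. fold e3 in Q3. fold c3 in Q3.
    assert (C23 : c2 < c3) by (unfold c2, c3; lra). assert (C31 : c3 < c1) by (unfold c1, c3; lra).
    assert (N3 : 0 < c3) by (unfold c3; lra).
    assert (N2 : c2 < 0) by (unfold c2; lra).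
    transitivity ((Re T = 0 /\ b2 * b2 <= Im T * Im T) \/ (Im T = 0 /\ a3 * a3 <= Re T * Re T <= a1 * a1)).
    + rewrite S1, Q1, Q2, Q3. clearbody c1 c2 c3. clear - C23 C31 N3 N2. band_cases T.
    + rewrite <- rays_iff, <- real_segs_iff by easy. unfold imag_axis. tauto.
  - intros HP T.
    destruct (SqA 1%nat) as [P1 Q1]; [fold e1; lra|]. fold a1 in P1, Q1. fold e1 in Q1. fold c1 in Q1.
    destruct (SqA 3%nat) as [P3 Q3]; [fold e3; lra|]. fold a3 in P3, Q3. fold e3 in Q3. fold c3 in Q3.
    assert (C23 : c2 < c3) by (unfold c2, c3; lra). assert (C31 : c3 < c1) by (unfold c1, c3; lra).
    assert (N2 : c2 = 0) by (unfold c2; lra).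
    transitivity (Re T = 0 \/ (Im T = 0 /\ a3 * a3 <= Re T * Re T <= a1 * a1)).
    + rewrite S1, Q1, Q3. clearbody c1 c2 c3. clear - C23 C31 N2. band_cases T.
    + rewrite <- real_segs_iff by easy. unfold imag_axis. tauto.
  - intros HP T.
    destruct (SqA 1%nat) as [P1 Q1]; [fold e1; lra|]. fold a1 in P1, Q1. fold e1 in Q1. fold c1 in Q1.
    destruct (SqA 2%nat) as [P2 Q2]; [fold e2; lra|]. fold a2 in P2, Q2. fold e2 in Q2. fold c2 in Q2.
    destruct (SqA 3%nat) as [P3 Q3]; [fold e3; lra|]. fold a3 in P3, Q3. fold e3 in Q3. fold c3 in Q3.
    assert (C23 : c2 < c3) by (unfold c2, c3; lra). assert (C31 : c3 < c1) by (unfold c1, c3; lra).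
    assert (N2 : 0 < c2) by (unfold c2; lra).
    transitivity (Re T = 0 \/ (Im T = 0 /\ Re T * Re T <= a2 * a2) \/ (Im T = 0 /\ a3 * a3 <= Re T * Re T <= a1 * a1)).
    + rewrite S1, Q1, Q2, Q3. clearbody c1 c2 c3. clear - C23 C31 N2. band_cases T.
    + rewrite <- real_seg_iff, <- real_segs_iff by easy. unfold imag_axis. tauto.
Qed.
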